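(* Let $R \in \mathbb{C}_p(z)$ be a rational function of degree at least two and let $X \subset \mathbb{P}(\mathbb{C}_p)$ be an analytic space such that $R(X) \subset X$. Then $X$ intersects an immediate basin of attraction of $R$ or the quasi-periodicity domain $\mathcal{E}(R)$ of $R$.
   Context: $p$ is a prime, $\mathbb{C}_p$ is the completion of an algebraic closure of $\mathbb{Q}_p$, $|\cdot|$ its norm, $\mathbb{P}(\mathbb{C}_p) = \mathbb{C}_p \cup \{\infty\}$, and $\Delta$ is the chordal distance, $\Delta([x,y],[x',y']) = |xy'-x'y| / (\max\{|x|,|y|\}\max\{|x'|,|y'|\})$. Balls: for $a \in \mathbb{C}_p$ and $r \in |\mathbb{C}_p^*|$, $\{|z-a|<r\}$ is an open ball and $\{|z-a|\le r\}$ a closed ball of $\mathbb{C}_p$. An open (resp. closed) ball of $\mathbb{P}(\mathbb{C}_p)$ is an open (resp. closed) ball of $\mathbb{C}_p$ or the complement in $\mathbb{P}(\mathbb{C}_p)$ of a closed (resp. open) ball of $\mathbb{C}_p$. An open (resp. closed) affinoid is a nonempty finite intersection of open (resp. closed) balls. An analytic space is a (finite or infinite) union of closed affinoids all containing a common point. Analytic component: for $U \subset \mathbb{P}(\mathbb{C}_p)$ open and $x \in U$, the analytic component of $U$ containing $x$ is the union of all open affinoids contained in $U$ and containing $x$. A periodic point $z_0$ with $R^n(z_0)=z_0$ ($n$ its primitive period) is attracting if its multiplier $\lambda=(R^n)'(z_0)$ satisfies $|\lambda|<1$. Its basin of attraction is the set of $x$ with $\Delta(R^n(x),R^n(z_0))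 \to 0$ as $n\to\infty$, and its immediate basin of attraction is the analytic component of its basin that contains $z_0$. The quasi-periodicity domain $\mathcal{E}(R)$ is the interior of the set of points of $\mathbb{P}(\mathbb{C}_p)$ recurrent under $R$ (i.e. $x$ is the limit of $R^{n_j}(x)$ for some $n_j \to \infty$). *)

(* Defs.v *)
From HB Require Import structures.
From mathcomp Require Import all_boot all_order all_algebra.
From mathcomp Require Import boolp classical_sets reals topology normedtype.

Set Implicit Arguments.
Unset Strict Implicit.
Unset Printing Implicit Defensive.

Import Order.TTheory GRing.Theory Num.Theory.
Import numFieldNormedType.Exports.

Local Open Scope classical_set_scope.
Local Open Scope ring_scope.

(** * The field C_p

    MathComp has no p-adic numbers.  We do not construct C_p; instead [is_Cp]
    says that a field with an absolute value is a completion of an algebraic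
    closure of a completion of (Q, |.|_p).  This determines C_p up to isometric
    isomorphism. *)

(** Normalised by |p| = 1/p. *)
Definition padic_abs (R : realType) (p : nat) (x : rat) : R :=
  if x == 0 then 0
  else p%:R ^ ((logn p `|denq x|)%:Z - (logn p `|numq x|)%:Z).

Record is_nonarch_abs (R : realType) (K : fieldType) (v : K -> R) : Prop :=
  IsNonarchAbs {
    nonarch_abs_ge0 : forall x, 0 <= v x;
    nonarch_abs_eq0 : forall x, v x = 0 <-> x = 0;
    nonarch_absM : forall x y, v (x * y) = v x * v y;
    nonarch_absD : forall x y, v (x + y) <= Num.max (v x) (v y)
  }.

Definition abs_complete (R : realType) (K : fieldType) (v : K -> R) : Prop :=
  forall u : nat -> K,
    (forall e : R, 0 < e ->
       exists N : nat, forall m n : nat,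
         (N <= m)%N -> (N <= n)%N -> v (u m - u n) < e) ->
    exists l : K, (fun n => v (u n - l)) @ \oo --> (0 : R).

Record is_completion (R : realType) (K L : fieldType) (vK : K -> R)
    (vL : L -> R) (f : {rmorphism K -> L}) : Prop := IsCompletion {
  completion_abs : is_nonarch_abs vL;
  completion_isometry : forall x, vL (f x) = vK x;
  completion_dense : forall (y : L) (e : R), 0 < e -> exists x, vL (y - f x) < e;
  completion_complete : abs_complete vL
}.

(** Algebraic closedness of [L] is carried by its type. *)
Record is_algebraic_closure (R : realType) (K : fieldType)
    (L : closedFieldType) (vK : K -> R) (vL : L -> R)
    (f : {rmorphism K -> L}) : Prop := IsAlgebraicClosure {
  algebraic_closure_abs : is_nonarch_abs vL;
  algebraic_closure_isometry : forall x, vL (f x) = vK x;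
  algebraic_closure_algebraic : forall y : L, algebraicOver f y
}.

Definition is_Cp (R : realType) (p : nat) (C : fieldType) (abs : C -> R) : Prop :=
  exists (Qp : fieldType) (absQp : Qp -> R) (iQ : {rmorphism rat -> Qp})
         (Qpbar : closedFieldType) (absQpbar : Qpbar -> R)
         (iQp : {rmorphism Qp -> Qpbar}) (iQpbar : {rmorphism Qpbar -> C}),
    [/\ is_completion (@padic_abs R p) absQp iQ,
        is_algebraic_closure absQp absQpbar iQp
      & is_completion absQpbar abs iQpbar].

(** * The projective line *)

(** [None] is the point at infinity. *)
Definition P1 (C : fieldType) : Type := option C.

Definition P1_infty (C : fieldType) : P1 C := None.

Definition P1_coord (C : fieldType) (z : P1 C) : C * C :=
  if z is Some x then (x, 1) else (1, 0).

(** The point [x : y]; a junk value when x = y = 0. *)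
Definition P1_point (C : fieldType) (x y : C) : P1 C :=
  if y == 0 then P1_infty C else Some (x / y).

Definition chordal (R : realType) (C : fieldType) (abs : C -> R)
    (z w : P1 C) : R :=
  let: (x, y) := P1_coord z in
  let: (x', y') := P1_coord w in
  abs (x * y' - x' * y)
    / (Num.max (abs x) (abs y) * Num.max (abs x') (abs y')).

Definition chordal_interior (R : realType) (C : fieldType) (abs : C -> R)
    (A : set (P1 C)) : set (P1 C) :=
  [set x | exists2 e : R, 0 < e & [set y | chordal abs x y < e] `<=` A].

(** * Balls, affinoids, analytic spaces *)

Definition open_disk (R : realType) (C : fieldType) (abs : C -> R)
    (a : C) (r : R) : set (P1 C) :=
  [set Some z | z in [set z | abs (z - a) < r]].

Definition closed_disk (R : realType) (C : fieldType) (abs : C -> R)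
    (a : C) (r : R) : set (P1 C) :=
  [set Some z | z in [set z | abs (z - a) <= r]].

(** Radii range over the value group |C^*|. *)
Definition is_open_ball (R : realType) (C : fieldType) (abs : C -> R)
    (B : set (P1 C)) : Prop :=
  exists a c : C, c != 0 /\
    (B = open_disk abs a (abs c) \/ B = ~` closed_disk abs a (abs c)).

Definition is_closed_ball (R : realType) (C : fieldType) (abs : C -> R)
    (B : set (P1 C)) : Prop :=
  exists a c : C, c != 0 /\
    (B = closed_disk abs a (abs c) \/ B = ~` open_disk abs a (abs c)).

(** Intersections are over at least one ball. *)
Definition is_open_affinoid (R : realType) (C : fieldType) (abs : C -> R)
    (A : set (P1 C)) : Prop :=
  A !=set0 /\
  exists (n : nat) (B : 'I_n.+1 -> set (P1 C)),
    (forall i, is_open_ball abs (B i)) /\ A = \bigcap_i B i.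

Definition is_closed_affinoid (R : realType) (C : fieldType) (abs : C -> R)
    (A : set (P1 C)) : Prop :=
  A !=set0 /\
  exists (n : nat) (B : 'I_n.+1 -> set (P1 C)),
    (forall i, is_closed_ball abs (B i)) /\ A = \bigcap_i B i.

(** The family is required to be nonempty, so that X really contains the common
    point [x]; otherwise the empty set would be an analytic space. *)
Definition is_analytic_space (R : realType) (C : fieldType) (abs : C -> R)
    (X : set (P1 C)) : Prop :=
  exists (F : set (set (P1 C))) (x : P1 C),
    [/\ F !=set0,
        forall A, F A -> is_closed_affinoid abs A /\ A x
      & X = \bigcup_(A in F) A].

Definition analytic_component (R : realType) (C : fieldType) (abs : C -> R)
    (U : set (P1 C)) (x : P1 C) : set (P1 C) :=
  \bigcup_(A in [set A | [/\ is_open_affinoid abs A, A `<=` U & A x]]) A.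

(** * Rational functions

    The representative of an element of the fraction field need not be reduced,
    so the common factor is divided out.  The resulting coprime pair is
    canonical up to a common nonzero constant, which affects none of the
    definitions below. *)

Notation ratfun C := {fraction {poly C}}.

Definition rat_gcd (C : fieldType) (f : ratfun C) : {poly C} :=
  gcdp (\n_(repr f)) (\d_(repr f)).

Definition rat_num (C : fieldType) (f : ratfun C) : {poly C} :=
  \n_(repr f) %/ rat_gcd f.

Definition rat_den (C : fieldType) (f : ratfun C) : {poly C} :=
  \d_(repr f) %/ rat_gcd f.

Definition rat_degree (C : fieldType) (f : ratfun C) : nat :=
  (maxn (size (rat_num f)) (size (rat_den f))).-1.

(** At infinity: homogenise numerator and denominator in degree [rat_degree f]
    and evaluate at [1 : 0]. *)
Definition rat_map (C : fieldType) (f : ratfun C) (z : P1 C) : P1 C :=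
  if z is Some x then P1_point (rat_num f).[x] (rat_den f).[x]
  else P1_point (rat_num f)`_(rat_degree f) (rat_den f)`_(rat_degree f).

Definition rat_id (C : fieldType) : ratfun C := tofrac ('X : {poly C}).

Definition rat_eval (C : fieldType) (q : {poly C}) (g : ratfun C) : ratfun C :=
  (map_poly (@tofrac {poly C} \o polyC) q).[g].

(** [f] composed with [g]; meaningful when [g] is nonconstant. *)
Definition rat_comp (C : fieldType) (f g : ratfun C) : ratfun C :=
  rat_eval (rat_num f) g / rat_eval (rat_den f) g.

Definition rat_iter (C : fieldType) (n : nat) (f : ratfun C) : ratfun C :=
  iter n (rat_comp f) (rat_id C).

(** Derivative at a finite point which is not a pole. *)
Definition rat_deriv_at (C : fieldType) (f : ratfun C) (x : C) : C :=
  ((rat_num f)^`().[x] * (rat_den f).[x]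
     - (rat_num f).[x] * (rat_den f)^`().[x]) / (rat_den f).[x] ^+ 2.

(** f conjugated by z |-> 1/z. *)
Definition rat_conj_inv (C : fieldType) (f : ratfun C) : ratfun C :=
  rat_comp (rat_id C)^-1 (rat_comp f (rat_id C)^-1).

(** * Dynamics *)

Definition has_primitive_period (C : fieldType) (f : ratfun C) (z0 : P1 C)
    (n : nat) : Prop :=
  [/\ (0 < n)%N, iter n (rat_map f) z0 = z0
    & forall m : nat, (0 < m < n)%N -> iter m (rat_map f) z0 <> z0].

(** (f^n)'(z0) for a fixed point z0 of f^n; at infinity it is computed in the
    coordinate 1/z. *)
Definition multiplier (C : fieldType) (f : ratfun C) (n : nat) (z0 : P1 C) : C :=
  if z0 is Some x then rat_deriv_at (rat_iter n f) x
  else rat_deriv_at (rat_conj_inv (rat_iter n f)) 0.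

Definition is_attracting (R : realType) (C : fieldType) (abs : C -> R)
    (f : ratfun C) (z0 : P1 C) : Prop :=
  exists2 n : nat, has_primitive_period f z0 n & abs (multiplier f n z0) < 1.

Definition basin (R : realType) (C : fieldType) (abs : C -> R)
    (f : ratfun C) (z0 : P1 C) : set (P1 C) :=
  [set x | (fun k => chordal abs (iter k (rat_map f) x)
                               (iter k (rat_map f) z0)) @ \oo --> (0 : R)].

Definition immediate_basin (R : realType) (C : fieldType) (abs : C -> R)
    (f : ratfun C) (z0 : P1 C) : set (P1 C) :=
  analytic_component abs (basin abs f z0) z0.

Definition recurrent_set (R : realType) (C : fieldType) (abs : C -> R)
    (f : ratfun C) : set (P1 C) :=
  [set x | exists n_ : nat -> nat, n_ @ \oo --> \oo /\
     (fun j => chordal abs (iter (n_ j) (rat_map f) x) x) @ \oo --> (0 : R)].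

Definition quasi_periodicity_domain (R : realType) (C : fieldType)
    (abs : C -> R) (f : ratfun C) : set (P1 C) :=
  chordal_interior abs (recurrent_set abs f).

(* Main.v *)
Require Import Defs.
From mathcomp Require Import all_boot all_order all_algebra.
From mathcomp Require Import boolp classical_sets reals topology normedtype sequences.
From mathcomp Require Import lra ring zify.

Set Implicit Arguments.
Unset Strict Implicit.
Unset Printing Implicit Defensive.

Import Order.TTheory GRing.Theory Num.Theory.
Import numFieldNormedType.Exports.

Local Open Scope classical_set_scope.
Local Open Scope ring_scope.

(** A nonrepelling fixed point w exists, because the sum of 1 / (1 - lambda)
    over the fixed points is 1.  If every neighbourhood of w meets X, a small
    disk around w works in what follows.  Otherwise move w to infinity by a
    Moebius map: X becomes a bounded subset of C_p without poles.

    The disks D(a, r) are points of the Berkovich tree, and R acts on them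
    through Gauss norms.  Call D(a, r) contracted if its image lies below it,
    that is, if the Gauss norm of R(z) - z on it is at most r.  As long as the
    image lies strictly below, one can move down to a smaller contracted disk,
    and bounding how often the zeros and poles of R(z) - z can be lost this way
    ends at a disk fixed by R or at an attracting fixed point.  On a fixed disk
    R acts as a rational map over the residue field, which is algebraic over
    F_p, so residue classes have finite orbits.  Either way some open disk that
    meets X is mapped into itself by an iterate F of R.

    On such a disk F has an attracting fixed point whose basin contains the
    disk, or an iterate of F is uniformly closer to the identity than the
    radius of some closed subdisk; in that case the iterates of order p^k tend
    to the identity there, and all its points are recurrent. *)

(** The tree itself is never built. A disk enters only through Gauss norms of a few polynomials, and
    two properties carry the argument: for a radius in the value group the Gauss norm is the value
    at a generic point of the disk, and as a function of the radius it is piecewise a monomial with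
    an integer exponent. Radii outside the value group have to be handled by the second property
    alone.

    The obstacle is that C_p is not spherically complete: decreasing contracted disks can have empty
    intersection, so there need not be a limit disk. Minimising the number of fixed points and poles
    in the disk makes all smaller contracted disks share a fixed point, which then serves as a
    common centre.

    X need not contain the disks that occur. The common point of its affinoids gives a weaker
    convexity: if X contains a and a point at distance at least r from a, then it contains D(a, r)
    up to finitely many residue classes.

    Algebraicity of the residue field is used twice: for the orbits of residue classes, and for a
    multiplier of norm 1, some power of which reduces to 1. *)

(** * Ultrametric absolute values *)

Section Nonarch.
Context (R : realType) (K : fieldType) (abs : K -> R).
Hypothesis abs_na : is_nonarch_abs abs.

Lemma nabs_ge0 x : 0 <= abs x. Proof. exact: (nonarch_abs_ge0 abs_na). Qed.

Lemma nabs0 : abs 0 = 0. Proof. by apply/(nonarch_abs_eq0 abs_na). Qed.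

Lemma nabsM x y : abs (x * y) = abs x * abs y.
Proof. exact: (nonarch_absM abs_na). Qed.

Lemma nabs_eq0 x : (abs x == 0) = (x == 0).
Proof. by apply/eqP/eqP => /(nonarch_abs_eq0 abs_na). Qed.

Lemma nabs_gt0 x : (0 < abs x) = (x != 0).
Proof. by rewrite lt_def nabs_ge0 andbT nabs_eq0. Qed.

Lemma nabs1 : abs 1 = 1.
Proof.
have h : abs 1 * abs 1 = abs 1 * 1 by rewrite -nabsM !mulr1.
by apply: (mulfI _ h); rewrite nabs_eq0 oner_neq0.
Qed.

Lemma nabsX x n : abs (x ^+ n) = abs x ^+ n.
Proof. by elim: n => [|n IH]; rewrite ?expr0 ?nabs1 // !exprS nabsM IH. Qed.

Lemma nabsN x : abs (- x) = abs x.
Proof.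
have h : abs (-1) = 1.
  apply/eqP; rewrite -(@pexpr_eq1 _ _ 2) ?nabs_ge0 //.
  by rewrite -nabsX sqrrN expr1n nabs1.
by rewrite -mulN1r nabsM h mul1r.
Qed.

Lemma nabsV x : abs x^-1 = (abs x)^-1.
Proof.
have [->|x0] := eqVneq x 0; first by rewrite invr0 nabs0 invr0.
apply: (@mulfI _ (abs x)); first by rewrite nabs_eq0.
by rewrite -nabsM !divff ?nabs1 // nabs_eq0.
Qed.

Lemma nabs_div x y : abs (x / y) = abs x / abs y.
Proof. by rewrite nabsM nabsV. Qed.

Lemma nabs_sub x y : abs (x - y) = abs (y - x).
Proof. by rewrite -nabsN opprB. Qed.

Lemma nabs_prod (I : Type) (s : seq I) (F : I -> K) :
  abs (\prod_(i <- s) F i) = \prod_(i <- s) abs (F i).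
Proof. exact: (big_morph abs nabsM nabs1). Qed.

Lemma nabsD_le x y r : abs x <= r -> abs y <= r -> abs (x + y) <= r.
Proof.
move=> hx hy; apply: le_trans (nonarch_absD abs_na x y) _.
by rewrite ge_max hx hy.
Qed.

Lemma nabsD_lt x y r : abs x < r -> abs y < r -> abs (x + y) < r.
Proof.
move=> hx hy; apply: le_lt_trans (nonarch_absD abs_na x y) _.
by rewrite gt_max hx hy.
Qed.

Lemma nabsB_le x y r : abs x <= r -> abs y <= r -> abs (x - y) <= r.
Proof. by move=> hx hy; apply: nabsD_le; rewrite ?nabsN. Qed.

Lemma nabsB_lt x y r : abs x < r -> abs y < r -> abs (x - y) < r.
Proof. by move=> hx hy; apply: nabsD_lt; rewrite ?nabsN. Qed.

Lemma nabs_dist_le y x z r : abs (x - y) <= r -> abs (y - z) <= r -> abs (x - z) <= r.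
Proof. by move=> hx hy; rewrite -(subrKA y); apply: nabsD_le. Qed.

Lemma nabs_dist_lt y x z r : abs (x - y) < r -> abs (y - z) < r -> abs (x - z) < r.
Proof. by move=> hx hy; rewrite -(subrKA y); apply: nabsD_lt. Qed.

Lemma nabsDl x y : abs y < abs x -> abs (x + y) = abs x.
Proof.
move=> h; apply/le_anti/andP; split; first by apply: nabsD_le => //; exact: ltW.
rewrite leNgt; apply/negP => h2.
have : abs (x + y - y) < abs x by apply: nabsB_lt.
by rewrite addrK ltxx.
Qed.

Lemma nabsDr x y : abs x < abs y -> abs (x + y) = abs y.
Proof. by move=> h; rewrite addrC nabsDl. Qed.

Lemma nabsBl x y : abs y < abs x -> abs (x - y) = abs x.
Proof. by move=> h; rewrite nabsDl // nabsN. Qed.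

Lemma nabsBr x y : abs x < abs y -> abs (x - y) = abs y.
Proof. by move=> h; rewrite nabsDr ?nabsN. Qed.

Lemma nabs_dist_eq x y z : abs (x - y) < abs (y - z) -> abs (x - z) = abs (y - z).
Proof.
move=> h; have -> : x - z = (y - z) + (x - y) by ring.
by rewrite nabsDl.
Qed.

Lemma nabs_sum_le (I : Type) (s : seq I) (P : pred I) (F : I -> K) r :
  0 <= r -> (forall i, P i -> abs (F i) <= r) -> abs (\sum_(i <- s | P i) F i) <= r.
Proof.
move=> r0 h; elim/big_ind: _ => //; first by rewrite nabs0.
by move=> x y; exact: nabsD_le.
Qed.

Lemma nabs_nat_le1 n : abs n%:R <= 1.
Proof.
elim: n => [|n IH]; first by rewrite nabs0.
by rewrite -addn1 natrD; apply: nabsD_le => //; rewrite nabs1.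
Qed.

Lemma nabs_int_le1 (n : int) : abs n%:~R <= 1.
Proof.
case: n => n; first exact: nabs_nat_le1.
by rewrite NegzE mulrNz nabsN; exact: nabs_nat_le1.
Qed.

Lemma nabsX_sub_le x y n : abs x <= 1 -> abs y <= 1 ->
  abs (x ^+ n - y ^+ n) <= abs (x - y).
Proof.
move=> hx hy; rewrite subrXX nabsM ler_piMr ?nabs_ge0 //.
apply: nabs_sum_le => // i _; rewrite nabsM !nabsX.
by rewrite mulr_ile1 ?exprn_ge0 ?nabs_ge0 // exprn_ile1 ?nabs_ge0.
Qed.

End Nonarch.

(** * Gauss norms *)

Definition alg_closed (K : fieldType) : Prop :=
  forall P : {poly K}, (1 < size P)%N -> exists x, root P x.

Definition value_group (R : realType) (K : fieldType) (abs : K -> R) : set R :=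
  [set r | exists2 c : K, c != 0 & abs c = r].

Definition splits_as (K : fieldType) (P : {poly K}) (s : seq K) : Prop :=
  P = lead_coef P *: \prod_(x <- s) ('X - x%:P).

(** The junk value [::] is never met over an algebraically closed field. *)
Definition poly_roots (K : fieldType) (P : {poly K}) : seq K :=
  xget [::] (splits_as P).

(** For r in the value group this is the supremum of |P| on D(a, r).  The
    product form makes it piecewise monomial in r. *)
Definition gauss_norm (R : realType) (K : fieldType) (abs : K -> R)
    (P : {poly K}) (a : K) (r : R) : R :=
  abs (lead_coef P) * \prod_(x <- poly_roots P) Num.max r (abs (a - x)).

Lemma poly_splits (K : fieldType) (K_closed : alg_closed K) (P : {poly K}) :
  splits_as P (poly_roots P).
Proof.
suff : exists s, splits_as P s by move/(@xgetPex _ [::]).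
have [n] := ubnP (size P); elim: n P => // n IH P ltP.
have [le1|gt1] := leqP (size P) 1.
  exists [::]; rewrite /splits_as big_nil alg_polyC.
  by rewrite {1}(size1_polyC le1) /lead_coef; case: (size P) le1 => [|[]].
have [x /factor_theorem [Q defP]] := K_closed P gt1.
have Q0 : Q != 0 by apply: contraTneq gt1 => Q0; rewrite defP Q0 mul0r size_poly0.
have szP : size P = (size Q).+1.
  by rewrite defP size_Mmonic ?monicXsubC // size_XsubC addn2.
have [s defQ] : exists s, splits_as Q s by apply: IH; rewrite -ltnS -szP.
exists (x :: s); rewrite /splits_as big_cons {2}defP lead_coef_Mmonic ?monicXsubC //.
by rewrite {1}defP {1}defQ -scalerAl mulrC.
Qed.

Section GaussNorm.
Context (R : realType) (K : fieldType) (abs : K -> R).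
Hypothesis (na : is_nonarch_abs abs) (K_closed : alg_closed K).

Local Notation gn := (gauss_norm abs).
Local Notation vg := (value_group abs).

Lemma horner_splits (P : {poly K}) z :
  P.[z] = lead_coef P * \prod_(x <- poly_roots P) (z - x).
Proof.
rewrite {1}(poly_splits K_closed P) hornerZ horner_prod.
by congr (_ * _); apply: eq_bigr => x _; rewrite hornerXsubC.
Qed.

Lemma nabs_horner (P : {poly K}) z :
  abs P.[z] = abs (lead_coef P) * \prod_(x <- poly_roots P) abs (z - x).
Proof. by rewrite horner_splits (nabsM na) // (nabs_prod na). Qed.

Lemma mem_poly_roots (P : {poly K}) x : P != 0 -> (x \in poly_roots P) = root P x.
Proof.
move=> P0; rewrite /root horner_splits mulf_eq0 lead_coef_eq0 (negPf P0) /=.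
by rewrite -(root_prod_XsubC (poly_roots P) x) /root horner_prod; congr (_ == _);
  apply: eq_bigr => y _; rewrite hornerXsubC.
Qed.

(** If x is farther than r from one centre, the isosceles property gives the same distance from the
    other; otherwise both maxima equal r. *)
Lemma max_dist_eq r a b x : abs (a - b) <= r ->
  Num.max r (abs (a - x)) = Num.max r (abs (b - x)).
Proof.
wlog le_ab : a b / abs (a - x) <= abs (b - x).
  move=> H hr; case: (leP (abs (a - x)) (abs (b - x))) => [/H ->//|/ltW h].
  by apply/esym/(H _ _ h); rewrite (nabs_sub na).
move=> hr; case: (leP (abs (b - x)) r) => h; first by rewrite !max_l // (le_trans le_ab).
have /(nabs_dist_eq na) e : abs (a - b) < abs (b - x) by apply: le_lt_trans h.
by rewrite e !max_r // ltW.
Qed.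

Lemma gn_center P a b r : abs (a - b) <= r -> gn P a r = gn P b r.
Proof.
by move=> h; congr (_ * _); apply: eq_bigr => x _; apply: max_dist_eq.
Qed.

Lemma gn0 a r : gn 0 a r = 0.
Proof. by rewrite /gauss_norm lead_coef0 (nabs0 na) // mul0r. Qed.

Lemma gn_ge0 P a r : 0 <= gn P a r.
Proof.
rewrite mulr_ge0 ?(nabs_ge0 na) //; apply: prodr_ge0 => x _.
by rewrite le_max (nabs_ge0 na) // orbT.
Qed.

Lemma gn_gt0 P a r : P != 0 -> 0 < r -> 0 < gn P a r.
Proof.
move=> P0 r0; rewrite mulr_gt0 ?(nabs_gt0 na) ?lead_coef_eq0 //.
by apply: prodr_gt0 => x _; rewrite lt_max r0.
Qed.

Lemma gn_homo P a r r' : r <= r' -> gn P a r <= gn P a r'.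
Proof.
move=> h; rewrite ler_wpM2l ?(nabs_ge0 na) //; apply: ler_prod => x _.
by rewrite le_max (nabs_ge0 na) // orbT /= ge_max !le_max h lexx orbT.
Qed.

Lemma gn_ub P a r z : abs (z - a) <= r -> abs P.[z] <= gn P a r.
Proof.
move=> h; rewrite nabs_horner // ler_wpM2l ?(nabs_ge0 na) //; apply: ler_prod => x _.
by rewrite (nabs_ge0 na) //= -(max_dist_eq x h) le_max lexx orbT.
Qed.

Lemma gn_generic P a r z : abs (z - a) <= r ->
  (forall x, x \in poly_roots P -> r <= abs (z - x)) -> abs P.[z] = gn P a r.
Proof.
move=> h hx; rewrite nabs_horner //; congr (_ * _); apply: eq_big_seq => x xs.
by rewrite -(max_dist_eq x h) max_r // hx.
Qed.

Lemma gn_generic_roots P a r z : P != 0 -> abs (z - a) <= r ->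
  (forall x, root P x -> r <= abs (z - x)) -> abs P.[z] = gn P a r.
Proof.
by move=> P0 h hx; apply: gn_generic => // x; rewrite mem_poly_roots //; apply: hx.
Qed.

Lemma vg_gt0 r : vg r -> 0 < r.
Proof. by move=> [c c0 <-]; rewrite (nabs_gt0 na). Qed.

Lemma vgM r s : vg r -> vg s -> vg (r * s).
Proof.
move=> [c c0 <-] [d d0 <-]; exists (c * d); by [rewrite mulf_neq0|rewrite (nabsM na)].
Qed.

Lemma vgV r : vg r -> vg r^-1.
Proof. by move=> [c c0 <-]; exists c^-1; [rewrite invr_eq0|rewrite (nabsV na)]. Qed.

Lemma vgX r n : vg r -> vg (r ^+ n).
Proof. by move=> [c c0 <-]; exists (c ^+ n); [rewrite expf_neq0|rewrite (nabsX na)]. Qed.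

Lemma vg_root r n : (0 < n)%N -> 0 <= r -> vg (r ^+ n) -> vg r.
Proof.
move=> n0 r0 [c c0 hc].
have /K_closed[x] : (1 < size ('X^n - c%:P : {poly K})%R)%N by rewrite size_XnsubC.
rewrite rootE !hornerE subr_eq0 => /eqP hx.
have hr : abs x = r.
  apply/eqP; rewrite -(@eqrXn2 _ n) ?(nabs_ge0 na) //.
  by rewrite -(nabsX na) // hx hc.
exists x => //; rewrite -(nabs_gt0 na) hr lt_def r0 andbT.
by apply: contra c0 => /eqP r00; rewrite -(nabs_eq0 na) hc r00 expr0n; case: n n0 {hx hc}.
Qed.

(** After rescaling to the unit disk, finitely many residue classes must be avoided. A root t of the
    equation prod (t - y) = 1 avoids them: |t| <= 1, since otherwise the product would be too large,
    so all factors have norm at most 1, and since their product has norm 1 each of them has norm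
    1. *)
Lemma generic_point (L : seq K) a r : vg r ->
  exists2 z, abs (z - a) <= r & forall x, x \in L -> r <= abs (z - x).
Proof.
move=> [c c0 hr].
have r0 : 0 < r by rewrite -hr (nabs_gt0 na).
(* The entry 0 makes the list nonempty, so the polynomial below is not constant. *)
pose L1 := 0 :: [seq (x - a) / c | x <- L & abs (x - a) <= r].
have L1le y : y \in L1 -> abs y <= 1.
  rewrite inE => /orP[/eqP->|/mapP[x]]; first by rewrite (nabs0 na).
  by rewrite mem_filter => /andP[hx _] ->; rewrite (nabs_div na) // hr ler_pdivrMr // mul1r.
have /K_closed[t] : (1 < size (\prod_(y <- L1) ('X - y%:P) - 1%:P)%R)%N.
  by rewrite size_polyDl size_prod_XsubC //= size_polyN size_polyC oner_eq0.
rewrite rootE hornerD hornerN hornerC subr_eq0 horner_prod => /eqP ht.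
have pt : \prod_(y <- L1) abs (t - y) = 1.
  rewrite -(nabs_prod na) //; have -> : \prod_(y <- L1) (t - y) = 1.
    by rewrite -[RHS]ht; apply: eq_bigr => y _; rewrite hornerXsubC.
  exact: (nabs1 na).
have t1 : abs t <= 1.
  rewrite leNgt; apply/negP => t1.
  have e y : y \in L1 -> abs (t - y) = abs t.
    by move=> /L1le y1; apply: (nabsBl na) => //; apply: le_lt_trans t1.
  have : 1 < \prod_(y <- L1) abs (t - y).
    rewrite (eq_big_seq _ e) big_cons.
    apply: (lt_le_trans t1); rewrite ler_peMr ?(nabs_ge0 na) //.
    by elim/big_rec: _ => // i x _ hx; rewrite -[1]mulr1 ler_pM // ltW.
  by rewrite pt ltxx.
have tL y : y \in L1 -> abs (t - y) = 1.
  move=> yL; apply/le_anti/andP; split; first by apply: (nabsB_le na) => //; apply: L1le.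
  have : all (fun z => abs (t - z) <= 1) L1.
    by apply/allP => z zL; apply: (nabsB_le na) => //; apply: L1le.
  move: (L1) yL pt => s ys pt; rewrite (perm_all _ (perm_to_rem ys)) => /= /andP[_ hs].
  rewrite -pt (perm_big _ (perm_to_rem ys)) big_cons -[X in _ <= X]mulr1 ler_wpM2l ?(nabs_ge0 na) //.
  elim: (rem y s) hs => [|z s' IH] /=; first by rewrite big_nil.
  move=> /andP[h /IH h2]; rewrite big_cons mulr_ile1 ?(nabs_ge0 na) //.
  by apply: prodr_ge0 => i _; apply: (nabs_ge0 na).
exists (a + c * t); first by rewrite addrC addKr (nabsM na) hr ler_piMr // ltW.
move=> x xL; case: (leP (abs (x - a)) r) => hx.
  have /tL e : (x - a) / c \in L1.
    by rewrite inE; apply/orP; right; apply/mapP; exists x => //; rewrite mem_filter hx.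
  rewrite -[X in X <= _]mulr1 -e -{1}hr -(nabsM na) le_eqVlt; apply/orP; left.
  by apply/eqP; congr abs; field.
have -> : a + c * t - x = c * t - (x - a) by ring.
have h : abs (c * t) < abs (x - a) by rewrite (nabsM na) hr (le_lt_trans _ hx) // ler_piMr // ltW.
by rewrite (nabsBr na) // ltW.
Qed.

(** One generic point computes the Gauss norms of several polynomials at once, so relations between
    Gauss norms reduce to relations between norms of elements of K. *)
Lemma gn_gen (Ps : seq {poly K}) (L : seq K) a r : vg r ->
  exists z, [/\ abs (z - a) <= r, forall x, x \in L -> r <= abs (z - x)
    & forall P, P \in Ps -> abs P.[z] = gn P a r].
Proof.
move=> /(generic_point (L ++ flatten (map (@poly_roots K) Ps)) a) [z za zL].
exists z; split=> // [x xL|P PP]; first by apply: zL; rewrite mem_cat xL.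
apply: gn_generic => // x xP; apply: zL; rewrite mem_cat; apply/orP; right.
by apply/flattenP; exists (poly_roots P) => //; apply: map_f.
Qed.

Lemma gnM P Q a r : vg r -> gn (P * Q) a r = gn P a r * gn Q a r.
Proof.
move=> /(gn_gen [:: P * Q; P; Q] [::] a) [z [_ _ h]].
by rewrite -!h ?inE ?eqxx ?orbT // hornerM (nabsM na).
Qed.

Lemma gnB_le P Q a r M : vg r -> gn P a r <= M -> gn Q a r <= M -> gn (P - Q) a r <= M.
Proof.
move=> /(gn_gen [:: P - Q; P; Q] [::] a) [z [_ _ h]].
rewrite -!h ?inE ?eqxx ?orbT // hornerD hornerN; exact: (nabsB_le na).
Qed.

Lemma gnB_lt P Q a r M : vg r -> gn P a r < M -> gn Q a r < M -> gn (P - Q) a r < M.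
Proof.
move=> /(gn_gen [:: P - Q; P; Q] [::] a) [z [_ _ h]].
rewrite -!h ?inE ?eqxx ?orbT // hornerD hornerN; exact: (nabsB_lt na).
Qed.

Lemma gnBr P Q a r : vg r -> gn P a r < gn Q a r -> gn (P - Q) a r = gn Q a r.
Proof.
move=> /(gn_gen [:: P - Q; P; Q] [::] a) [z [_ _ h]].
rewrite -!h ?inE ?eqxx ?orbT // hornerD hornerN; exact: (nabsBr na).
Qed.

Lemma gn_XsubC a b r : vg r -> abs (a - b) <= r -> gn ('X - b%:P) a r = r.
Proof.
move=> vr h; have [z [za zb hz]] := gn_gen [:: 'X - b%:P] [:: b] a vr.
rewrite -hz ?inE ?eqxx // hornerXsubC; apply/le_anti/andP; split.
  exact: (nabs_dist_le na za).
by apply: zb; rewrite inE.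
Qed.

(** Each root within l of a contributes a factor r, every other root a constant. That c lies in the
    value group later decides whether a radius at which two such monomials agree lies there too. *)
Lemma gn_mono P a l h : 0 <= l -> l < h ->
  (forall x, x \in poly_roots P -> abs (a - x) <= l \/ h <= abs (a - x)) ->
  exists c k, [/\ P != 0 -> vg c & forall r, l <= r <= h -> gn P a r = c * r ^+ k].
Proof.
move=> l0 lh; have [->|P0] := eqVneq P 0.
  by exists 0, 0%N; split=> // r _; rewrite gn0 mul0r.
move=> hr; suff [c [k [vc hk]]] : exists c k, [/\ vg c
    & forall r, l <= r <= h -> \prod_(x <- poly_roots P) Num.max r (abs (a - x)) = c * r ^+ k].
  exists (abs (lead_coef P) * c), k; split; last by move=> r /hk; rewrite /gauss_norm => ->; rewrite mulrA.
  by move=> _; apply: vgM => //; exists (lead_coef P); rewrite ?lead_coef_eq0.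
elim: (poly_roots P) hr => [|x s IH] hr.
  exists 1, 0%N; split; first by exists 1; rewrite ?oner_neq0 ?(nabs1 na).
  by move=> r _; rewrite big_nil mulr1.
have [y ys|c [k [vc hk]]] := IH; first by apply: hr; rewrite inE ys orbT.
have [] := hr x (mem_head _ _) => hx.
  exists c, k.+1; split=> // r /[dup] /hk e /andP[lr _].
  by rewrite big_cons e max_l ?(le_trans hx) // exprS mulrCA.
exists (abs (a - x) * c), k; split.
  by apply: vgM => //; exists (a - x) => //; rewrite -(nabs_gt0 na) (lt_le_trans _ hx) // (le_lt_trans l0).
move=> r /[dup] /hk e /andP[_ lr].
by rewrite big_cons e max_r ?mulrA // (le_trans lr).
Qed.

End GaussNorm.

(** * Real estimates and density of the value group *)

Lemma expr_small (R : realType) (q e : R) : 0 <= q < 1 -> 0 < e -> exists n : nat, q ^+ n < e.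
Proof.
move=> /andP[q0 q1] e0.
have : (fun n => q ^+ n) @ \oo --> (0 : R) by apply: cvg_expr; rewrite ger0_norm.
move/cvgrPdist_lt/(_ _ e0) => [n _ hn]; exists n.
have := hn n (leqnn n); rewrite /= sub0r normrN ger0_norm //.
exact: exprn_ge0.
Qed.

(** Applied to the distances from a centre to the roots of a polynomial, this and its mirror image
    provide the intervals without breakpoints that [gn_mono] asks for. *)
Lemma gap_right (R : realType) (s : seq R) (l h : R) : l < h ->
  exists2 h', l < h' <= h & forall x, x \in s -> x <= l \/ h' <= x.
Proof.
move=> lh; elim: s => [|x s [h' /andP[lh' h'h] IH]]; first by exists h; rewrite ?lh ?lexx.
exists (if x <= l then h' else Num.min x h').
  by case: (leP x l) => hx; rewrite ?lt_min ?ge_min ?hx ?lh' ?h'h ?orbT.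
move=> y; rewrite inE => /orP[/eqP ->|/IH []]; case: (leP x l) => hx; try by [left|right].
- by right; rewrite ge_min lexx.
- by move=> h2; right; rewrite ge_min h2 orbT.
Qed.

Lemma gap_left (R : realType) (s : seq R) (l h : R) : l < h ->
  exists2 l', l <= l' < h & forall x, x \in s -> x <= l' \/ h <= x.
Proof.
move=> lh; elim: s => [|x s [l' /andP[ll' l'h] IH]]; first by exists l; rewrite ?lh ?lexx.
exists (if h <= x then l' else Num.max x l').
  by case: (leP h x) => hx; rewrite ?gt_max ?le_max ?hx ?ll' ?l'h ?orbT.
move=> y; rewrite inE => /orP[/eqP ->|/IH []]; case: (leP h x) => hx; try by [left|right].
- by left; rewrite le_max lexx.
- by move=> h2; left; rewrite le_max h2 orbT.
Qed.

(** A root y of high order of pi has s / t < |y| < 1. The progression |y|^k / |pi|^N starts above t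
    for large N, and its steps are so small that its first term below t is still above s. *)
Lemma vg_dense (R : realType) (K : fieldType) (abs : K -> R)
  (na : is_nonarch_abs abs) (K_closed : alg_closed K) (pi : K) (s t : R) :
  0 < abs pi < 1 -> 0 <= s -> s < t -> exists2 r, value_group abs r & s < r < t.
Proof.
move=> /andP[p0 p1]; wlog s0 : s / 0 < s.
  move=> H s0 st; have [r vr /andP[h1 h2]] : exists2 r, value_group abs r & (s + t) / 2 < r < t.
    by apply: H; lra.
  by exists r => //; lra.
move=> _ st; have t0 : 0 < t by lra.
have q1 : 0 <= s / t < 1 by rewrite divr_ge0 ?ltW //= ltr_pdivrMr // mul1r.
have [n hn] := expr_small q1 p0.
have {}hn : (s / t) ^+ n.+1 < abs pi.
  apply: le_lt_trans hn; rewrite exprS ler_piMl ?exprn_ge0 //; lra.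
have /K_closed[y] : (1 < size ('X^(n.+1) - pi%:P : {poly K})%R)%N by rewrite size_XnsubC.
rewrite rootE !hornerE subr_eq0 => /eqP hy.
have {}hy : abs y ^+ n.+1 = abs pi by rewrite -(nabsX na) // hy.
have y1 : abs y < 1 by rewrite -(@expr_lt1 _ n.+1) ?(nabs_ge0 na) // hy.
have ys : s / t < abs y by rewrite -(@ltr_pXn2r _ n.+1) ?nnegrE ?(nabs_ge0 na) // ?hy //; lra.
have y0 : 0 < abs y by lra.
have [N hN] : exists N, abs pi ^+ N < t^-1 by apply: expr_small; rewrite ?invr_gt0 ?p1 ?ltW.
have pN : 0 < abs pi ^+ N by rewrite exprn_gt0.
have exk : exists k, abs y ^+ k / abs pi ^+ N < t.
  have [k hk] : exists k, abs y ^+ k < t * abs pi ^+ N.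
    by apply: expr_small; rewrite ?mulr_gt0 // y1 ltW.
  by exists k; rewrite ltr_pdivrMr.
case: (ex_minnP exk) => k hk kmin.
exists (abs y ^+ k / abs pi ^+ N).
  have vX z m : 0 < abs z -> value_group abs (abs z ^+ m).
    by move=> z0; apply: vgX => //; exists z => //; rewrite -(nabs_gt0 na).
  by apply: vgM => //; [|apply: vgV => //]; apply: vX.
rewrite hk andbT; case: k {hk} kmin => [|k] kmin.
  rewrite expr0 mul1r; apply: (lt_trans st).
  by rewrite -[t]invrK ltf_pV2 ?posrE ?invr_gt0.
have : t <= abs y ^+ k / abs pi ^+ N.
  by rewrite leNgt; apply/negP => /kmin; rewrite ltnn.
rewrite exprS -mulrA; set u := _ / _ => tu; rewrite ltr_pdivrMr // in ys.
by apply: (lt_le_trans ys); rewrite ler_pM2l.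
Qed.

(** * Finite orbits in the residue field *)

(** The residue field is algebraic over F_p, said without constructing it: an element is algebraic
    exactly when it lies in a finite field, that is, when a power of Frobenius fixes it. *)
Definition residue_algebraic (R : realType) (K : fieldType) (abs : K -> R) (p : nat) : Prop :=
  forall x, abs x <= 1 -> exists2 n, (0 < n)%N & abs (x ^+ (p ^ n) - x) < 1.

Section ResidueField.
Context (R : realType) (K : fieldType) (abs : K -> R) (p : nat).
Hypothesis (na : is_nonarch_abs abs) (K_closed : alg_closed K).
Hypothesis (p_prime : prime p) (abs_p : abs p%:R < 1).
Hypothesis res_alg : residue_algebraic abs p.

Local Notation gn := (gauss_norm abs).

Lemma frobD x y : abs x <= 1 -> abs y <= 1 ->
  abs ((x + y) ^+ p - (x ^+ p + y ^+ p)) < 1.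
Proof.
move=> hx hy; have [m pE] : exists m, p = m.+1 by exists p.-1; rewrite prednK ?prime_gt0.
rewrite pE exprDn big_ord_recr big_ord_recl /=.
rewrite subnn subn0 !expr0 mulr1 mul1r bin0 binn !mulr1n.
set S := \sum_(i < _) _.
have -> : x ^+ m.+1 + S + y ^+ m.+1 - (x ^+ m.+1 + y ^+ m.+1) = S by ring.
apply: le_lt_trans abs_p; apply: (nabs_sum_le na) => [|i _]; first exact: (nabs_ge0 na).
have /dvdnP[k ->] : (p %| 'C(m.+1, bump 0 i))%N.
  by rewrite -pE prime_dvd_bin // /bump /= add1n pE; have := ltn_ord i; lia.
rewrite -[_ *+ _]mulr_natr natrM mulrA (nabsM na) ler_piMl ?(nabs_ge0 na) //.
rewrite !(nabsM na) mulr_ile1 ?mulr_ge0 ?(nabs_ge0 na) ?(nabs_nat_le1 na) //.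
by rewrite mulr_ile1 ?(nabs_ge0 na) // (nabsX na) exprn_ile1 ?(nabs_ge0 na).
Qed.

Lemma frobXD n x y : abs x <= 1 -> abs y <= 1 ->
  abs ((x + y) ^+ (p ^ n) - (x ^+ (p ^ n) + y ^+ (p ^ n))) < 1.
Proof.
move=> hx hy; elim: n => [|n IH]; first by rewrite expn0 !expr1 subrr (nabs0 na).
have X1 z k : abs z <= 1 -> abs (z ^+ k) <= 1 by move=> h; rewrite (nabsX na) exprn_ile1 ?(nabs_ge0 na).
rewrite expnSr !exprM; set a := x ^+ _; set b := y ^+ _; set c := (x + y) ^+ _.
have -> : c ^+ p - (a ^+ p + b ^+ p) = (c ^+ p - (a + b) ^+ p) + ((a + b) ^+ p - (a ^+ p + b ^+ p)).
  by ring.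
apply: (nabsD_lt na) => //; last by apply: frobD; apply: X1.
apply: le_lt_trans IH; apply: (nabsX_sub_le na) => //; first by apply: X1; apply: (nabsD_le na).
by apply: (nabsD_le na) => //; apply: X1.
Qed.

(** The integral elements whose residue class lies in the field with p^n elements. *)
Definition frob_fixed n x := abs x <= 1 /\ abs (x ^+ (p ^ n) - x) < 1.

Lemma frob_fixed0 n : frob_fixed n 0.
Proof. by split; rewrite ?(nabs0 na) // expr0n expn_eq0 -leqn0 leqNgt prime_gt0 //= subrr (nabs0 na). Qed.

Lemma frob_fixedD n x y : frob_fixed n x -> frob_fixed n y -> frob_fixed n (x + y).
Proof.
move=> [x1 hx] [y1 hy]; split; first exact: (nabsD_le na).
have -> : (x + y) ^+ (p ^ n) - (x + y) = ((x + y) ^+ (p ^ n) - (x ^+ (p ^ n) + y ^+ (p ^ n)))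
  + ((x ^+ (p ^ n) - x) + (y ^+ (p ^ n) - y)) by ring.
by apply: (nabsD_lt na) => //; [apply: frobXD | apply: (nabsD_lt na)].
Qed.

Lemma frob_fixedM n x y : frob_fixed n x -> frob_fixed n y -> frob_fixed n (x * y).
Proof.
move=> [x1 hx] [y1 hy]; split; first by rewrite (nabsM na) mulr_ile1 ?(nabs_ge0 na).
rewrite exprMn.
have -> : x ^+ (p ^ n) * y ^+ (p ^ n) - x * y =
  x ^+ (p ^ n) * (y ^+ (p ^ n) - y) + (x ^+ (p ^ n) - x) * y by ring.
apply: (nabsD_lt na) => //; rewrite (nabsM na).
  by apply: le_lt_trans hy; rewrite ler_piMl ?(nabs_ge0 na) // (nabsX na) exprn_ile1 ?(nabs_ge0 na).
by apply: le_lt_trans hx; rewrite ler_piMr ?(nabs_ge0 na).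
Qed.

Lemma frob_fixedV n x : frob_fixed n x -> abs x = 1 -> frob_fixed n x^-1.
Proof.
move=> [_ hx] x1; split; first by rewrite (nabsV na) x1 invr1.
have x0 : x != 0 by rewrite -(nabs_gt0 na) x1.
have -> : x^-1 ^+ (p ^ n) - x^-1 = (x - x ^+ (p ^ n)) / (x ^+ (p ^ n) * x).
  by rewrite exprVn; field; rewrite x0 expf_neq0.
by rewrite (nabs_div na) (nabsM na) (nabsX na) x1 expr1n mulr1 divr1 (nabs_sub na).
Qed.

Lemma frob_fixed_mul n m x : frob_fixed n x -> frob_fixed (n * m) x.
Proof.
move=> [x1 hx]; split=> //; elim: m => [|m IH]; first by rewrite muln0 expr1 subrr (nabs0 na).
rewrite mulnS addnC expnD exprM.
have -> : (x ^+ (p ^ (n * m))) ^+ (p ^ n) - x =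
  ((x ^+ (p ^ (n * m))) ^+ (p ^ n) - x ^+ (p ^ n)) + (x ^+ (p ^ n) - x) by ring.
apply: (nabsD_lt na) => //; apply: le_lt_trans IH; apply: (nabsX_sub_le na) => //.
by rewrite (nabsX na) exprn_ile1 ?(nabs_ge0 na).
Qed.

Lemma frob_fixed_common (L : seq K) : (forall x, x \in L -> abs x <= 1) ->
  exists2 n, (0 < n)%N & forall x, x \in L -> frob_fixed n x.
Proof.
elim: L => [|x L IH] hL; first by exists 1%N.
have [n n0 hn] : exists2 n, (0 < n)%N & forall x, x \in L -> frob_fixed n x.
  by apply: IH => y yL; apply: hL; rewrite inE yL orbT.
have [m m0 hm] := res_alg (hL x (mem_head _ _)).
exists (n * m)%N; first by rewrite muln_gt0 n0.
move=> y; rewrite inE => /orP[/eqP ->|/hn]; last exact: frob_fixed_mul.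
by rewrite mulnC; apply: frob_fixed_mul; split=> //; apply: hL; rewrite mem_head.
Qed.

(** X^q - X splits over K. Its value at u k is a product of the distances from u k to the roots, so
    a value of norm below 1 puts u k within distance less than 1 of a root. There are finitely many
    roots, and two terms sharing a root are close to each other. *)
Lemma frob_fixed_pigeonhole n (u : nat -> K) : (0 < n)%N ->
  (forall k, frob_fixed n (u k)) -> exists k l, (k < l)%N /\ abs (u k - u l) < 1.
Proof.
move=> n0 hu; set q := (p ^ n)%N.
have q1 : (1 < q)%N by rewrite -[1%N](exp1n n) ltn_exp2r // prime_gt1.
pose W : {poly K} := 'X^q - 'X.
have szW : size W = q.+1 by rewrite /W size_polyDl ?size_polyXn // size_polyN size_polyX.
have leadW : lead_coef W = 1.
  by rewrite /lead_coef szW /W coefB coefXn coefX eqxx /= gtn_eqF ?subr0.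
pose s := poly_roots W.
have near k : exists2 i : 'I_(size s), true & abs (u k - s`_i) < 1.
  have [_] := hu k; have -> : u k ^+ (p ^ n) - u k = W.[u k] by rewrite /W !hornerE.
  rewrite (nabs_horner na K_closed) leadW (nabs1 na) mul1r ltNge => /negP h.
  have [/hasP[x xs hx]|/hasPn hs] := boolP (has (fun x => abs (u k - x) < 1) s).
    have hi : (index x s < size s)%N by rewrite index_mem.
    by exists (Ordinal hi) => //=; rewrite nth_index.
  case: h; rewrite -/s big_seq; elim/big_rec: _ => // x y xs hy.
  by rewrite -[1]mulr1 ler_pM // leNgt hs.
pose F (k : 'I_(size s).+1) := projT1 (cid2 (near k)).
have /injectivePn[k [l kl e]] : ~~ injectiveb F.
  by apply/injectiveP => /leq_card; rewrite !card_ord ltnn.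
have hF (k' : 'I_(size s).+1) : abs (u k' - s`_(F k')) < 1 by rewrite /F; case: cid2.
have H (k' l' : 'I_(size s).+1) : F k' = F l' -> abs (u k' - u l') < 1.
  by move=> e'; apply: (nabs_dist_lt na (hF k')); rewrite e' (nabs_sub na).
have [lt|gt|/val_inj eq] := ltngtP k l.
- by exists k, l; split=> //; apply: H.
- by exists l, k; split=> //; apply: H.
- by rewrite eq eqxx in kl.
Qed.

(** Root by root: multiplying by X - x enlarges the bound on the coefficients by at most the factor
    max(1, |x|), which is the factor of x in the Gauss norm. *)
Lemma coef_le_gn (P : {poly K}) i : abs P`_i <= gn P 0 1.
Proof.
rewrite {1}(poly_splits K_closed P) coefZ (nabsM na) ler_wpM2l ?(nabs_ge0 na) //.
elim: (poly_roots P) i => [|x s IH] i; first by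
  rewrite !big_nil -(mulr1n 1) coefMn coef1 mulr1n; case: eqP; rewrite ?(nabs1 na) ?(nabs0 na).
rewrite !big_cons mulrBl coefB coefXM mul_polyC coefZ.
have M1 : 1 <= Num.max 1 (abs (0 - x)) by rewrite le_max lexx.
have M2 : abs x <= Num.max 1 (abs (0 - x)) by rewrite le_max sub0r (nabsN na) lexx orbT.
have S0 : 0 <= \prod_(j <- s) Num.max 1 (abs (0 - j)).
  by apply: prodr_ge0 => j _; rewrite le_max ler01.
apply: (nabsB_le na) => //.
  case: eqP => _; first by rewrite (nabs0 na) mulr_ge0 // (le_trans ler01).
  by rewrite -[abs _]mul1r ler_pM ?(nabs_ge0 na).
by rewrite (nabsM na) ler_pM ?(nabs_ge0 na).
Qed.

End ResidueField.

(** * Periodic disks *)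

Definition frac_map (K : fieldType) (P Q : {poly K}) (z : K) : K := P.[z] / Q.[z].

(** n is the first return time, so a point of the disk fixed by the n-th
    iterate has primitive period n. *)
Definition periodic_disk (R : realType) (K : fieldType) (abs : K -> R)
    (P Q : {poly K}) (X : set K) : Prop :=
  exists (a : K) (r : R) (n : nat),
    [/\ value_group abs r, (0 < n)%N, (exists2 x, X x & abs (x - a) < r),
        forall z k, abs (z - a) < r -> Q.[iter k (frac_map P Q) z] != 0
      & (forall z, abs (z - a) < r -> abs (iter n (frac_map P Q) z - a) < r) /\
        (forall i z, (0 < i < n)%N -> abs (z - a) < r ->
          ~ abs (iter i (frac_map P Q) z - a) < r)].

Section FixedDirection.
Context (R : realType) (K : fieldType) (abs : K -> R) (p : nat).
Hypothesis (na : is_nonarch_abs abs) (K_closed : alg_closed K).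
Hypothesis (p_prime : prime p) (abs_p : abs p%:R < 1).
Hypothesis res_alg : residue_algebraic abs p.

Local Notation gn := (gauss_norm abs).
Local Notation vg := (value_group abs).

Lemma invariant_periodic_disk (P Q : {poly K}) (X : set K) a r x :
  vg r -> X x -> abs (x - a) < r ->
  (forall z, abs (z - a) < r -> Q.[z] != 0 /\ abs (frac_map P Q z - a) < r) ->
  periodic_disk abs P Q X.
Proof.
move=> vr Xx xa h; exists a, r, 1%N; split=> //; first by exists x.
  have it k z : abs (z - a) < r -> abs (iter k (frac_map P Q) z - a) < r.
    by move=> za; elim: k => //= k /h [].
  by move=> z k /(it k) /h [].
by split=> [z /h []//|i z]; case: i => [|[]].
Qed.

Lemma sup_le1_coef (P : {poly K}) i : (forall z, abs z <= 1 -> abs P.[z] <= 1) -> abs P`_i <= 1.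
Proof.
move=> h; apply: le_trans (coef_le_gn na K_closed P i) _.
have v1 : vg 1 by exists 1; rewrite ?oner_neq0 ?(nabs1 na).
have [z [z1 _ hz]] := gn_gen na K_closed [:: P] [::] 0 v1.
by rewrite -hz ?inE ?eqxx //; apply: h; rewrite subr0 in z1.
Qed.

Lemma frob_fixed_horner n (P : {poly K}) z : (forall i, frob_fixed abs p n P`_i) ->
  frob_fixed abs p n z -> frob_fixed abs p n P.[z].
Proof.
move=> hP hz; elim/poly_ind: P hP => [|P c IH] hP; first by rewrite horner0; apply: frob_fixed0.
rewrite !hornerE; apply: frob_fixedD => //.
  apply: frob_fixedM => //; apply: IH => i.
  by have := hP i.+1; rewrite coefD coefMX coefC /= addr0.
by have := hP 0%N; rewrite coefD coefMX coefC /= add0r.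
Qed.

(** In the coordinate t = (u - a) / c the map is a quotient of polynomials with integral
    coefficients whose denominator is a unit along the orbit. The finitely many coefficients and the
    starting point reduce into one finite field, and the reduced orbit stays there. *)
Lemma finite_orbit (P Q : {poly K}) a r (u : nat -> K) : vg r ->
  (forall k, abs (u k - a) <= r) ->
  (forall k, Q.[u k] != 0 /\ abs Q.[u k] = gn Q a r) ->
  (forall k, u k.+1 = frac_map P Q (u k)) ->
  gn (P - a%:P * Q) a r <= r * gn Q a r ->
  exists k l, (k < l)%N /\ abs (u k - u l) < r.
Proof.
move=> [c c0 hr] ua uQ uS hP.
have r0 : 0 < r by rewrite -hr (nabs_gt0 na).
(* An element of K of norm [gn Q a r]; dividing by it makes the denominator integral, and with the
   extra factor c also the numerator. *)
pose kap := Q.[u 0%N]; have [k0 hkap] : kap != 0 /\ abs kap = gn Q a r := uQ 0%N.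
have gQ0 : 0 < gn Q a r by rewrite -hkap (nabs_gt0 na).
pose L : {poly K} := c *: 'X + a%:P.
have LE t : L.[t] = a + c * t by rewrite /L !hornerE addrC.
have Lr t : abs t <= 1 -> abs (L.[t] - a) <= r.
  by move=> t1; rewrite LE addrC addKr (nabsM na) hr ler_piMr // ltW.
pose P1 := (c * kap)^-1 *: ((P - a%:P * Q) \Po L).
pose Q1 := kap^-1 *: (Q \Po L).
have P1le t : abs t <= 1 -> abs P1.[t] <= 1.
  move=> /Lr Lt; rewrite /P1 hornerZ horner_comp (nabsM na) (nabsV na) (nabsM na) hr hkap.
  rewrite mulrC ler_pdivrMr ?mul1r; last exact: mulr_gt0.
  by apply: le_trans hP; exact: gn_ub.
have Q1le t : abs t <= 1 -> abs Q1.[t] <= 1.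
  move=> /Lr Lt; rewrite /Q1 hornerZ horner_comp (nabsM na) (nabsV na) hkap.
  by rewrite mulrC ler_pdivrMr // mul1r; exact: gn_ub.
pose t k := (u k - a) / c.
have Lt k : L.[t k] = u k by rewrite LE /t; field.
have t1 k : abs (t k) <= 1 by rewrite (nabs_div na) hr ler_pdivrMr // mul1r.
have Q1t k : abs Q1.[t k] = 1.
  rewrite /Q1 hornerZ horner_comp Lt (nabsM na) (nabsV na) hkap (uQ k).2 mulVf //.
  exact: lt0r_neq0.
have tS k : t k.+1 = P1.[t k] / Q1.[t k].
  rewrite /P1 /Q1 !hornerZ !horner_comp Lt /t uS /frac_map !hornerE.
  by have [q0 _] := uQ k; field; rewrite q0 c0 k0.
have [n n0 hn] : exists2 n, (0 < n)%N &
  forall x, x \in t 0%N :: (P1 : seq K) ++ (Q1 : seq K) -> frob_fixed abs p n x.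
  apply: frob_fixed_common => // x; rewrite inE mem_cat => /or3P[/eqP ->//| |] /(nthP 0) [i _ <-];
  exact: sup_le1_coef.
have coefn (S : {poly K}) : (forall x, x \in (S : seq K) -> frob_fixed abs p n x) ->
    forall i, frob_fixed abs p n S`_i.
  move=> hS i; case: (ltnP i (size S)) => hi; first by apply: hS; rewrite mem_nth.
  by rewrite nth_default //; apply: frob_fixed0.
have ft k : frob_fixed abs p n (t k).
  elim: k => [|k IH]; first by apply: hn; rewrite mem_head.
  rewrite tS; apply: frob_fixedM => //.
    apply: frob_fixed_horner => //; apply: coefn => x xP.
    by apply: hn; rewrite inE mem_cat xP orbT.
  apply: frob_fixedV => //; apply: frob_fixed_horner => //; apply: coefn => x xP.
  by apply: hn; rewrite inE mem_cat xP !orbT.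
have [k [l [kl h]]] := frob_fixed_pigeonhole na K_closed p_prime n0 ft.
exists k, l; split=> //; move: h.
have -> : t k - t l = (u k - u l) / c by rewrite /t; field.
by rewrite (nabs_div na) hr ltr_pdivrMr // mul1r.
Qed.

(** The last hypothesis says that the reduction of R at D(a, r) is not constant.
    Then a residue disk contained in X is mapped onto a residue disk, which is
    again contained in X, and finiteness of orbits applies. *)
Lemma nonconstant_periodic_disk (P Q : {poly K}) (X : set K) a r (L : seq K) :
  vg r ->
  (forall z, X z -> Q.[z] != 0 /\ X (frac_map P Q z)) ->
  (forall z, abs (z - a) <= r -> (forall x, x \in L -> r <= abs (z - x)) -> X z) ->
  Q != 0 ->
  gn (P - 'X * Q) a r <= r * gn Q a r ->
  (forall y, abs (y - a) <= r -> r * gn Q a r <= gn (P - y%:P * Q) a r) ->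
  periodic_disk abs P Q X.
Proof.
move=> vr XQ LX Q0 hN hy; set g := frac_map P Q.
have r0 := vg_gt0 na vr.
have gQ0 : 0 < gn Q a r by apply: gn_gt0.
have hyle y : abs (y - a) <= r -> gn (P - y%:P * Q) a r <= r * gn Q a r.
  move=> ya; have -> : P - y%:P * Q = (P - 'X * Q) - (y%:P - 'X) * Q by ring.
  have -> : (y%:P - 'X) * Q = 0 - ('X - y%:P) * Q by ring.
  apply: gnB_le => //; apply: gnB_le => //.
    by rewrite gn0 // mulr_ge0 ?gn_ge0 // ltW.
  by rewrite gnM // gn_XsubC // (nabs_sub na).
(* The open residue disk of z is contained in X. *)
pose good z := abs (z - a) <= r /\ forall w, abs (w - z) < r -> X w.
have distz w z : abs (z - a) <= r -> abs (w - z) < r -> abs (w - a) <= r.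
  by move=> za wz; apply: (nabs_dist_le na _ za); exact: ltW.
have goodQ z w : good z -> abs (w - z) < r -> Q.[w] != 0 /\ abs Q.[w] = gn Q a r.
  move=> [za hz] wz; split; first by have [] := XQ w (hz w wz).
  apply: gn_generic_roots => //; first exact: distz wz.
  move=> x Qx; rewrite leNgt; apply/negP => wx.
  have xz : abs (x - z) < r by apply: (nabs_dist_lt na (y := w)) => //; rewrite (nabs_sub na).
  by have [/negP] := XQ x (hz x xz).
have self z : abs (z - z) < r by rewrite subrr (nabs0 na).
have good1 z w : good z -> abs (w - z) < r -> abs (g w - a) <= r.
  move=> gz wz; have [Qw hQ] := goodQ z w gz wz.
  have wa : abs (w - a) <= r by apply: distz wz; case: gz.
  apply: (nabs_dist_le na _ wa).
  have -> : g w - w = (P - 'X * Q).[w] / Q.[w].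
    by rewrite /g /frac_map !hornerE; field.
  rewrite (nabs_div na) hQ ler_pdivrMr //; apply: le_trans hN; exact: gn_ub.
have good2 z w : good z -> abs (w - z) < r -> abs (g w - g z) < r.
  move=> gz wz; have [Qw hQ] := goodQ z w gz wz; have [Qz _] := goodQ z z gz (self z).
  have gza := good1 z z gz (self z).
  (* E / Q is the difference quotient of g at z. Its Gauss norm is at most 1, so g does not expand
     distances inside a good residue disk. *)
  have [E defE] : exists E, P - (g z)%:P * Q = E * ('X - z%:P).
    by apply/factor_theorem; rewrite rootE !hornerE /g /frac_map divfK // subrr.
  have gE : gn E a r <= gn Q a r.
    have := hyle _ gza; rewrite defE gnM // gn_XsubC // 1?(nabs_sub na); last by case: gz.
    by rewrite mulrC ler_pM2l.
  have -> : g w - g z = (P - (g z)%:P * Q).[w] / Q.[w].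
    by rewrite [g w]/frac_map !hornerE; field.
  rewrite (nabs_div na) hQ ltr_pdivrMr // defE hornerM hornerXsubC (nabsM na) mulrC.
  have Ew : abs E.[w] <= gn Q a r.
    by apply: le_trans gE; apply: gn_ub => //; apply: distz wz; case: gz.
  apply: (@le_lt_trans _ _ (abs (w - z) * gn Q a r)); first by rewrite ler_wpM2l ?(nabs_ge0 na).
  by rewrite ltr_pM2r.
have good3 z : good z -> good (g z).
  move=> gz; have gza := good1 z z gz (self z); split=> // y yz.
  have ya : abs (y - a) <= r by apply: distz yz.
  have H0 : P - y%:P * Q != 0.
    by apply/eqP => H0; have := hy y ya; rewrite H0 gn0 // leNgt mulr_gt0.
  (* Every y in the residue disk of g z is attained on that of z: otherwise P - y Q has no zero
     there, so its value at z is its Gauss norm, and g z would be at distance at least r from y. *)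
  have [[x xz Hx]|noroot] := pselect (exists2 x, abs (x - z) < r & root (P - y%:P * Q) x).
    have [Qx _] := goodQ z x gz xz.
    have -> : y = g x.
      move: Hx; rewrite rootE !hornerE subr_eq0 /g /frac_map => /eqP ->.
      by rewrite mulfK.
    by have [_] := XQ x (gz.2 x xz).
  have [Qz hQ] := goodQ z z gz (self z).
  suff : r <= abs (g z - y) by rewrite (nabs_sub na) leNgt yz.
  have -> : g z - y = (P - y%:P * Q).[z] / Q.[z] by rewrite /g /frac_map !hornerE; field.
  rewrite (nabs_div na) hQ ler_pdivlMr // (@gn_generic_roots _ _ _ na K_closed _ a r) //; first exact: hy.
    by case: gz.
  move=> x Hx; rewrite leNgt; apply/negP => zx; apply: noroot; exists x => //.
  by rewrite (nabs_sub na).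
have [z0 z0a z0L] := generic_point na K_closed L a vr.
have good0 : good z0.
  split=> // w wz; apply: LX; first exact: distz wz.
  move=> x /z0L h; rewrite leNgt; apply/negP => wx; move: h; rewrite leNgt => /negP; apply.
  by apply: (nabs_dist_lt na (y := w)) => //; rewrite (nabs_sub na).
pose u k := iter k g z0.
have goodu k : good (u k) by elim: k => //= k; apply: good3.
have [k1 [l1 [kl1 h1]]] : exists k l, (k < l)%N /\ abs (u k - u l) < r.
  apply: (@finite_orbit P Q a) => // [k|k|].
  - by case: (goodu k).
  - exact: goodQ (goodu k) (self _).
  - by apply: hyle; rewrite subrr (nabs0 na) // ltW.
(* Minimising the return time over all positions k of the orbit makes it a first return time. *)
have exn : exists n, (0 < n)%N && `[< exists k, abs (u k - u (k + n)%N) < r >].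
  exists (l1 - k1)%N; rewrite subn_gt0 kl1; apply/asboolP; exists k1.
  by rewrite subnKC // ltnW.
case: (ex_minnP exn) => n /andP[n0 /asboolP[k hk]] nmin.
have itu i z : abs (z - u k) < r -> abs (iter i g z - u (k + i)%N) < r.
  move=> zk; elim: i => [|i IH]; first by rewrite addn0.
  by rewrite addnS iterS /=; apply: good2.
exists (u k), r, n; split=> //.
- by exists (u k) => //; apply: (goodu k).2.
- move=> z i zk; have := itu i z zk => /(goodu (k + i)%N).2 /XQ [] //.
split=> [z zk|i z /andP[i0 iltn] zk h].
  by apply: (nabs_dist_lt na (itu n z zk)); rewrite (nabs_sub na).
suff /nmin : (0 < i)%N && `[< exists k, abs (u k - u (k + i)%N) < r >] by rewrite leqNgt iltn.
rewrite i0; apply/asboolP; exists k.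
by apply: (nabs_dist_lt na (y := iter i g z)); [rewrite (nabs_sub na) | apply: itu].
Qed.

End FixedDirection.

(** * Contracted disks *)

(** Bernoulli's inequality. It lets a strict inequality between Gauss norms survive a slight
    decrease of the radius; [n.+1] avoids a division by zero. *)
Lemma expr_near1 (R : realType) (theta : R) n : theta < 1 ->
  exists2 q : R, 0 <= q < 1 & forall x : R, q <= x <= 1 -> theta <= x ^+ n.
Proof.
move=> t1; exists (Num.max 0 (1 - (1 - theta) / n.+1%:R)).
  rewrite le_max lexx /= gt_max ltr01 /= ltrBlDr ltrDl divr_gt0 ?ltr0n //; lra.
move=> x /andP[]; rewrite ge_max => /andP[x0 hx] x1.
have bern : 1 - n%:R * (1 - x) <= x ^+ n.
  elim: n {hx} => [|n IH]; first by rewrite mul0r subr0 expr0.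
  have n0 : (0 : R) <= n%:R by exact: ler0n.
  have h1 := ler_wpM2l x0 IH.
  have h2 : 0 <= n%:R * ((1 - x) * (1 - x)) by rewrite mulr_ge0 // -expr2 sqr_ge0.
  by rewrite exprS -natr1; apply: le_trans h1; lra.
apply: le_trans bern.
have n1 : (0 : R) < n.+1%:R by rewrite ltr0n.
have h : (1 - x) * n.+1%:R <= 1 - theta by rewrite -ler_pdivlMr //; move: hx; set A := _ / _; lra.
rewrite -natr1 in h; lra.
Qed.

(** * Monomials with integer exponents *)

Section MonomialSqueeze.
Context (R : realType) (D : set R).
Hypothesis D_dense : forall s t : R, 0 <= s -> s < t -> exists2 r, D r & s < r < t.

(** The function (c / d) r^(i - j) would lie strictly between r and h on l < r < h. An exponent at
    most 0 keeps it below a constant less than h, an exponent at least 1 keeps its quotient by r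
    above a constant greater than 1; both fail near h. Only a fractional exponent, as in sqrt(h r),
    could fit. *)
Lemma no_squeeze_left (l h c d : R) i j : 0 < l -> l < h -> 0 < d ->
  ~ (forall r, D r -> l < r < h -> d * r ^+ j.+1 < c * r ^+ i < h * (d * r ^+ j)).
Proof.
move=> l0 lh d0 H; have [r1 D1 /andP[lr1 r1h]] := D_dense (ltW l0) lh.
have /andP[h1 h2] : d * r1 ^+ j.+1 < c * r1 ^+ i < h * (d * r1 ^+ j) by apply: H; rewrite ?lr1.
have r10 : 0 < r1 by lra.
have X0 k (r : R) : 0 < r -> 0 < r ^+ k by move=> *; rewrite exprn_gt0.
have [ij|ji] := leqP i j.
  move: (subnKC ij); set m := (j - i)%N => e.
  have {}h2 : c < h * (d * r1 ^+ m).
    by rewrite -(ltr_pM2r (X0 i _ r10)); move: h2; rewrite -e exprD; lra.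
  have dm : 0 < d * r1 ^+ m by rewrite mulr_gt0 ?X0.
  have [r2 D2 /andP[]] : exists2 r, D r & Num.max r1 (c / (d * r1 ^+ m)) < r < h.
    by apply: D_dense; rewrite ?le_max ?(ltW r10) // gt_max r1h ltr_pdivrMr.
  rewrite gt_max ltr_pdivrMr // => /andP[r12 hc] r2h.
  have r20 : 0 < r2 by lra.
  have /andP[] : d * r2 ^+ j.+1 < c * r2 ^+ i < h * (d * r2 ^+ j) by apply: H; rewrite // r2h andbT; lra.
  rewrite -e exprS exprD => k1 _.
  have k2 : d * (r2 * r2 ^+ m) < c.
    by rewrite -(ltr_pM2r (X0 i _ r20)); move: k1; lra.
  have k3 : r1 ^+ m <= r2 ^+ m by rewrite lerXn2r ?nnegrE ?ltW.
  have : d * (r2 * r1 ^+ m) <= d * (r2 * r2 ^+ m) by rewrite ler_pM2l // ler_pM2l.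
  by lra.
move: (subnKC ji); set m := (i - j.+1)%N => e.
have {}h1 : d < c * r1 ^+ m.
  by rewrite -(ltr_pM2r (X0 j.+1 _ r10)); move: h1; rewrite -e exprD; lra.
have cm : 0 < c * r1 ^+ m by lra.
have c0 : 0 < c by rewrite -(pmulr_lgt0 _ (X0 m _ r10)).
have [r2 D2 /andP[]] : exists2 r, D r & Num.max r1 (h * d / (c * r1 ^+ m)) < r < h.
  apply: D_dense; first by rewrite le_max (ltW r10).
  by rewrite gt_max r1h ltr_pdivrMr // ltr_pM2l //; lra.
rewrite gt_max ltr_pdivrMr // => /andP[r12 hc] r2h.
have r20 : 0 < r2 by lra.
have /andP[_] : d * r2 ^+ j.+1 < c * r2 ^+ i < h * (d * r2 ^+ j) by apply: H; rewrite // r2h andbT; lra.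
rewrite -e exprD exprS => k1.
have k2 : c * (r2 * r2 ^+ m) < h * d.
  by rewrite -(ltr_pM2r (X0 j _ r20)); move: k1; lra.
have k3 : r1 ^+ m <= r2 ^+ m by rewrite lerXn2r ?nnegrE ?ltW.
have : c * (r2 * r1 ^+ m) <= c * (r2 * r2 ^+ m) by rewrite ler_pM2l // ler_pM2l.
by lra.
Qed.

(** The mirror image at l: the monomial would lie strictly between l and r, as sqrt(l r) does, and
    both kinds of integer exponent fail near l. *)
Lemma no_squeeze_right (l h c d : R) i j : 0 < l -> l < h -> 0 < d ->
  ~ (forall r, D r -> l < r < h -> l * (d * r ^+ j) < c * r ^+ i < d * r ^+ j.+1).
Proof.
move=> l0 lh d0 H; have [r1 D1 /andP[lr1 r1h]] := D_dense (ltW l0) lh.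
have /andP[h1 h2] : l * (d * r1 ^+ j) < c * r1 ^+ i < d * r1 ^+ j.+1 by apply: H; rewrite ?lr1.
have r10 : 0 < r1 by lra.
have X0 k (r : R) : 0 < r -> 0 < r ^+ k by move=> *; rewrite exprn_gt0.
have [ij|ji] := leqP i j.
  move: (subnKC ij); set m := (j - i)%N => e.
  have {}h1 : l * (d * r1 ^+ m) < c.
    by rewrite -(ltr_pM2r (X0 i _ r10)); move: h1; rewrite -e exprD; lra.
  have dm : 0 < d * r1 ^+ m by rewrite mulr_gt0 ?X0.
  have [r2 D2 /andP[lr2]] : exists2 r, D r & l < r < Num.min r1 (c / (d * r1 ^+ m)).
    by apply: D_dense; rewrite ?(ltW l0) // lt_min lr1 ltr_pdivlMr.
  rewrite lt_min ltr_pdivlMr // => /andP[r12 hc].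
  have r20 : 0 < r2 by lra.
  have /andP[_] : l * (d * r2 ^+ j) < c * r2 ^+ i < d * r2 ^+ j.+1 by apply: H; rewrite // lr2; lra.
  rewrite -e exprS exprD => k1.
  have k2 : c < d * (r2 * r2 ^+ m).
    by rewrite -(ltr_pM2r (X0 i _ r20)); move: k1; lra.
  have k3 : r2 ^+ m <= r1 ^+ m by rewrite lerXn2r ?nnegrE ?ltW.
  have : d * (r2 * r2 ^+ m) <= d * (r2 * r1 ^+ m) by rewrite ler_pM2l // ler_pM2l.
  by lra.
move: (subnKC ji); set m := (i - j.+1)%N => e.
have {}h2 : c * r1 ^+ m < d.
  by rewrite -(ltr_pM2r (X0 j.+1 _ r10)); move: h2; rewrite -e exprD; lra.
have c0 : 0 < c.
  rewrite -(pmulr_lgt0 _ (X0 i _ r10)); apply: lt_trans h1.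
  by rewrite !mulr_gt0 ?X0.
have cm : 0 < c * r1 ^+ m by rewrite mulr_gt0 ?X0.
have [r2 D2 /andP[lr2]] : exists2 r, D r & l < r < Num.min r1 (l * d / (c * r1 ^+ m)).
  apply: D_dense; rewrite ?(ltW l0) // lt_min lr1 ltr_pdivlMr // ltr_pM2l //.
rewrite lt_min ltr_pdivlMr // => /andP[r12 hc].
have r20 : 0 < r2 by lra.
have /andP[+ _] : l * (d * r2 ^+ j) < c * r2 ^+ i < d * r2 ^+ j.+1 by apply: H; rewrite // lr2; lra.
rewrite -e exprD exprS => k1.
have k2 : l * d < c * (r2 * r2 ^+ m).
  by rewrite -(ltr_pM2r (X0 j _ r20)); move: k1; lra.
have k3 : r2 ^+ m <= r1 ^+ m by rewrite lerXn2r ?nnegrE ?ltW.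
have : c * (r2 * r2 ^+ m) <= c * (r2 * r1 ^+ m) by rewrite ler_pM2l // ler_pM2l.
by lra.
Qed.

End MonomialSqueeze.

Section GaussNormExtra.
Context (R : realType) (K : fieldType) (abs : K -> R).
Hypothesis (na : is_nonarch_abs abs) (K_closed : alg_closed K).

Local Notation gn := (gauss_norm abs).
Local Notation vg := (value_group abs).

Lemma gnZ c P a r : vg r -> gn (c%:P * P) a r = abs c * gn P a r.
Proof.
move=> vr; have [z [_ _ h]] := gn_gen na K_closed [:: c%:P * P; P] [::] a vr.
by rewrite -!h ?inE ?eqxx ?orbT // hornerM hornerC (nabsM na).
Qed.

Lemma gn_shrink P a r r' : 0 < r' -> r' <= r ->
  (r' / r) ^+ size (poly_roots P) * gn P a r <= gn P a r'.
Proof.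
move=> r'0 r'r; have r0 : 0 < r by exact: lt_le_trans r'r.
rewrite /gauss_norm mulrCA ler_wpM2l ?(nabs_ge0 na) //.
have q0 : 0 <= r' / r by rewrite divr_ge0 ?ltW.
have q1 : r' / r <= 1 by rewrite ler_pdivrMr // mul1r.
have prod0 t s : 0 <= \prod_(x <- s) Num.max t (abs (a - x)).
  by apply: prodr_ge0 => x _; rewrite le_max (nabs_ge0 na) // orbT.
elim: (poly_roots P) => [|x s IH] /=; first by rewrite !big_nil mulr1.
rewrite !big_cons exprS mulrACA; apply: ler_pM => //.
- by rewrite mulr_ge0 // le_max (nabs_ge0 na) // orbT.
- by rewrite mulr_ge0 ?exprn_ge0.
rewrite maxr_pMr // ge_max !le_max divfK ?lt0r_neq0 // lexx /=.
by rewrite [X in _ || X]ler_piMl ?orbT ?(nabs_ge0 na).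
Qed.

Lemma gn_noroot P a r r' : r' <= r ->
  (forall x, x \in poly_roots P -> r < abs (a - x)) -> gn P a r' = gn P a r.
Proof.
move=> r'r h; congr (_ * _); apply: eq_big_seq => x /h hx.
by rewrite !max_r // ltW // (le_lt_trans r'r).
Qed.

End GaussNormExtra.

Lemma sub_count_eq (T : eqType) (a b : pred T) (s : seq T) x :
  subpred a b -> (count b s <= count a s)%N -> x \in s -> b x -> a x.
Proof.
move=> sub; elim: s => // y s IH /=; have := sub_count sub s.
rewrite inE => le h /orP[/eqP xy|xs] bx.
  by move: h; rewrite -xy bx; case: (a x) => //; lia.
by apply: IH => //; move: h (sub y); case: (a y); case: (b y) => //=; lia.
Qed.

(** * Bounded invariant sets without poles *)

Section BoundedInvariant.
Context (R : realType) (K : fieldType) (abs : K -> R) (p : nat).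
Hypothesis (na : is_nonarch_abs abs) (K_closed : alg_closed K).
Hypothesis (p_prime : prime p) (abs_p : 0 < abs p%:R < 1).
Hypothesis res_alg : residue_algebraic abs p.

Local Notation gn := (gauss_norm abs).
Local Notation vg := (value_group abs).

Variables (P Q : {poly K}) (X : set K) (x0 x1 : K) (M : R).
Local Notation N := (P - 'X * Q).
Local Notation g := (frac_map P Q).

Hypothesis PQ_coprime : forall z, P.[z] = 0 -> Q.[z] != 0.
Hypothesis N_neq0 : N != 0.
Hypothesis XQ : forall z, X z -> Q.[z] != 0 /\ X (g z).
Hypothesis X_bounded : forall z, X z -> abs z <= M.
Hypothesis (Xx0 : X x0) (Xx1 : X x1) (x01 : x0 != x1).
(** A disk between two points of X lies in X except for the residue classes of the points of L. This
    is the form in which the analytic structure of X enters. *)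
Hypothesis X_convex : forall a b r, X a -> X b -> vg r -> r <= abs (a - b) ->
  exists L : seq K, forall z, abs (z - a) <= r ->
    (forall x, x \in L -> r <= abs (z - x)) -> X z.

(** The point of the tree attached to D(a, r) lies in the hull of X and is mapped
    below itself. *)
Definition contracted a r : Prop :=
  [/\ X a, exists2 b, X b & r <= abs (a - b), 0 < r & gn N a r <= r * gn Q a r].

Let Q_neq0 : Q != 0.
Proof. by apply/eqP => Q0; have [] := XQ Xx0; rewrite Q0 horner0 eqxx. Qed.

Let dense : forall s t : R, 0 <= s -> s < t -> exists2 r, vg r & s < r < t.
Proof. by move=> s t; apply: vg_dense abs_p. Qed.

Let gQ_gt0 a r : 0 < r -> 0 < gn Q a r.
Proof. by move=> r0; apply: gn_gt0. Qed.

Let gX_generic a b r (Ps : seq {poly K}) : X a -> X b -> vg r -> r <= abs (a - b) ->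
  exists z, [/\ X z, abs (z - a) <= r & forall S, S \in Ps -> abs S.[z] = gn S a r].
Proof.
move=> Xa Xb vr /(X_convex Xa Xb vr) [L hL].
have [z [za zL hz]] := gn_gen na K_closed Ps L a vr.
by exists z; split=> //; apply: hL.
Qed.

Let g_sub z y : Q.[z] != 0 -> g z - y = (P - y%:P * Q).[z] / Q.[z].
Proof. by move=> Qz; rewrite /frac_map !hornerE; field. Qed.

Let gN_dist z : Q.[z] != 0 -> g z - z = N.[z] / Q.[z].
Proof. by move=> Qz; rewrite /frac_map !hornerE; field. Qed.

Let gn_shift y y' a r : vg r -> abs (y - y') < r ->
  gn (P - y%:P * Q) a r < r * gn Q a r -> gn (P - y'%:P * Q) a r < r * gn Q a r.
Proof.
move=> vr hy h; have r0 := vg_gt0 na vr.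
have -> : P - y'%:P * Q = (P - y%:P * Q) - (y' - y)%:P * Q by rewrite polyCB; ring.
by apply: gnB_lt => //; rewrite gnZ // ltr_pM2r ?gQ_gt0 // (nabs_sub na).
Qed.

(** If the reduction of R on the disk is not constant, there is a periodic disk. Otherwise R(z) is
    within less than r of a constant at generic z, and that constant may be replaced by the image b
    in X of a generic point of X. In R(z) - z = (R(z) - b) - (z - b) the last term then dominates,
    which gives the equality. A slightly smaller disk around b is still contracted. *)
Lemma contracted_step_vg a r : ~ periodic_disk abs P Q X -> contracted a r -> vg r ->
  gn N a r = r * gn Q a r /\
  exists b r', [/\ contracted b r', r' < r, vg r', abs (b - a) <= r
    & gn (P - b%:P * Q) a r < r * gn Q a r].
Proof.
move=> nper [Xa [b0 Xb0 rb0] r0 hN] vr; have gQ := gQ_gt0 a r0.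
have [y ya hy] : exists2 y, abs (y - a) <= r & gn (P - y%:P * Q) a r < r * gn Q a r.
  apply: contrapT => H; apply: nper.
  have [L hL] := X_convex Xa Xb0 vr rb0.
  have /andP[_ abs_p1] := abs_p.
  apply: (nonconstant_periodic_disk na K_closed p_prime abs_p1 res_alg vr XQ hL) => //.
  by move=> y ya; rewrite leNgt; apply/negP => h; apply: H; exists y.
have [z [Xz za hz]] := gX_generic [:: P - y%:P * Q; Q] Xa Xb0 vr rb0.
have [Qz Xb] := XQ Xz; set b := g z in Xb.
have by' : abs (b - y) < r.
  by rewrite g_sub // (nabs_div na) !hz ?inE ?eqxx ?orbT // ltr_pdivrMr.
have hb : gn (P - b%:P * Q) a r < r * gn Q a r by apply: gn_shift hy; rewrite // (nabs_sub na).
have ba : abs (b - a) <= r by apply: (nabs_dist_le na (ltW by')).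
split.
  have -> : N = (P - b%:P * Q) - ('X - b%:P) * Q by ring.
  by rewrite gnBr ?gnM // gn_XsubC // (nabs_sub na).
set M1 := gn (P - b%:P * Q) a r in hb; set k := size (poly_roots Q).
have rQ : 0 < r * gn Q a r by rewrite mulr_gt0.
have t1 : M1 / (r * gn Q a r) < 1 by rewrite ltr_pdivrMr // mul1r.
(* Shrinking r to r' costs at most a factor r' / r for each of the k roots of Q, and one more for
   the radius itself. *)
have [q /andP[q0 q1] hq] := expr_near1 k.+1 t1.
have [r' vr' /andP[h1 h2]] : exists2 r', vg r' & q * r < r' < r.
  by apply: dense; rewrite ?mulr_ge0 ?(ltW r0) // gtr_pMl.
have r'0 := vg_gt0 na vr'.
have M1le : M1 <= r' * gn Q b r'.
  have : M1 / (r * gn Q a r) <= (r' / r) ^+ k.+1.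
    by apply: hq; rewrite ler_pdivlMr // ler_pdivrMr // mul1r !ltW.
  rewrite ler_pdivrMr // => /le_trans; apply.
  have -> : (r' / r) ^+ k.+1 * (r * gn Q a r) = r' * ((r' / r) ^+ k * gn Q a r).
    by rewrite exprS mulrACA divfK // lt0r_neq0.
  by rewrite ler_pM2l // -(gn_center na _ ba); apply: gn_shrink => //; exact: ltW.
exists b, r'; split=> //; split=> //.
  have [h|h] := leP r (abs (b - a)); first by exists a => //; apply: le_trans h; exact: ltW.
  exists b0 => //; rewrite ((nabs_dist_eq na) b a b0); last exact: lt_le_trans rb0.
  by apply: le_trans rb0; exact: ltW.
have -> : N = (P - b%:P * Q) - ('X - b%:P) * Q by ring.
apply: gnB_le => //; last by rewrite gnM // gn_XsubC // subrr (nabs0 na) // ltW.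
apply: le_trans M1le; rewrite /M1 -(gn_center na _ ba); apply: gn_homo => //; exact: ltW.
Qed.

(** For r outside the value group no generic points are at hand, so the centre is kept and the
    monomials c r^i and d r^(j+1) are compared. If i > j, the inequality between them persists for
    smaller r. Otherwise equality would put a power of r, hence r, into the value group; so the
    inequality is strict and holds slightly below r as well. *)
Lemma contracted_step a r : ~ periodic_disk abs P Q X -> contracted a r ->
  exists b r', [/\ contracted b r', r' < r, vg r' & abs (b - a) <= r].
Proof.
move=> nper Sar; have [vr|nvr] := pselect (vg r).
  by have [_ [b [r' [? ? ? ? _]]]] := contracted_step_vg nper Sar vr; exists b, r'.
have [Xa [b0 Xb0 rb0] r0 hN] := Sar; exists a.
have [l /andP[l2 lr] hl] : exists2 l', r / 2 <= l' < r & forall x,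
    x \in [seq abs (a - x) | x <- poly_roots N ++ poly_roots Q] -> x <= l' \/ r <= x.
  by apply: gap_left; lra.
have l0 : 0 < l by lra.
have hl' x : x \in poly_roots N ++ poly_roots Q -> abs (a - x) <= l \/ r <= abs (a - x).
  by move=> hx; apply: hl; apply: map_f.
have [c [i [/(_ N_neq0) vc hc]]] : exists c k, [/\ N != 0 -> vg c &
    forall t, l <= t <= r -> gn N a t = c * t ^+ k].
  by apply: gn_mono => //; [exact: ltW | move=> x hx; apply: hl'; rewrite mem_cat hx].
have [d [j [/(_ Q_neq0) vd hd]]] : exists c k, [/\ Q != 0 -> vg c &
    forall t, l <= t <= r -> gn Q a t = c * t ^+ k].
  by apply: gn_mono => //; [exact: ltW | move=> x hx; apply: hl'; rewrite mem_cat hx orbT].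
have c0 := vg_gt0 na vc; have d0 := vg_gt0 na vd.
have X0 k (t : R) : 0 < t -> 0 < t ^+ k by move=> *; rewrite exprn_gt0.
suff [r' vr' /andP[/andP[h1 h2] h3]] : exists2 r', vg r' & (l < r' < r) && (c * r' ^+ i <= d * r' ^+ j.+1).
  exists r'; split=> //; last by rewrite subrr (nabs0 na) // ltW.
  split=> //; [by exists b0 => //; apply: le_trans rb0; exact: ltW | exact: vg_gt0 vr' |].
  by rewrite hc ?hd ?(ltW h1) ?(ltW h2) // mulrCA -exprS.
have rr : l <= r <= r by rewrite lexx ltW.
move: hN; rewrite (hc _ rr) (hd _ rr) mulrCA -exprS => hN.
have [ji|ij] := ltnP j i.
  move: (subnKC ji); set m := (i - j.+1)%N => e.
  have [r' vr' /andP[h1 h2]] := dense (ltW l0) lr; exists r'; rewrite ?h1 ?h2 //=.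
  have r'0 : 0 < r' by lra.
  have k1 : c * r ^+ m <= d.
    by rewrite -(ler_pM2r (X0 j.+1 _ r0)); move: hN; rewrite -e exprD; lra.
  have k2 : c * r' ^+ m <= c * r ^+ m by rewrite ler_pM2l // lerXn2r ?nnegrE ?ltW.
  rewrite -e exprD mulrCA mulrC ler_pM2r ?X0 //; lra.
have {}ij := leqW ij.
move: (subnKC ij); set m := (j.+1 - i)%N => e.
have k1 : c <= d * r ^+ m.
  by rewrite -(ler_pM2r (X0 i _ r0)); move: hN; rewrite -e exprD; lra.
have m0 : (0 < m)%N || (m == 0)%N by case: m {e k1}.
case/orP: m0 => [m0|/eqP m0]; last first.
  have [r' vr' /andP[h1 h2]] := dense (ltW l0) lr; exists r'; rewrite ?h1 ?h2 //=.
  move: k1 e; rewrite m0 expr0 mulr1 addn0 => k1 <-; rewrite ler_pM2r // X0 //; lra.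
have k2 : c < d * r ^+ m.
  rewrite lt_neqAle k1 andbT; apply/eqP => ce; apply: nvr.
  apply: (vg_root na K_closed m0 (ltW r0)).
  have -> : r ^+ m = c / d by rewrite ce mulrC mulKf // lt0r_neq0.
  by apply: vgM => //; apply: vgV.
have dr : 0 < d * r ^+ m by rewrite mulr_gt0 ?X0.
have t1 : c / (d * r ^+ m) < 1 by rewrite ltr_pdivrMr // mul1r.
have [q /andP[q0 q1] hq] := expr_near1 m t1.
have [r' vr' /andP[]] : exists2 r', vg r' & Num.max l (q * r) < r' < r.
  by apply: dense; rewrite ?le_max ?(ltW l0) // gt_max lr gtr_pMl.
rewrite gt_max => /andP[h1 h2] h3; exists r'; rewrite ?h1 ?h3 //=.
have r'0 : 0 < r' by lra.
have k3 : c <= d * r' ^+ m.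
  have : c / (d * r ^+ m) <= (r' / r) ^+ m.
    by apply: hq; rewrite ler_pdivlMr // ler_pdivrMr // mul1r !ltW.
  rewrite ler_pdivrMr // expr_div_n => /le_trans; apply.
  by rewrite mulrCA divfK // lt0r_neq0 ?X0.
by rewrite -e exprD mulrCA mulrC ler_pM2l ?X0.
Qed.

(** Let rho be the supremum of the distances from x0 to X. Since z and R(z) both lie in X, |R(z) -
    z| <= rho on X, so D(x0, rho) is contracted if rho is attained. If it is not, and no disk is
    contracted, then r < |R(z) - z| < rho at generic points for all r just below rho, which
    [no_squeeze_left] excludes. *)
Lemma exists_contracted : exists a r, contracted a r.
Proof.
apply: contrapT => H0; have H a r : ~ contracted a r by move=> h; apply: H0; exists a, r.
pose E := [set abs (x0 - b) | b in X].
have supE : has_sup E.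
  split; first by exists (abs (x0 - x0)), x0.
  exists (Num.max (abs x0) M) => _ [b Xb <-]; apply: (nabsB_le na) => //.
    by rewrite le_max lexx.
  by rewrite le_max X_bounded ?orbT.
pose rho := sup E.
have rho_ub b : X b -> abs (x0 - b) <= rho.
  by move=> Xb; apply: (ub_le_sup supE.2); exists b.
have rho0 : 0 < rho.
  by apply: lt_le_trans (rho_ub x1 Xx1); rewrite (nabs_gt0 na) subr_eq0.
have [[b Xb hb]|nattained] := pselect (exists2 b, X b & abs (x0 - b) = rho).
  have vrho : vg rho by exists (x0 - b); rewrite ?hb // -(nabs_gt0 na) hb.
  have le_rho : rho <= abs (x0 - b) by rewrite hb.
  have [z [Xz za hz]] := gX_generic [:: N; Q] Xx0 Xb vrho le_rho.
  have [Qz Xgz] := XQ Xz; apply: (H x0 rho); split=> //; first by exists b.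
  rewrite -ler_pdivrMr ?gQ_gt0 // -!hz ?inE ?eqxx ?orbT // -(nabs_div na) -gN_dist //.
  by apply: (nabs_dist_le na (y := x0)); rewrite ?rho_ub // (nabs_sub na) rho_ub.
have rho_lt b : X b -> abs (x0 - b) < rho.
  move=> Xb; rewrite lt_neqAle rho_ub // andbT; apply/eqP => e; apply: nattained.
  by exists b.
have [l /andP[l2 lr] hl] : exists2 l', rho / 2 <= l' < rho & forall x,
    x \in [seq abs (x0 - x) | x <- poly_roots N ++ poly_roots Q] -> x <= l' \/ rho <= x.
  by apply: gap_left; lra.
have l0 : 0 < l by lra.
have hl' x : x \in poly_roots N ++ poly_roots Q -> abs (x0 - x) <= l \/ rho <= abs (x0 - x).
  by move=> hx; apply: hl; apply: map_f.
have [c [i [/(_ N_neq0) vc hc]]] : exists c k, [/\ N != 0 -> vg c &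
    forall t, l <= t <= rho -> gn N x0 t = c * t ^+ k].
  by apply: gn_mono => //; [exact: ltW | move=> x hx; apply: hl'; rewrite mem_cat hx].
have [d [j [/(_ Q_neq0) vd hd]]] : exists c k, [/\ Q != 0 -> vg c &
    forall t, l <= t <= rho -> gn Q x0 t = c * t ^+ k].
  by apply: gn_mono => //; [exact: ltW | move=> x hx; apply: hl'; rewrite mem_cat hx orbT].
apply: (no_squeeze_left dense (i := i) (j := j) (c := c) l0 lr (vg_gt0 na vd)) => r vr /andP[lr' rr].
have rr' : l <= r <= rho by rewrite !ltW.
have [_ [b Xb <-] rb] : exists2 y, E y & r < y.
  by apply: (sup_gt supE.1); exact: rr.
have [z [Xz za hz]] := gX_generic [:: N; Q] Xx0 Xb vr (ltW rb).
have r0 := vg_gt0 na vr.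
rewrite exprS mulrCA -(hc _ rr') -(hd _ rr'); apply/andP; split.
  rewrite ltNge; apply/negP => h; apply: (H x0 r); split=> //; exists b => //; exact: ltW.
have [Qz Xgz] := XQ Xz.
rewrite -ltr_pdivrMr ?gQ_gt0 // -!hz ?inE ?eqxx ?orbT // -(nabs_div na) -gN_dist //.
by apply: (nabs_dist_lt na (y := x0)); rewrite ?rho_lt // (nabs_sub na) rho_lt.
Qed.

(** Take a contracted disk containing as few zeros of N and Q as possible.  All
    contracted disks below it then contain the same zeros, among them a fixed
    point z1, and they shrink to z1: at a positive limit radius, R would contract
    towards z1 with a non-integral exponent. *)
Lemma bounded_invariant_periodic_disk : periodic_disk abs P Q X.
Proof.
apply: contrapT => nper.
pose Z := poly_roots N ++ poly_roots Q.
pose cnt a r := count (fun x => abs (a - x) <= r) Z.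
have [a0 [r0 [S0 v0 cmin]]] : exists a0 r0, [/\ contracted a0 r0, vg r0 &
    forall b r, contracted b r -> (cnt a0 r0 <= cnt b r)%N].
  have exn : exists n, `[< exists a r, contracted a r /\ cnt a r = n >].
    by have [a [r Sar]] := exists_contracted; exists (cnt a r); apply/asboolP; exists a, r.
  case: (ex_minnP exn) => n /asboolP[a [r [Sar hn]]] nmin.
  (* One step down cannot raise the minimal count and yields a radius in the value group. *)
  have [b [r' [Sb r'r vr' ba]]] := contracted_step nper Sar.
  exists b, r'; split=> // b2 r2 S2; apply: (@leq_trans n).
    rewrite -hn; apply: sub_count => x /= bx.
    by apply: (nabs_dist_le na (y := b)); [rewrite (nabs_sub na) | apply: le_trans bx (ltW r'r)].
  by apply: nmin; apply/asboolP; exists b2, r2.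
have [Xa0 [b0 Xb0 r0b0] r00 hN0] := S0.
have same b r x : contracted b r -> abs (b - a0) <= r0 -> r <= r0 -> x \in Z ->
    abs (a0 - x) <= r0 -> abs (b - x) <= r.
  move=> Sb ba rr xZ ax.
  have sub : subpred (fun x => abs (b - x) <= r) (fun x => abs (a0 - x) <= r0).
    move=> y /= byr; apply: (nabs_dist_le na (y := b)); first by rewrite (nabs_sub na).
    exact: le_trans rr.
  exact: (sub_count_eq sub (cmin b r Sb)).
have [e0 [b1 [r1 [S1 r10 v1 b1a _]]]] := contracted_step_vg nper S0 v0.
have r1pos := vg_gt0 na v1.
(* Without a zero of N in D(a0, r0) the Gauss norm of N would be the same at r0 and r1, whereas r
   times that of Q strictly drops; since equality holds at r0, the disk at r1 would not be
   contracted. *)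
have [z1 Nz1 a0z1] : exists2 z1, root N z1 & abs (a0 - z1) <= r0.
  apply: contrapT => H.
  have hNr : gn N b1 r1 = gn N b1 r0.
    apply: gn_noroot => //; first exact: ltW.
    move=> x; rewrite mem_poly_roots // => Nx; rewrite ltNge; apply/negP => bx; apply: H.
    by exists x => //; apply: (nabs_dist_le na (y := b1)); rewrite // (nabs_sub na).
  have [_ _ _] := S1; rewrite hNr (gn_center na _ b1a) e0 -(gn_center na _ b1a) leNgt => /negP; apply.
  apply: (@le_lt_trans _ _ (r1 * gn Q b1 r0)).
    by rewrite ler_pM2l //; apply: gn_homo => //; exact: ltW.
  by rewrite ltr_pM2r ?gQ_gt0.
have z1Z : z1 \in Z by rewrite mem_cat mem_poly_roots ?Nz1.
pose J := [set r | exists b, [/\ contracted b r, abs (b - a0) <= r0 & r <= r0]].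
have J0 : J r0 by exists a0; rewrite subrr (nabs0 na) // ltW.
have J_gt0 r : J r -> 0 < r by move=> [b [[_ _ ? _] _ _]].
have J_step r : J r -> exists2 r', J r' & r' < r /\ vg r'.
  move=> [b [Sb ba rr]]; have [b' [r' [Sb' r'r vr' b'b]]] := contracted_step nper Sb.
  exists r' => //; exists b'; split=> //; last by apply: le_trans rr; exact: ltW.
  by apply: (nabs_dist_le na (y := b)) => //; apply: le_trans rr.
have J_near r : J r -> exists b, [/\ contracted b r, abs (b - z1) <= r & abs (b - a0) <= r0].
  by move=> [b [Sb ba rr]]; exists b; split=> //; apply: (same b r z1).
have infJ : has_inf J by split; [exists r0 | exists 0 => r /J_gt0 /ltW].
pose rs := inf J.
have rs_lb r : J r -> rs <= r by move=> Jr; apply: ge_inf => //; exact: infJ.2.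
have rs0 : 0 <= rs by apply: lb_le_inf => [|r /J_gt0 /ltW //]; exists r0.
have rsr0 : rs < r0.
  by have [r' Jr' [h _]] := J_step _ J0; apply: le_lt_trans h; apply: rs_lb.
have J_above r : rs < r -> exists2 r', J r' & r' < r.
  by move=> h; apply: (inf_lt infJ.1 h).
have notJrs : ~ J rs by move=> /J_step [r' /rs_lb h [h2 _]]; lra.
(* By minimality a zero in D(a0, r0) stays, together with z1, in every contracted disk inside it, so
   its distance to z1 is at most every radius in J. *)
have Zgap x : x \in Z -> abs (z1 - x) <= rs \/ r0 < abs (z1 - x).
  move=> xZ; have [ax|ax] := leP (abs (a0 - x)) r0.
    left; apply: lb_le_inf; first by exists r0.
    move=> r Jr; have [b [Sb ba rr]] := Jr.
    by apply: (nabs_dist_le na (y := b)); [rewrite (nabs_sub na)|]; apply: same.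
  right; rewrite (nabs_dist_eq na (y := a0)) //.
  by rewrite (nabs_sub na) (le_lt_trans a0z1).
have Zgap' x : x \in Z -> abs (z1 - x) <= rs \/ r0 <= abs (z1 - x).
  by move=> /Zgap [|/ltW]; [left | right].
have [c [i [/(_ N_neq0) vc hc]]] : exists c k, [/\ N != 0 -> vg c &
    forall t, rs <= t <= r0 -> gn N z1 t = c * t ^+ k].
  by apply: gn_mono => // x hx; apply: Zgap'; rewrite mem_cat hx.
have [d [j [/(_ Q_neq0) vd hd]]] : exists c k, [/\ Q != 0 -> vg c &
    forall t, rs <= t <= r0 -> gn Q z1 t = c * t ^+ k].
  by apply: gn_mono => // x hx; apply: Zgap'; rewrite mem_cat hx orbT.
have J_eq r : J r -> vg r -> c * r ^+ i = d * r ^+ j.+1.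
  move=> Jr vr; have [b [Sb bz ba]] := J_near _ Jr.
  have rr : rs <= r <= r0 by rewrite rs_lb //; case: Jr => ? [].
  have [+ _] := contracted_step_vg nper Sb vr.
  by rewrite !(gn_center na _ bz) hc // hd // mulrCA -exprS.
(* The monomials agree at the two radii r0 and r2, which forces equal exponents and then equal
   constants. Hence they agree on the whole interval, and being contracted no longer depends on the
   centre chosen in X. *)
have tau r : 0 < r -> rs <= r <= r0 -> gn N z1 r = r * gn Q z1 r.
  have [r2 J2 [r2r0 v2]] := J_step _ J0.
  have h1 := J_eq _ J0 v0; have h2 := J_eq _ J2 v2.
  have r2pos := J_gt0 _ J2.
  have ij : i = j.+1.
    apply: (@ieexprIn _ (r2 / r0)); rewrite ?divr_gt0 //.
      by rewrite lt_eqF // ltr_pdivrMr // mul1r.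
    rewrite !expr_div_n; apply: (mulfI (lt0r_neq0 (vg_gt0 na vc))).
    apply: (mulIf (lt0r_neq0 (exprn_gt0 i r00))).
    apply: (mulIf (lt0r_neq0 (exprn_gt0 j.+1 r00))).
    have -> : c * (r2 ^+ i / r0 ^+ i) * r0 ^+ i * r0 ^+ j.+1 = c * r2 ^+ i * r0 ^+ j.+1.
      by rewrite mulrA divfK // lt0r_neq0 // exprn_gt0.
    have -> : c * (r2 ^+ j.+1 / r0 ^+ j.+1) * r0 ^+ i * r0 ^+ j.+1 = c * r0 ^+ i * r2 ^+ j.+1.
      by rewrite mulrAC mulrA divfK ?lt0r_neq0 ?exprn_gt0 // mulrAC.
    by rewrite h1 h2 mulrAC.
  have cd : c = d.
    by apply: (mulIf (lt0r_neq0 (exprn_gt0 j.+1 r00))); rewrite -h1 ij.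
  by move=> rpos rr; rewrite hc // hd // ij cd mulrCA exprS.
have J_any b r : X b -> 0 < r -> rs <= r <= r0 -> abs (b - z1) <= r ->
    contracted b r /\ abs (b - a0) <= r0.
  move=> Xb rpos /[dup] rr /andP[_ rr0] bz.
  have ba : abs (b - a0) <= r0.
    by apply: (nabs_dist_le na (y := z1)); [apply: le_trans rr0 | rewrite (nabs_sub na)].
  split=> //; split=> //.
    have [h|h] := leP r (abs (b - b0)); first by exists b0.
    exists a0 => //; rewrite (nabs_sub na) leNgt; apply/negP => h2.
    have : abs (a0 - b0) < r by apply: (nabs_dist_lt na (y := b)).
    by rewrite ltNge (le_trans rr0).
  by rewrite !(gn_center na _ bz) tau.
have J_in r : rs < r -> r <= r0 -> J r.
  move=> h h2; have [r' Jr' r'r] := J_above _ h.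
  have [b [[Xb _ _ _] bz _]] := J_near _ Jr'.
  have [||||? ?] := @J_any b r; rewrite ?h2 ?ltW //; first exact: le_lt_trans h.
    exact: le_lt_trans r'r.
  by exists b.
(* The step below radius r has its centre b' within less than r of z1, because the smaller
   contracted disk contains z1; so z1 can replace b'. *)
have u_lt r : vg r -> rs < r -> r <= r0 -> gn (P - z1%:P * Q) z1 r < r * gn Q z1 r.
  move=> vr h h2; have Jr := J_in _ h h2.
  have [b [Sb bz ba]] := J_near _ Jr.
  have [_ [b' [r' [Sb' r'r vr' b'b hb']]]] := contracted_step_vg nper Sb vr.
  rewrite -!(gn_center na _ bz); apply: gn_shift hb' => //.
  apply: le_lt_trans (r'r); apply: (same b' r') => //.
    by apply: (nabs_dist_le na (y := b)) => //; apply: le_trans h2.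
  by apply: le_trans h2; exact: ltW.
have Q1 : Q.[z1] != 0.
  apply/eqP => Q1; have := PQ_coprime (z := z1); rewrite Q1 eqxx => H.
  suff /H : P.[z1] = 0 by [].
  by move: Nz1; rewrite rootE !hornerE Q1 mulr0 subr0 => /eqP.
(* At limit radius 0 there is no pole within r0 of z1, and [u_lt] at r0 says that R maps the open
   disk of radius r0 around z1 into itself. *)
have [rs_eq0|rs_neq0] := eqVneq rs 0.
  have Qr x : root Q x -> r0 < abs (z1 - x).
    move=> Qx; have [||//] := Zgap x; first by rewrite mem_cat [X in _ || X]mem_poly_roots // Qx orbT.
    rewrite rs_eq0 le_eqVlt ltNge (nabs_ge0 na) orbF (nabs_eq0 na) subr_eq0 => /eqP e.
    by move: Qx; rewrite -e rootE (negPf Q1).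
  have [r' Jr' r'r] := J_above _ rsr0.
  have [b [[Xb _ _ _] bz _]] := J_near _ Jr'.
  apply: nper; apply: (invariant_periodic_disk v0 Xb (a := z1)); first exact: le_lt_trans r'r.
  move=> z zr; have zr' := ltW zr.
  have hQz : abs Q.[z] = gn Q z1 r0.
    apply: gn_generic_roots => // x /Qr h; rewrite (nabs_dist_eq na (y := z1)) ?ltW //.
    exact: lt_trans h.
  have Qz : Q.[z] != 0 by rewrite -(nabs_gt0 na) hQz gQ_gt0.
  split=> //; rewrite g_sub // (nabs_div na) hQz ltr_pdivrMr ?gQ_gt0 //.
  by apply: le_lt_trans (u_lt _ v0 rsr0 (lexx _)); apply: gn_ub.
have rs_gt0 : 0 < rs by rewrite lt_def rs_neq0.
have [h /andP[rsh hr0] hgap] : exists2 h', rs < h' <= r0 & forall x,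
    x \in [seq abs (z1 - x) | x <- poly_roots (P - z1%:P * Q)] -> x <= rs \/ h' <= x.
  exact: gap_right.
have [e [k [_ he]]] : exists c k, [/\ P - z1%:P * Q != 0 -> vg c &
    forall t, rs <= t <= h -> gn (P - z1%:P * Q) z1 t = c * t ^+ k].
  by apply: gn_mono => // x hx; apply: hgap; apply: map_f.
apply: (no_squeeze_right dense (i := k) (j := j) (c := e) rs_gt0 rsh (vg_gt0 na vd)) => r vr /andP[rr rh].
have rr0 : r <= r0 by apply: ltW; exact: lt_le_trans hr0.
have rrs : rs <= r <= r0 by rewrite (ltW rr).
have -> : d * r ^+ j.+1 = r * gn Q z1 r by rewrite hd // exprS mulrCA.
rewrite -he ?(ltW rr) ?(ltW rh) // -hd // u_lt // andbT ltNge.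
(* If |R(z) - z1| <= rs at a generic z of X, then R(z) is a point of X at which the disk of radius
   rs is contracted, so the infimum of J would be attained. *)
apply/negP => hle; apply: notJrs.
have Jr := J_in _ rr rr0; have [b [[Xb [b2 Xb2 rb2] rpos _] bz ba]] := J_near _ Jr.
have [z [Xz zb hz]] := gX_generic [:: P - z1%:P * Q; Q] Xb Xb2 vr rb2.
have [Qz Xgz] := XQ Xz.
have gz : abs (g z - z1) <= rs.
  by rewrite g_sub // (nabs_div na) !hz ?inE ?eqxx ?orbT // !(gn_center na _ bz) ler_pdivrMr ?gQ_gt0.
have rsrs : rs <= rs <= r0 by rewrite lexx ltW.
have [Sgz ?] := J_any _ _ Xgz rs_gt0 rsrs gz.
by exists (g z); split=> //; exact: ltW.
Qed.

End BoundedInvariant.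

(** * Dynamics on a periodic disk *)

(** The degree d homogenisation of S. The degree is a parameter because S may have smaller degree,
    in which case the form vanishes at infinity. *)
Definition hom_eval (K : fieldType) (d : nat) (S : {poly K}) (x y : K) : K :=
  \sum_(i < d.+1) S`_i * x ^+ i * y ^+ (d - i).

Definition hom_comp (K : fieldType) (d : nat) (S A B : {poly K}) : {poly K} :=
  \sum_(i < d.+1) S`_i *: (A ^+ i * B ^+ (d - i)).

Lemma horner_hom_comp (K : fieldType) d (S A B : {poly K}) z :
  (hom_comp d S A B).[z] = hom_eval d S A.[z] B.[z].
Proof.
rewrite /hom_comp horner_sum; apply: eq_bigr => i _.
by rewrite hornerZ hornerM !horner_exp mulrA.
Qed.

Lemma hom_eval_horner (K : fieldType) d (S : {poly K}) x y :
  (size S <= d.+1)%N -> y != 0 -> hom_eval d S x y = y ^+ d * S.[x / y].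
Proof.
move=> hS y0; rewrite (horner_coef_wide _ hS) mulr_sumr; apply: eq_bigr => i _.
have id : (i <= d)%N by rewrite -ltnS.
have -> : y ^+ d = y ^+ (d - i) * y ^+ i by rewrite -exprD subnK.
rewrite expr_div_n mulrCA !mulrA -[LHS]mulrA [_ * y ^+ (d - i)]mulrC -!mulrA; congr (_ * _).
by rewrite [y ^+ i * _]mulrC divfK ?expf_neq0.
Qed.

Lemma hom_eval_infty (K : fieldType) d (S : {poly K}) x : hom_eval d S x 0 = S`_d * x ^+ d.
Proof.
rewrite /hom_eval big_ord_recr /= subnn expr0 mulr1 big1 ?add0r // => i _.
by rewrite expr0n subn_eq0 leqNgt ltn_ord mulr0.
Qed.

(** Only the existence of a presentation without poles on D is recorded, so iterates can be treated
    without computing their numerators and denominators. *)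
Definition rational_on (K : fieldType) (D : set K) (phi : K -> K) : Prop :=
  exists A B : {poly K}, forall z, D z -> B.[z] != 0 /\ phi z = A.[z] / B.[z].

Section RationalOn.
Context (K : fieldType).
Implicit Types (D : set K) (phi : K -> K).

Lemma rational_on_sub D D' phi : D `<=` D' -> rational_on D' phi -> rational_on D phi.
Proof. by move=> DD' [A [B h]]; exists A, B => z /DD' /h. Qed.

Lemma rational_on_id D : rational_on D id.
Proof. by exists 'X, 1 => z _; rewrite !hornerE oner_neq0 divr1. Qed.

Lemma rational_onB D phi phi' : rational_on D phi -> rational_on D phi' ->
  rational_on D (fun z => phi z - phi' z).
Proof.
move=> [A [B h]] [A' [B' h']]; exists (A * B' - A' * B), (B * B') => z Dz.
have [Bz ->] := h z Dz; have [B'z ->] := h' z Dz.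
by rewrite !hornerE mulf_neq0 //; split=> //; field; rewrite Bz B'z.
Qed.

Lemma rational_on_cst D c : rational_on D (fun=> c).
Proof. by exists c%:P, 1 => z _; rewrite !hornerE oner_neq0 divr1. Qed.

Lemma rational_on_comp D D' phi phi' : rational_on D phi ->
  (forall z, D z -> D' (phi z)) -> rational_on D' phi' ->
  rational_on D (phi' \o phi).
Proof.
move=> [A [B h]] DD' [A' [B' h']].
pose d := maxn (size A') (size B').
have sA : (size A' <= d.+1)%N by apply: leqW; rewrite leq_maxl.
have sB : (size B' <= d.+1)%N by apply: leqW; rewrite leq_maxr.
exists (hom_comp d A' A B), (hom_comp d B' A B) => z Dz.
have [Bz hz] := h z Dz; have [B'z hz'] := h' _ (DD' z Dz).
rewrite !horner_hom_comp !hom_eval_horner // -hz; split.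
  by rewrite mulf_neq0 ?expf_neq0.
by rewrite /= hz' -mulf_div divff ?expf_neq0 // mul1r.
Qed.

Lemma rational_on_iter D phi n : rational_on D phi -> (forall z, D z -> D (phi z)) ->
  rational_on D (iter n phi).
Proof.
move=> h hD; elim: n => [|n IH]; first exact: rational_on_id.
by apply: (rational_on_comp IH _ h) => z Dz; elim: n {IH} => //= n; apply: hD.
Qed.

Lemma frac_map_iter_rational D (P Q : {poly K}) n :
  (forall z k, D z -> Q.[iter k (frac_map P Q) z] != 0) ->
  rational_on D (iter n (frac_map P Q)).
Proof.
move=> h; elim: n => [|n IH]; first exact: rational_on_id.
apply: (rational_on_comp (D' := [set z | Q.[z] != 0]) IH) => [z Dz|]; first exact: h.
by exists P, Q.
Qed.

End RationalOn.

(** * The ultrametric Schwarz lemma *)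

Section Schwarz.
Context (R : realType) (K : fieldType) (abs : K -> R).
Hypothesis (na : is_nonarch_abs abs) (K_closed : alg_closed K).
Context (pi : K).
Hypothesis abs_pi : 0 < abs pi < 1.

Local Notation gn := (gauss_norm abs).
Local Notation vg := (value_group abs).

Definition cball a r : set K := [set z | abs (z - a) <= r].
Definition oball a r : set K := [set z | abs (z - a) < r].

Lemma oball_center a b r z : oball a r b -> oball a r z -> oball b r z.
Proof. by rewrite /oball /= => hb hz; apply: (nabs_dist_lt na hz); rewrite (nabs_sub na). Qed.

Lemma oballC a b r : oball a r b -> oball b r a.
Proof. by rewrite /oball /= (nabs_sub na). Qed.

Lemma cball_subset_oball a r s : r < s -> cball a r `<=` oball a s.
Proof. by move=> rs z; rewrite /cball /oball /= => h; apply: le_lt_trans rs. Qed.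

(** All zeros of the numerator and of the denominator lie outside the disk, and the distance from
    such a point is the same for all points of the disk. *)
Lemma nabs_cst_oball (phi : K -> K) a r : rational_on (oball a r) phi ->
  (forall z, oball a r z -> phi z != 0) ->
  forall z w, oball a r z -> oball a r w -> abs (phi z) = abs (phi w).
Proof.
move=> [A [B h]] h0 z w Dz Dw.
have E S : (forall z, oball a r z -> S.[z] != 0) -> abs S.[z] = abs S.[w].
  move=> hS; have S0 : S != 0 by apply/eqP => S0; have := hS z Dz; rewrite S0 horner0 eqxx.
  rewrite !(nabs_horner na K_closed); congr (_ * _); apply: eq_big_seq => x.
  rewrite mem_poly_roots // => Sx; have nx : ~ oball a r x.
    by move=> /hS; rewrite (rootP Sx) eqxx.
  have e : abs (w - z) < abs (z - x).
    have zw : abs (w - z) < r by apply: oball_center Dw.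
    apply: (lt_le_trans zw); rewrite leNgt; apply/negP => zx; apply: nx.
    by apply: (nabs_dist_lt na (y := z)) => //; rewrite (nabs_sub na).
  by rewrite (nabs_dist_eq na e).
have [Bz ->] := h z Dz; have [Bw ->] := h w Dw.
rewrite !(nabs_div na) E ?(E B) // => [y Dy|y Dy]; first by have [] := h y Dy.
by have := h0 y Dy; have [By ->] := h y Dy; apply: contra => /eqP ->; rewrite mul0r.
Qed.

Lemma gn_den (B : {poly K}) a r z : 0 < r -> (forall w, cball a r w -> B.[w] != 0) ->
  cball a r z -> abs B.[z] = gn B a r.
Proof.
move=> r0 hB Dz; have B0 : B != 0.
  by apply/eqP => B0; have := hB z Dz; rewrite B0 horner0 eqxx.
apply: gn_generic_roots => // x Bx; rewrite leNgt; apply/negP => zx.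
have /hB : cball a r x.
  by apply: (nabs_dist_le na (y := z)) => //; rewrite (nabs_sub na) ltW.
by rewrite (rootP Bx) eqxx.
Qed.

(** Divide phi(z) - phi(w) by z - w: the Gauss norm is multiplicative and that of X - w is r, so the
    quotient is bounded by M / r. *)
Lemma schwarz_cball (phi : K -> K) a r M : vg r -> rational_on (cball a r) phi ->
  (forall z, cball a r z -> abs (phi z) <= M) ->
  forall z w, cball a r z -> cball a r w -> abs (phi z - phi w) * r <= abs (z - w) * M.
Proof.
move=> vr [A [B h]] hM z w Dz Dw; have r0 := vg_gt0 na vr.
have hB y : cball a r y -> abs B.[y] = gn B a r.
  by move=> Dy; apply: gn_den => // x /h [].
have [Bw hw] := h w Dw.
have [E defE] : exists E, A - (phi w)%:P * B = E * ('X - w%:P).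
  by apply/factor_theorem; rewrite rootE !hornerE hw divfK // subrr.
have gE : gn E a r * r <= M * gn B a r.
  rewrite -[X in gn E a r * X](gn_XsubC na K_closed (a := a) (b := w) vr); last first.
    by rewrite (nabs_sub na).
  rewrite -gnM // -defE.
  have [y [ya _ hy]] := gn_gen na K_closed [:: A - (phi w)%:P * B] [::] a vr.
  rewrite -hy ?inE ?eqxx //; have [By py] := h y ya.
  have -> : (A - (phi w)%:P * B).[y] = (phi y - phi w) * B.[y].
    by rewrite py !hornerE mulrBl divfK.
  by rewrite (nabsM na) hB // ler_wpM2r ?gn_ge0 //; apply: (nabsB_le na) => //; apply: hM.
have [Bz hz] := h z Dz.
have -> : phi z - phi w = E.[z] * (z - w) / B.[z].
  have : (A - (phi w)%:P * B).[z] = E.[z] * (z - w) by rewrite defE !hornerE.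
  by move=> <-; rewrite hz !hornerE mulrBl mulfK.
have gB0 : 0 < gn B a r by rewrite -(hB z Dz) (nabs_gt0 na).
rewrite (nabs_div na) (nabsM na) (hB z Dz) mulrAC ler_pdivrMr // mulrAC -[X in _ <= X]mulrA mulrC.
rewrite ler_wpM2l ?(nabs_ge0 na) //; apply: le_trans gE.
by rewrite ler_pM2r //; apply: gn_ub.
Qed.

Lemma schwarz_oball (phi : K -> K) a r M : rational_on (oball a r) phi ->
  (forall z, oball a r z -> abs (phi z) <= M) ->
  forall z w, oball a r z -> oball a r w -> abs (phi z - phi w) * r <= abs (z - w) * M.
Proof.
move=> hphi hM z w Dz Dw; rewrite leNgt; apply/negP => hlt.
have r0 : 0 < r by apply: le_lt_trans Dz; apply: (nabs_ge0 na).
have M0 : 0 <= M by apply: le_trans (hM z Dz); apply: (nabs_ge0 na).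
have d0 : 0 < abs (phi z - phi w).
  rewrite -(pmulr_lgt0 _ r0); apply: le_lt_trans hlt.
  by rewrite mulr_ge0 ?(nabs_ge0 na).
(* A strict violation on the open disk already occurs on every closed disk of radius above [s], and
   such radii below r exist in the value group. *)
pose s := Num.max (Num.max (abs (z - a)) (abs (w - a))) (abs (z - w) * M / abs (phi z - phi w)).
have sr : s < r by
  rewrite /s !gt_max (Dz : abs (z - a) < r) (Dw : abs (w - a) < r) /= ltr_pdivrMr // [r * _]mulrC.
have s0 : 0 <= s by rewrite /s !le_max (nabs_ge0 na).
have [t vt /andP[st tr]] := vg_dense na K_closed abs_pi s0 sr.
move: st; rewrite /s !gt_max => /andP[/andP[zt wt]]; rewrite ltr_pdivrMr // => hlt2.
have sub : cball a t `<=` oball a r by exact: cball_subset_oball.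
have := schwarz_cball vt (rational_on_sub sub hphi) (fun y Dy => hM y (sub y Dy)) (ltW zt) (ltW wt).
by rewrite leNgt [_ * t]mulrC hlt2.
Qed.

Lemma rational_on_bounded (phi : K -> K) a r : 0 < r -> rational_on (cball a r) phi ->
  exists M, forall z, cball a r z -> abs (phi z) <= M.
Proof.
move=> r0 [A [B h]]; exists (gn A a r / gn B a r) => z Dz.
have [Bz ->] := h z Dz; rewrite (nabs_div na).
rewrite (@gn_den B a r z) // => [|w /h [] //].
by rewrite ler_wpM2r ?invr_ge0 ?gn_ge0 //; apply: gn_ub.
Qed.

Lemma rational_on_lipschitz (phi : K -> K) a r : vg r -> rational_on (cball a r) phi ->
  exists2 M, 0 <= M & forall z w, cball a r z -> cball a r w -> abs (phi z - phi w) <= M * abs (z - w).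
Proof.
move=> vr hphi; have r0 := vg_gt0 na vr.
have [M hM] := rational_on_bounded r0 hphi.
have aD : cball a r a by rewrite /cball /= subrr (nabs0 na) // ltW.
have M0 : 0 <= M by apply: le_trans (hM a aD); apply: (nabs_ge0 na).
exists (M / r); first by rewrite divr_ge0 // ltW.
move=> z w Dz Dw; have := schwarz_cball vr hphi hM Dz Dw.
by rewrite mulrAC ler_pdivlMr // [M * _]mulrC.
Qed.

End Schwarz.

Lemma cvg0P (R : realType) (u : nat -> R) : (forall k, 0 <= u k) ->
  u @ \oo --> (0 : R) <-> forall e, 0 < e -> exists N, forall k, (N <= k)%N -> u k < e.
Proof.
move=> u0; split=> [/cvgrPdist_lt h e e0|h].
  have [N _ hN] := h e e0; exists N => k Nk.
  by have := hN k Nk; rewrite /= sub0r normrN ger0_norm.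
apply/cvgrPdist_lt => e e0; have [N hN] := h e e0; exists N => // k /hN /=.
by rewrite sub0r normrN ger0_norm.
Qed.

(** * Iterates close to the identity *)

Section NearIdentity.
Context (R : realType) (K : fieldType) (abs : K -> R) (p : nat).
Hypothesis (na : is_nonarch_abs abs) (K_closed : alg_closed K).
Hypothesis abs_p : 0 < abs p%:R < 1.

Local Notation vg := (value_group abs).
Local Notation cball := (cball abs).

(** The error e of an iterate close to the identity becomes max(|p|, e) e after
    taking p-th iterates: the p first order terms add up to p times one of them. *)
Lemma near_identity_iterates (F : K -> K) a r e : vg r -> 0 <= e < 1 ->
  rational_on (cball a r) F -> (forall z, cball a r z -> abs (F z - z) <= e * r) ->
  forall k z, cball a r z ->
    abs (iter (p ^ k) F z - z) <= e * Num.max (abs p%:R) e ^+ k * r.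
Proof.
move=> vr /andP[e0 e1] hF hFe; have r0 := vg_gt0 na vr.
set m := Num.max _ _; have m0 : 0 <= m by rewrite le_max e0 orbT.
have m1 : m <= 1 by rewrite ge_max (ltW e1) andbT; case/andP: abs_p => _ /ltW.
have pm : abs p%:R <= m by rewrite le_max lexx.
have em : e <= m by rewrite le_max lexx orbT.
have FD z : cball a r z -> cball a r (F z).
  move=> Dz; apply: (nabs_dist_le na _ Dz); apply: le_trans (hFe z Dz) _.
  by rewrite ler_piMl ?ltW.
elim=> [|k IH] z Dz; first by rewrite expr0 mulr1; apply: hFe.
rewrite expnS iterM; set G := iter (p ^ k) F in IH *.
have hG : rational_on (cball a r) G by apply: rational_on_iter.
have GD y : cball a r y -> cball a r (G y).
  by move=> Dy; rewrite /G; elim: (p ^ k)%N => //= n; apply: FD.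
set d := e * m ^+ k * r in IH.
have d0 : 0 <= d by rewrite !mulr_ge0 ?exprn_ge0 // ltW.
have GiD i : cball a r (iter i G z) by elim: i => //= i; apply: GD.
have Gi i : abs (iter i G z - z) <= d.
  elim: i => [|i IHi]; first by rewrite subrr (nabs0 na).
  by apply: (nabs_dist_le na _ IHi); apply: IH; apply: GiD.
(* The displacement G - id is bounded by d on a disk of radius r, so by the Schwarz lemma it changes
   by at most d d / r between points at distance at most d. *)
have psi i : abs ((G (iter i G z) - iter i G z) - (G z - z)) <= d * e * m ^+ k.
  have := schwarz_cball na K_closed vr (rational_onB hG (rational_on_id _)) IH (GiD i) Dz.
  move=> h; rewrite -(ler_pM2r r0); apply: (le_trans h).
  have -> : d * e * m ^+ k * r = d * d by rewrite {3}/d !mulrA.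
  by rewrite ler_wpM2r.
have tel n : iter n G z - z = (G z - z) *+ n +
    \sum_(i < n) ((G (iter i G z) - iter i G z) - (G z - z)).
  elim: n => [|n IHn]; first by rewrite big_ord0 subrr mulr0n addr0.
  rewrite big_ord_recr /= mulrS.
  have -> : G (iter n G z) - z = (G (iter n G z) - iter n G z) + (iter n G z - z) by ring.
  by rewrite IHn; ring.
rewrite tel; apply: (nabsD_le na) => //.
  rewrite -mulr_natl (nabsM na).
  have -> : e * m ^+ k.+1 * r = m * d by rewrite /d exprS; ring.
  by rewrite ler_pM ?(nabs_ge0 na) //; apply: IH.
apply: (nabs_sum_le na) => // [|i _]; first by rewrite !mulr_ge0 ?exprn_ge0 // ltW.
apply: (le_trans (psi i)); have -> : e * m ^+ k.+1 * r = d * m by rewrite /d exprS; ring.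
rewrite -mulrA ler_wpM2l //; apply: le_trans em.
by rewrite ler_piMr // exprn_ile1.
Qed.

Lemma near_identity_cvg (F : K -> K) a r e : vg r -> 0 <= e < 1 ->
  rational_on (cball a r) F -> (forall z, cball a r z -> abs (F z - z) <= e * r) ->
  forall z, cball a r z -> (fun k => abs (iter (p ^ k) F z - z)) @ \oo --> (0 : R).
Proof.
move=> vr e01 hF hFe z Dz; have r0 := vg_gt0 na vr; have /andP[e0 e1] := e01.
apply/cvg0P => [k|t t0]; first exact: (nabs_ge0 na).
set m := Num.max (abs p%:R) e.
have m01 : 0 <= m < 1 by rewrite /m le_max e0 orbT gt_max e1 andbT; case/andP: abs_p.
have [N hN] := expr_small m01 (divr_gt0 t0 r0).
rewrite ltr_pdivlMr // in hN.
have /andP[m0 m1] := m01.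
exists N => k Nk; apply: le_lt_trans (near_identity_iterates vr e01 hF hFe k Dz) _.
apply: le_lt_trans hN; rewrite ler_pM2r // -/m; apply: (@le_trans _ _ (m ^+ k)).
  by rewrite ler_piMl ?exprn_ge0 // ltW.
by apply: ler_wiXn2l => //; exact: ltW.
Qed.

End NearIdentity.

(** * Attracting or recurrent behaviour on a periodic disk *)

Section PeriodicDisk.
Context (R : realType) (K : fieldType) (abs : K -> R) (p : nat).
Hypothesis (na : is_nonarch_abs abs) (K_closed : alg_closed K).
Hypothesis (p_prime : prime p) (abs_p : 0 < abs p%:R < 1).
Hypothesis res_alg : residue_algebraic abs p.

Local Notation vg := (value_group abs).
Local Notation cball := (cball abs).
Local Notation oball := (oball abs).

(** The rate theta is allowed to depend on z because it can tend to 1 towards the boundary of the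
    open disk; it is uniform over the points y that are no farther from z0 than z. *)
Definition attracting_disk (P Q : {poly K}) (X : set K) : Prop :=
  exists (z0 : K) (r : R) (n : nat),
  [/\ vg r, [/\ (0 < n)%N, iter n (frac_map P Q) z0 = z0
        & forall i, (0 < i < n)%N -> iter i (frac_map P Q) z0 <> z0],
      exists2 x, X x & oball z0 r x,
      forall z k, oball z0 r z -> Q.[iter k (frac_map P Q) z] != 0
    & forall z, oball z0 r z -> exists2 theta, 0 <= theta < 1 &
        forall y, abs (y - z0) <= abs (z - z0) ->
          forall k, abs (iter (n * k) (frac_map P Q) y - z0) <= theta ^+ k * abs (y - z0)].

Definition recurrent_disk (P Q : {poly K}) (X : set K) : Prop :=
  exists (x : K) (r : R) (n : nat),
  [/\ 0 < r, (0 < n)%N, X x,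
      forall z k, cball x r z -> Q.[iter k (frac_map P Q) z] != 0
    & forall z, cball x r z ->
        (fun k => abs (iter (p ^ k * n) (frac_map P Q) z - z)) @ \oo --> (0 : R)].

(** Let f be the return map. Without a fixed point, |f(z) - z| is constant on the disk and less than
    r, so f is close to the identity on a closed disk of slightly smaller radius. A fixed point has
    a multiplier [lam] of norm at most 1. If the norm is less than 1 the point attracts the disk; if
    it is 1, a power of [lam] reduces to 1 and the corresponding iterate of f is close to the
    identity on smaller closed disks. *)
Lemma periodic_disk_alternative (P Q : {poly K}) (X : set K) :
  periodic_disk abs P Q X -> attracting_disk P Q X \/ recurrent_disk P Q X.
Proof.
move=> [a [r [n [vr n0 [x Xx xa] hQ [hn hi]]]]].
have r0 := vg_gt0 na vr; set g := frac_map P Q in hQ hn hi *; set f := iter n g.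
have hf : rational_on (oball a r) f by apply: frac_map_iter_rational.
have [[z0 z0a fz0]|nofix] := pselect (exists2 z0, abs (z0 - a) < r & f z0 = z0); last first.
  right; set c := abs (f x - x).
  have cr : c < r by apply: (nabs_dist_lt na (hn x xa)); rewrite (nabs_sub na).
  have hc z : oball a r z -> abs (f z - z) = c.
    move=> Dz; apply: (nabs_cst_oball na K_closed (phi := fun z => f z - z) (a := a) (r := r)) => //.
      by apply: rational_onB => //; apply: rational_on_id.
    by move=> y Dy; rewrite subr_eq0; apply/eqP => fy; apply: nofix; exists y.
  have [s vs /andP[cs sr]] := vg_dense na K_closed abs_p (nabs_ge0 na _ : 0 <= c) cr.
  have s0 := vg_gt0 na vs.
  have sub : cball x s `<=` oball a r.
    by move=> z Dz; apply: (nabs_dist_lt na _ xa); apply: le_lt_trans sr.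
  exists x, s, n; split=> // [z k /sub|z Dz]; first exact: hQ.
  under eq_fun do rewrite iterM.
  apply: (near_identity_cvg na K_closed abs_p (a := x) (r := s) (e := c / s)) => //.
  - by rewrite divr_ge0 ?(nabs_ge0 na) ?(ltW s0) //= ltr_pdivrMr // mul1r.
  - exact: rational_on_sub hf.
  - by move=> y /sub Dy; rewrite divfK ?lt0r_neq0 // hc.
have z0b z : oball a r z -> oball z0 r z by apply: oball_center.
have bz0 z : oball z0 r z -> oball a r z by apply: (oball_center na); apply: oballC.
have hf0 : rational_on (oball z0 r) f by apply: rational_on_sub hf.
have f_le z : oball z0 r z -> abs (f z - z0) <= abs (z - z0).
  move=> Dz; have Dz0 : oball z0 r z0 by rewrite /oball /= subrr (nabs0 na).
  have := schwarz_oball na K_closed abs_p (rational_onB hf0 (rational_on_cst _ z0)) _ Dz Dz0.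
  move=> /(_ r); rewrite fz0 subrr subr0 ler_pM2r //; apply => y Dy; apply: ltW.
  by apply: z0b; apply: hn; apply: bz0.
have [A [B hAB]] := hf0.
have Dz0 : oball z0 r z0 by rewrite /oball /= subrr (nabs0 na).
have [Bz0 fAB] := hAB z0 Dz0.
have [E defE] : exists E, A - z0%:P * B = E * ('X - z0%:P).
  apply/factor_theorem; rewrite rootE !hornerE subr_eq0 -{2}fz0 fAB divfK //.
(* The quotient (f(z) - z0) / (z - z0), extended over z0, where its value is the multiplier. *)
pose h z := E.[z] / B.[z].
have hh : rational_on (oball z0 r) h by exists E, B => z /hAB [].
have fh z : oball z0 r z -> f z - z0 = h z * (z - z0).
  move=> Dz; have [Bz ->] := hAB z Dz.
  have : (A - z0%:P * B).[z] = E.[z] * (z - z0) by rewrite defE !hornerE.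
  rewrite !hornerE => e; rewrite /h mulrAC -e; field.
  exact: Bz.
have h1 z : oball z0 r z -> abs (h z) <= 1.
  have h1' y : oball z0 r y -> y != z0 -> abs (h y) <= 1.
    move=> Dy yz0; have := f_le y Dy.
    by rewrite fh // (nabsM na) -[X in _ <= X]mul1r ler_pM2r // (nabs_gt0 na) subr_eq0.
  move=> Dz; have [->|/h1'] := eqVneq z z0; last exact.
  (* At z0 itself the quotient is not controlled by [f_le]. But |E(z0)| is at most a Gauss norm,
     which is attained at some y different from z0, and |B| is constant on the disk. *)
  have [s vs /andP[s0 sr]] := vg_dense na K_closed abs_p (lexx 0) r0.
  have [y [yz0 ys hy]] := gn_gen na K_closed [:: E] [:: z0] z0 vs.
  have Dy : oball z0 r y by apply: cball_subset_oball yz0.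
  have yz : y != z0.
    by rewrite -subr_eq0 -(nabs_gt0 na); apply: lt_le_trans (ys z0 _) => //; rewrite mem_head.
  apply: le_trans (h1' y Dy yz); rewrite !(nabs_div na).
  have -> : abs B.[y] = abs B.[z0].
    have hB : rational_on (oball z0 r) (fun z => B.[z]).
      by exists B, 1 => u _; rewrite !hornerE oner_neq0 divr1.
    by apply: (nabs_cst_oball na K_closed hB) => // u /hAB [].
  rewrite ler_wpM2r ?invr_ge0 ?(nabs_ge0 na) // hy ?inE ?eqxx //; apply: gn_ub => //.
  by rewrite subrr (nabs0 na) // ltW.
have h_lip z w : oball z0 r z -> oball z0 r w -> abs (h z - h w) <= abs (z - w) / r.
  move=> Dz Dw; rewrite ler_pdivlMr // -[leRHS]mulr1.
  exact: (schwarz_oball na K_closed abs_p hh h1).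
have h0z z : oball z0 r z -> abs (h z - h z0) <= abs (z - z0) / r by move=> Dz; apply: h_lip.
set lam := h z0 in h0z.
have it_ball z i : oball z0 r z -> oball z0 r (iter i f z) /\ abs (iter i f z - z0) <= abs (z - z0).
  move=> Dz; elim: i => [|i [D1 D2]] //=; split; last exact: le_trans (f_le _ D1) D2.
  by apply: le_lt_trans (f_le _ D1) _.
have [lam1|lam1] := ltP (abs lam) 1.
  left; exists z0, r, n; split=> //.
  - split=> // i hi'; move=> e; apply: (hi i z0 hi' z0a); rewrite e; exact: z0a.
  - by exists x => //; apply: z0b.
  - by move=> z k /bz0 Dz; apply: hQ.
  move=> z Dz; set th := Num.max (abs lam) (abs (z - z0) / r).
  have th0 : 0 <= th by rewrite le_max (nabs_ge0 na).
  exists th; first by rewrite th0 gt_max lam1 ltr_pdivrMr // mul1r.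
  move=> y yz k; have Dy : oball z0 r y by apply: le_lt_trans Dz.
  rewrite mulnC iterM -/f; elim: k => [|k IH]; first by rewrite mul1r.
  have [D1 D2] := it_ball y k Dy.
  rewrite iterS fh // (nabsM na) exprS -mulrA; apply: ler_pM; rewrite ?(nabs_ge0 na) //.
  have -> : h (iter k f y) = lam + (h (iter k f y) - lam) by ring.
  apply: (nabsD_le na) => //; first by rewrite /th le_max lexx.
  apply: (le_trans (h0z _ D1)); rewrite /th le_max; apply/orP; right.
  by rewrite ler_pM2r ?invr_gt0 //; apply: le_trans yz.
have {}lam1 : abs lam = 1 by apply/le_anti; rewrite lam1 h1.
(* The class of [lam] is a nonzero element of a finite field: cancel the unit [lam] in the
   congruence between lam^(p^s) and lam. *)
right; have [m m0 hm] : exists2 m, (0 < m)%N & abs (lam ^+ m - 1) < 1.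
  have lam_le1 : abs lam <= 1 by rewrite lam1.
  have [s s0 hs] := res_alg lam_le1.
  have ps1 : (1 < p ^ s)%N by rewrite -[1%N](exp1n s) ltn_exp2r // prime_gt1.
  exists (p ^ s).-1; first by rewrite -subn1 subn_gt0.
  have : abs (lam * (lam ^+ (p ^ s).-1 - 1)) < 1.
    by rewrite mulrBr mulr1 -exprS prednK // ltnW.
  by rewrite (nabsM na) lam1 mul1r.
have [s vs /andP[xs sr]] := vg_dense na K_closed abs_p (nabs_ge0 na _) (z0b x xa).
have s0 := vg_gt0 na vs.
have sub : cball z0 s `<=` oball z0 r by apply: cball_subset_oball.
(* On the closed disk of radius s < r the i-th iterate differs from the linear map of slope lam^i
   only by a relative error of at most s / r, uniformly in i. *)
have coef i z : cball z0 s z -> exists2 c, iter i f z - z0 = c * (z - z0) &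
    abs (c - lam ^+ i) <= s / r.
  move=> Dz; elim: i => [|i [c hc1 hc2]].
    by exists 1; rewrite ?mul1r // subrr (nabs0 na) // divr_ge0 ?ltW.
  have [D1 D2] := it_ball z i (sub z Dz).
  exists (h (iter i f z) * c); first by rewrite iterS fh // hc1 mulrA.
  have sr1 : s / r < 1 by rewrite ltr_pdivrMr // mul1r.
  have c1 : abs c <= 1.
    have -> : c = lam ^+ i + (c - lam ^+ i) by ring.
    apply: (nabsD_le na) => //; first by rewrite (nabsX na) lam1 expr1n.
    by apply: le_trans hc2 _; exact: ltW.
  have -> : h (iter i f z) * c - lam ^+ i.+1 =
      (h (iter i f z) - lam) * c + lam * (c - lam ^+ i) by rewrite exprS; ring.
  apply: (nabsD_le na) => //; last by rewrite (nabsM na) lam1 mul1r.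
  rewrite (nabsM na); apply: (@le_trans _ _ (abs (h (iter i f z) - lam))).
    by rewrite ler_piMr ?(nabs_ge0 na).
  apply: le_trans (h0z _ D1) _; rewrite ler_pM2r ?invr_gt0 //.
  by apply: le_trans D2 _.
set e := Num.max (s / r) (abs (lam ^+ m - 1)).
exists x, s, (m * n)%N; split=> //.
- by rewrite muln_gt0 m0.
- move=> z k Dz; apply: hQ; apply: bz0; apply: sub; apply: (nabs_dist_le na Dz).
  exact: ltW.
have eF : iter (m * n) (frac_map P Q) = iter m f by apply/funext => y; rewrite iterM.
move=> z Dz; under eq_fun do rewrite iterM eF.
apply: (near_identity_cvg na K_closed abs_p (a := z0) (r := s) (e := e)) => //.
- by rewrite /e le_max (nabs_ge0 na) // orbT gt_max hm andbT ltr_pdivrMr // mul1r.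
- apply: (rational_on_iter _ (rational_on_sub sub hf0)) => y Dy.
  by apply: le_trans (f_le _ (sub _ Dy)) _.
- move=> y Dy; have [c hc1 hc2] := coef m y Dy.
  have -> : iter m f y - y = (c - 1) * (y - z0).
    by rewrite mulrBl mul1r -hc1; ring.
  rewrite (nabsM na); apply: ler_pM; rewrite ?(nabs_ge0 na) //.
  have -> : c - 1 = (c - lam ^+ m) + (lam ^+ m - 1) by ring.
  by apply: (nabsD_le na) => //; rewrite /e le_max ?hc2 // lexx orbT.
- by apply: (nabs_dist_le na Dz); exact: ltW.
Qed.

End PeriodicDisk.

(** * The field C_p *)

Section PolyBounds.
Context (R : realType) (K : fieldType) (abs : K -> R).
Hypothesis na : is_nonarch_abs abs.

Lemma nabs_horner_le (S : {poly K}) z n eta B : (size S <= n.+1)%N ->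
  1 <= B -> abs z <= B -> 0 <= eta -> (forall i, abs S`_i <= eta) -> abs S.[z] <= eta * B ^+ n.
Proof.
move=> sS B1 zB e0 hS; have B0 : 0 <= B by lra.
rewrite (horner_coef_wide _ sS); apply: (nabs_sum_le na) => // [|i _].
  by rewrite mulr_ge0 ?exprn_ge0.
rewrite (nabsM na) (nabsX na) ler_pM ?exprn_ge0 ?(nabs_ge0 na) //.
apply: (@le_trans _ _ (B ^+ i)); first by rewrite lerXn2r ?nnegrE ?(nabs_ge0 na).
by rewrite ler_weXn2l // -ltnS.
Qed.

Lemma poly_bounded (S : {poly K}) a r : exists2 M, 0 <= M & forall z, abs (z - a) <= r -> abs S.[z] <= M.
Proof.
elim/poly_ind: S => [|S c [M M0 IH]]; first by exists 0 => // z _; rewrite horner0 (nabs0 na).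
exists (Num.max (M * Num.max r (abs a)) (abs c)); first by rewrite le_max (nabs_ge0 na) // orbT.
move=> z hz; rewrite !hornerE; apply: (nabsD_le na) => //; last by rewrite le_max lexx orbT.
rewrite le_max (nabsM na); apply/orP; left; rewrite ler_pM ?(nabs_ge0 na) ?IH //.
by rewrite -(subrK a z); apply: (nabsD_le na) => //; rewrite le_max ?hz ?lexx ?orbT.
Qed.

Lemma poly_lipschitz (S : {poly K}) a r :
  exists2 M, 0 <= M & forall z, abs (z - a) <= r -> abs (S.[z] - S.[a]) <= M * abs (z - a).
Proof.
have [E defE] : exists E, S - S.[a]%:P = E * ('X - a%:P).
  by apply/factor_theorem; rewrite rootE !hornerE subrr.
have [M M0 hM] := poly_bounded E a r; exists M => // z hz.
have -> : S.[z] - S.[a] = (S - S.[a]%:P).[z] by rewrite !hornerE.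
by rewrite defE hornerM hornerXsubC (nabsM na) ler_wpM2r ?(nabs_ge0 na) // hM.
Qed.

End PolyBounds.

Section CompletionClosed.
Context (R : realType) (L : closedFieldType) (K : fieldType) (absL : L -> R) (abs : K -> R).
Context (i : {rmorphism L -> K}).
Hypothesis (hc : is_completion absL abs i).

Let na : is_nonarch_abs abs := completion_abs hc.

(** One step of the approximation of a root: replace P by a nearby polynomial that
    splits over L. *)
Lemma approx_root (P : {poly K}) y e : P \is monic -> (1 < size P)%N -> 0 < e <= 1 ->
  exists2 x, abs P.[x] <= e & abs (x - y) ^+ (size P).-1 <= Num.max (abs P.[y]) e.
Proof.
move=> mP sP /andP[e0 e1]; set n := (size P).-1.
have szP : size P = n.+1 by rewrite prednK // ltnW.
have n0 : (0 < n)%N by rewrite -ltnS -szP.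
(* [B] also bounds the root still to be found: |x - y|^n is at most max(|P(y)|, e), hence at most
   B^n since B >= 1 >= e. With the choice of [eta], P and its approximation differ by at most e for
   |z| <= B. *)
pose B := Num.max (Num.max 1 (abs y)) (abs P.[y]).
have B1 : 1 <= B by rewrite /B !le_max lexx.
have yB : abs y <= B by rewrite /B !le_max lexx orbT.
have PB : abs P.[y] <= B by rewrite /B !le_max lexx !orbT.
have B0 : 0 < B by lra.
pose eta := e / B ^+ n; have eta0 : 0 < eta by rewrite divr_gt0 ?exprn_gt0.
have appr k : exists x, abs (P`_k - i x) < eta := completion_dense hc P`_k eta0.
pose c k := projT1 (cid (appr k)).
have hcf k : abs (P`_k - i (c k)) < eta by rewrite /c; case: cid.
pose S : {poly L} := \poly_(k < n.+1) (if k == n then 1 else c k).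
have Sn : S`_n = 1 by rewrite coef_poly ltnSn eqxx.
have szS : size S = n.+1.
  by apply: size_poly_eq; rewrite eqxx oner_neq0.
have mS : S \is monic by rewrite monicE /lead_coef szS Sn.
have [s defS] := closed_field_poly_normal S.
rewrite (monicP mS) scale1r in defS.
have szs : size s = n by apply: succn_inj; rewrite -szS defS size_prod_XsubC.
pose T := map_poly i S.
have TE z : T.[z] = \prod_(x <- s) (z - i x).
  rewrite /T defS rmorph_prod horner_prod; apply: eq_bigr => x _.
  by rewrite rmorphB /= map_polyX map_polyC hornerXsubC.
have PT z : abs z <= B -> abs (P.[z] - T.[z]) <= e.
  move=> zB; have -> : P.[z] - T.[z] = (P - T).[z] by rewrite !hornerE.
  have -> : e = eta * B ^+ n by rewrite divfK // lt0r_neq0 ?exprn_gt0.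
  apply: nabs_horner_le => // [||k]; last 1 first.
  - rewrite coefB; case: (ltngtP k n) => hk.
    + by rewrite /T coef_map coef_poly ltnS (ltnW hk) (ltn_eqF hk); apply: ltW.
    + have -> : T`_k = 0.
        by rewrite nth_default //; apply: leq_trans (size_poly _ _) _; rewrite szS.
      by rewrite subr0 nth_default ?(nabs0 na) ?ltW // szP.
    + have -> : T`_k = 1 by rewrite hk /T coef_map Sn; apply: rmorph1.
      by rewrite hk -[P`_n]/(lead_coef P) (monicP mP) subrr (nabs0 na) // ltW.
  - apply: leq_trans (size_polyD _ _) _; rewrite size_polyN geq_max szP leqnn /=.
    by apply: leq_trans (size_poly _ _) _; rewrite szS.
  - exact: ltW.
have Ty : abs T.[y] <= Num.max (abs P.[y]) e.
  have -> : T.[y] = P.[y] - (P.[y] - T.[y]) by ring.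
  by apply: (nabsB_le na) => //; rewrite le_max ?lexx // (PT y yB) orbT.
(* The n distances from y to the roots multiply to |T(y)|, so one of them has n-th power at most
   |T(y)|. *)
have [x xs hx] : exists2 x, x \in s & abs (y - i x) ^+ n <= abs T.[y].
  apply: contrapT => H; have {}H x : x \in s -> abs T.[y] < abs (y - i x) ^+ n.
    by move=> xs; rewrite ltNge; apply/negP => h; apply: H; exists x.
  have Ty0 : 0 <= abs T.[y] by apply: (nabs_ge0 na).
  have prodlt (t : seq L) : {subset t <= s} -> t != [::] ->
      abs T.[y] ^+ size t < \prod_(x <- t) (abs (y - i x) ^+ n).
    elim: t => // x [|x' t] IH sub _; first by rewrite big_seq1 expr1 H // sub ?mem_head.
    rewrite big_cons exprS ltr_pM ?exprn_ge0 //; first by rewrite H // sub ?mem_head.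
    by apply: IH => // x2 h; apply: sub; rewrite inE h orbT.
  have s0 : s != [::] by rewrite -size_eq0 szs -lt0n.
  have := prodlt s (fun _ h => h) s0; rewrite prodrXl szs -(nabs_prod na) // -TE ltxx //.
rewrite (nabs_sub na) in hx.
have hx2 : abs (i x - y) ^+ n <= Num.max (abs P.[y]) e by apply: le_trans hx Ty.
have xyB : abs (i x - y) <= B.
  rewrite -(@ler_pXn2r _ n) ?nnegrE ?(nabs_ge0 na) ?(ltW B0) //; apply: le_trans hx2 _.
  rewrite ge_max; apply/andP; split.
    by apply: le_trans PB _; rewrite -{1}[B]expr1 ler_weXn2l.
  by apply: le_trans e1 _; rewrite exprn_ege1.
have xB : abs (i x) <= B by rewrite -(subrK y (i x)); apply: (nabsD_le na).
exists (i x) => //; have Tx : T.[i x] = 0.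
  by rewrite TE; apply/eqP; rewrite prodf_seq_eq0; apply/hasP; exists x; rewrite //= subrr.
by have := PT _ xB; rewrite Tx subr0.
Qed.

(** Choose each approximate root near the previous one, with errors 2^-k. Then the n-th powers of
    consecutive distances are at most 2^-k, so the sequence is Cauchy by the ultrametric inequality,
    and its limit is a root by continuity of P. *)
Lemma completion_alg_closed : alg_closed K.
Proof.
move=> P0 sP0.
have [P [mP sP rootP]] : exists P : {poly K},
    [/\ P \is monic, (1 < size P)%N & forall x, root P x -> root P0 x].
  have l0 : lead_coef P0 != 0 by rewrite lead_coef_eq0 -size_poly_gt0 ltnW.
  exists ((lead_coef P0)^-1 *: P0); split; rewrite ?size_scale ?invr_eq0 //.
    by rewrite monicE lead_coefZ mulVf.
  by move=> x; rewrite rootZ // invr_eq0.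
suff [x Px] : exists x, root P x by exists x; apply: rootP.
set n := (size P).-1; have n0 : (0 < n)%N by rewrite /n -subn1 subn_gt0.
pose ep k : R := 2^-1 ^+ k.
have ep01 k : 0 < ep k <= 1.
  by rewrite exprn_gt0 ?invr_gt0 ?ltr0n // exprn_ile1 ?invr_ge0 ?ler0n // invf_le1 ?ler1n ?ltr0n.
have next k y : exists x, abs P.[x] <= ep k /\ abs (x - y) ^+ n <= Num.max (abs P.[y]) (ep k).
  by have [x h1 h2] := approx_root y mP sP (ep01 k); exists x.
pose nx k y := projT1 (cid (next k y)).
have hnx k y : abs P.[nx k y] <= ep k /\ abs (nx k y - y) ^+ n <= Num.max (abs P.[y]) (ep k).
  by rewrite /nx; case: cid.
pose u := fix u k := if k is k'.+1 then nx k (u k') else nx 0%N 0.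
have Pu k : abs P.[u k] <= ep k by case: k => [|k]; apply: (hnx _ _).1.
have ep_le k l : (k <= l)%N -> ep l <= ep k.
  move=> kl; rewrite ler_wiXn2l ?invr_ge0 ?ler0n //.
  by rewrite invf_le1 ?ler1n ?ltr0n.
have du k : abs (u k.+1 - u k) ^+ n <= ep k.
  apply: le_trans (hnx k.+1 (u k)).2 _; rewrite ge_max Pu /=.
  by apply: ep_le.
have ep_small e : 0 < e -> exists k, ep k < e.
  by move=> e0; apply: expr_small => //; rewrite invr_ge0 ler0n invf_lt1 ?ltr1n ?ltr0n.
have cauchy e : 0 < e -> exists N, forall k, (N <= k)%N -> abs (u k - u N) < e.
  move=> e0; have [N hN] := ep_small (e ^+ n) (exprn_gt0 _ e0); exists N => k Nk.
  rewrite -(subnKC Nk); elim: (k - N)%N => [|m IH]; first by rewrite addn0 subrr (nabs0 na).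
  apply: (nabs_dist_lt na _ IH); rewrite addnS -(@ltr_pXn2r _ n) ?nnegrE ?(nabs_ge0 na) ?(ltW e0) //.
  by apply: le_lt_trans (du _) _; apply: le_lt_trans hN; apply: ep_le; rewrite leq_addr.
have [|l hl] := completion_complete hc (u := u).
  move=> e e0; have [N hN] := cauchy e e0; exists N => m k Nm Nk.
  by apply: (nabs_dist_lt na (hN m Nm)); rewrite (nabs_sub na) hN.
exists l; rewrite /root -(nabs_eq0 na) eq_le (nabs_ge0 na) // andbT leNgt; apply/negP => Pl0.
have [M M0 hM] := poly_lipschitz na P l 1.
have M1 : 0 < M + 1 by lra.
pose t := Num.min 1 (abs P.[l] / (M + 1)).
have t0 : 0 < t by rewrite lt_min ltr01 divr_gt0.
have [N hN] : exists N, forall k, (N <= k)%N -> abs (u k - l) < t.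
  move/cvgrPdist_lt/(_ _ t0): hl => [N _ hN]; exists N => k /hN /=.
  by rewrite sub0r normrN ger0_norm ?(nabs_ge0 na).
have [N' hN'] := ep_small _ Pl0.
pose k := maxn N N'.
have : abs P.[l] < abs P.[l].
  have {1}-> : P.[l] = P.[u k] - (P.[u k] - P.[l]) by ring.
  apply: (nabsB_lt na) => //.
    by apply: le_lt_trans (Pu k) _; apply: le_lt_trans hN'; apply: ep_le; rewrite leq_maxr.
  have := hN k (leq_maxl _ _); rewrite lt_min => /andP[k1 k2].
  apply: le_lt_trans (hM _ (ltW k1)) _; rewrite ltr_pdivlMr // in k2.
  by apply: le_lt_trans k2; rewrite mulrC ler_wpM2l ?(nabs_ge0 na) //; lra.
by rewrite ltxx.
Qed.

End CompletionClosed.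

(** * Powers of Frobenius modulo p *)

Section FpPowers.
Context (p : nat).
Hypothesis p_prime : prime p.

Lemma Fp_poly_divides_Frobenius (S : {poly 'F_p}) : S != 0 ->
  exists i j, (i < j)%N /\ S %| 'X^(p ^ j) - 'X^(p ^ i).
Proof.
move=> S0; pose d := size S.
pose F (k : 'I_(#|{: 'rV['F_p]_d}|.+1)) : 'rV['F_p]_d := poly_rV ('X^(p ^ k) %% S).
have /injectivePn[k [l kl e]] : ~~ injectiveb F.
  by apply/injectiveP => /leq_card; rewrite card_ord ltnn.
have {}e : 'X^(p ^ k) %% S = 'X^(p ^ l) %% S.
  rewrite -(@poly_rV_K _ d ('X^(p ^ k) %% S)) 1?ltnW ?ltn_modp //.
  by rewrite -/(F k) e poly_rV_K // ltnW // ltn_modp.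
have H k' l' : 'X^(p ^ k') %% S = 'X^(p ^ l') %% S -> S %| 'X^(p ^ l') - 'X^(p ^ k').
  by move=> e'; rewrite /dvdp modpD modpN e' subrr.
have [lt|gt|/val_inj eq] := ltngtP k l.
- by exists k, l; split=> //; apply: H.
- by exists l, k; split=> //; apply: H.
- by rewrite eq eqxx in kl.
Qed.

(** Modulo p, S divides X^(p^j) - X^(p^i): the powers X^(p^k) take finitely many
    values modulo S. *)
Lemma int_poly_Frobenius (S : {poly int}) k : ~~ (p %| S`_k)%Z ->
  exists i j (D T : {poly int}), (i < j)%N /\ 'X^(p ^ j) - 'X^(p ^ i) = D * S + p%:Z *: T.
Proof.
move=> hk; pose red : int -> 'F_p := intr.
have pch : p \in [pchar 'F_p] by apply: pchar_Fp.
have redE c : (red c == 0) = (p %| c)%Z by rewrite /red -(dvdz_pcharf pch).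
have S0 : map_poly (intr : int -> 'F_p) S != 0.
  by apply/eqP => /polyP/(_ k)/eqP; rewrite coef_map coef0 [_ == _]redE (negPf hk).
have [i [j [ij /dvdpP[D' hD]]]] := Fp_poly_divides_Frobenius S0.
pose D : {poly int} := map_poly (fun x : 'F_p => (x : nat)%:Z) D'.
have DD : map_poly (intr : int -> 'F_p) D = D'.
  apply/polyP => m; rewrite coef_map coef_map_id0 //.
  exact: natr_Zp.
pose U := 'X^(p ^ j) - 'X^(p ^ i) - D * S.
pose T : {poly int} := map_poly (fun c => (c %/ p)%Z) U.
exists i, j, D, T; split=> //.
suff -> : p%:Z *: T = U by rewrite /U [RHS]addrC subrK.
apply/polyP => m; rewrite coefZ coef_map_id0 ?div0z // mulrC divzK //.
rewrite -redE /red -[intr _](coef_map (intr : {rmorphism int -> 'F_p})).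
by rewrite /U !rmorphB rmorphM /= !map_polyXn DD hD subrr coef0.
Qed.

End FpPowers.

Section CpFacts.
Context (R : realType) (p : nat) (C : fieldType) (abs : C -> R).
Hypothesis (p_prime : prime p) (C_Cp : is_Cp p abs).

Lemma Cp_nonarch : is_nonarch_abs abs.
Proof. by have [? [? [? [? [? [? [? [_ _ []]]]]]]]] := C_Cp. Qed.

Lemma Cp_alg_closed : alg_closed C.
Proof.
have [? [? [? [? [? [? [? [_ _ h]]]]]]]] := C_Cp; exact: completion_alg_closed h.
Qed.

Lemma Cp_abs_p : 0 < abs p%:R < 1.
Proof.
have [Qp [absQp [iQ [Qpbar [absQpbar [iQp [iQpbar [h1 h2 h3]]]]]]]] := C_Cp.
have -> : abs p%:R = padic_abs R p p%:R.
  rewrite -(completion_isometry h1) -(algebraic_closure_isometry h2) -(completion_isometry h3).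
  by rewrite !rmorph_nat.
have p0 : (p%:R : rat) != 0 by rewrite pnatr_eq0 -lt0n prime_gt0.
have nE : numq (p%:R : rat) = p :> int by exact: (numq_int p).
have dE : denq (p%:R : rat) = 1 by exact: (denq_int p).
rewrite /padic_abs (negPf p0) nE dE absz1 absz_nat logn1 sub0r.
rewrite -[X in logn p X]expn1 pfactorK //.
have p1 : (1 : R) < p%:R by rewrite ltr1n prime_gt1.
rewrite exprN1 invr_gt0 (lt_trans ltr01) //=.
by rewrite invf_lt1 ?(lt_trans ltr01).
Qed.

Let na := Cp_nonarch.

Lemma Cp_abs_unit (m : int) : ~~ (p %| m)%Z -> abs m%:~R = 1.
Proof.
move=> pm; have /andP[_ p1] := Cp_abs_p.
have : coprimez p m by rewrite coprimezE prime_coprime.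
move/coprimezP => [[u v] /= e].
apply/le_anti; rewrite (nabs_int_le1 na) //= leNgt; apply/negP => m1.
have : abs (1 : C) < 1.
  rewrite -[1](rmorph1 (intr : {rmorphism int -> C})) -e rmorphD !rmorphM /=.
  apply: (nabsD_lt na) => //; rewrite (nabsM na).
    by apply: le_lt_trans p1; rewrite ler_piMl ?(nabs_ge0 na) // (nabs_int_le1 na).
  by apply: le_lt_trans m1; rewrite ler_piMl ?(nabs_ge0 na) // (nabs_int_le1 na).
by rewrite (nabs1 na) // ltxx.
Qed.

(** Approximate x by an element z algebraic over Q_p. Up to errors of norm below 1, z satisfies an
    equation with integer coefficients that is nonzero modulo p, and so z^(p^b) and z^(p^a) are
    congruent for some a < b. Frobenius is injective on residues, which removes the p^a. *)
Lemma Cp_residue_algebraic : residue_algebraic abs p.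
Proof.
have [Qp [absQp [iQ [Qpbar [absQpbar [iQp [iQpbar [h1 h2 h3]]]]]]]] := C_Cp.
have /andP[_ p1] := Cp_abs_p.
move=> x x1.
have [y hy] := completion_dense h3 x ltr01.
set z := iQpbar y in hy.
have z1 : abs z <= 1.
  have -> : z = x - (x - z) by ring.
  by apply: (nabsB_le na) => //; exact: ltW.
pose j : {rmorphism Qp -> C} := (iQpbar \o iQp)%FUN.
have jabs c : abs (j c) = absQp c.
  by rewrite /= (completion_isometry h3) (algebraic_closure_isometry h2).
have [P0 P0n0 rootP0] := algebraic_closure_algebraic h2 y.
have rootz : root (map_poly j P0) z.
  by rewrite map_poly_comp /= [root _ _]fmorph_root.
have naQ := completion_abs h1.
pose n := size P0; have n0 : (0 < n)%N by rewrite size_poly_gt0.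
(* Dividing by a coefficient of largest norm makes the equation integral with one coefficient equal
   to 1, hence nonzero modulo p. *)
have [k _ hk] : exists2 k : 'I_n, true & forall l : 'I_n, absQp P0`_l <= absQp P0`_k.
  case: (@arg_maxP _ _ _ (Ordinal n0) predT (fun l : 'I_n => absQp P0`_l)) => // k _ hk.
  by exists k => // l; apply: hk.
set c := P0`_k in hk.
have c0 : c != 0.
  apply/eqP => c0; have : absQp (lead_coef P0) <= 0.
    have ltn : (n.-1 < n)%N by rewrite prednK.
    by have := hk (Ordinal ltn); rewrite c0 (nabs0 naQ).
  by rewrite leNgt (nabs_gt0 naQ) lead_coef_eq0 P0n0.
(* Every class of Z_p contains an integer: a rational number of norm at most 1 has a denominator
   prime to p, which Bezout inverts modulo p. *)
have hint (a : Qp) : absQp a <= 1 -> exists m : int, abs (j a - m%:~R) < 1.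
  move=> a1; have [q hq] := completion_dense h1 a ltr01.
  pose qC : C := j (iQ q).
  have hqC : abs (j a - qC) < 1 by rewrite /qC -rmorphB jabs.
  have qC1 : abs qC <= 1.
    have -> : qC = j a - (j a - qC) by ring.
    by apply: (nabsB_le na) => //; [rewrite jabs | exact: ltW].
  have qE : qC * (denq q)%:~R = (numq q)%:~R.
    have e : q * (denq q)%:~R = (numq q)%:~R.
      by rewrite -{1}(divq_num_den q) divfK // intr_eq0 denq_eq0.
    have := congr1 (fun t => j (iQ t)) e.
    by rewrite rmorphM rmorphM /= !rmorph_int.
  have pv : ~~ (p %| denq q)%Z.
    apply/negP => pv; have pu : ~~ (p %| numq q)%Z.
      apply/negP => pu; have := coprime_num_den q; rewrite /coprime => /eqP e.
      have : (p %| gcdn `|numq q| `|denq q|)%N by rewrite dvdn_gcd; apply/andP; split.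
      by rewrite e dvdn1 gtn_eqF // prime_gt1.
    have := Cp_abs_unit pu; rewrite -qE (nabsM na) => e.
    have : abs (qC * (denq q)%:~R) < 1.
      move/dvdzP: pv => [d ->]; rewrite rmorphM /= !(nabsM na) mulrA.
      apply: le_lt_trans p1; rewrite ler_piMl ?(nabs_ge0 na) //.
      by rewrite mulr_ile1 ?(nabs_ge0 na) // (nabs_int_le1 na).
    by rewrite (nabsM na) e ltxx.
  have : coprimez p (denq q) by rewrite coprimezE prime_coprime.
  move/coprimezP => [[u w] /= e].
  exists (numq q * w); rewrite -(subrKA qC); apply: (nabsD_lt na) => //.
  have -> : qC - (numq q * w)%:~R = qC * (u * p)%:~R.
    rewrite rmorphM /= -qE -mulrA -{1}[qC]mulr1 -mulrBr; congr (_ * _).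
    rewrite -[1](rmorph1 (intr : {rmorphism int -> C})) -rmorphM -rmorphB /=; congr intr.
    by rewrite -e mulrC [w * _]mulrC addrK mulrC.
  rewrite rmorphM /= !(nabsM na) mulrA; apply: le_lt_trans p1; rewrite ler_piMl ?(nabs_ge0 na) //.
  by rewrite mulr_ile1 ?(nabs_ge0 na) // (nabs_int_le1 na).
have P0c l : absQp (P0`_l / c) <= 1.
  rewrite (nabs_div naQ) ler_pdivrMr ?(nabs_gt0 naQ) // mul1r.
  have [ln|nl] := ltnP l n; first exact: (hk (Ordinal ln)).
  by rewrite nth_default // (nabs0 naQ) (nabs_ge0 naQ).
pose m l := projT1 (cid (hint _ (P0c l))).
have hm l : abs (j (P0`_l / c) - (m l)%:~R) < 1 by rewrite /m; case: cid.
pose S : {poly int} := \poly_(l < n) m l.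
pose SC := map_poly (intr : int -> C) S.
have Sz : abs SC.[z] < 1.
  have -> : SC.[z] = \sum_(l < n) ((m l)%:~R - j (P0`_l / c)) * z ^+ l.
    under eq_bigr do rewrite mulrBl; rewrite sumrB.
    have -> : \sum_(l < n) j (P0`_l / c) * z ^+ l = 0.
      have : (map_poly j P0).[z] / j c = 0 by rewrite (rootP rootz) mul0r.
      rewrite (@horner_coef_wide _ n) ?size_map_poly // mulr_suml => h; rewrite -[RHS]h.
      by apply: eq_bigr => l _; rewrite coef_map fmorph_div mulrAC.
    rewrite subr0 (@horner_coef_wide _ n); last first.
      by apply: leq_trans (size_poly _ _) _; apply: size_poly.
    by apply: eq_bigr => l _; rewrite coef_map coef_poly ltn_ord.
  elim/big_ind: _ => [|a b|l _]; [by rewrite (nabs0 na) // ltr01|exact: (nabsD_lt na)|].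
  rewrite (nabsM na) (nabs_sub na); apply: le_lt_trans (hm l); rewrite ler_piMr ?(nabs_ge0 na) //.
  by rewrite (nabsX na) exprn_ile1 ?(nabs_ge0 na).
have Sk : ~~ (p %| S`_k)%Z.
  rewrite coef_poly ltn_ord; apply/negP => /dvdzP[d e].
  have := hm k; rewrite -/c divff // rmorph1 e rmorphM /=.
  have h : abs (d%:~R * p%:R : C) < 1.
    by rewrite (nabsM na); apply: le_lt_trans p1; rewrite ler_piMl ?(nabs_ge0 na) // (nabs_int_le1 na).
  by rewrite (nabsBl na) ?(nabs1 na) // ltxx.
have [a [b [D [T [ab hDT]]]]] := int_poly_Frobenius p_prime Sk.
have int1 (V : {poly int}) : abs (map_poly (intr : int -> C) V).[z] <= 1.
  rewrite horner_coef; apply: (nabs_sum_le na) => // l _.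
  rewrite (nabsM na) coef_map; apply: mulr_ile1; rewrite ?(nabs_ge0 na) ?(nabs_int_le1 na) //.
  by rewrite (nabsX na) exprn_ile1 ?(nabs_ge0 na).
have zab : abs (z ^+ (p ^ b) - z ^+ (p ^ a)) < 1.
  have -> : z ^+ (p ^ b) - z ^+ (p ^ a) =
      (map_poly (intr : int -> C) ('X^(p ^ b) - 'X^(p ^ a))).[z].
    by rewrite rmorphB /= !map_polyXn !hornerE.
  rewrite hDT rmorphD rmorphM /= map_polyZ /= hornerD hornerM hornerZ.
  apply: (nabsD_lt na) => //; rewrite (nabsM na).
    by apply: le_lt_trans Sz; rewrite ler_piMl ?(nabs_ge0 na) ?int1.
  by apply: le_lt_trans p1; rewrite ler_piMr ?(nabs_ge0 na) ?int1.
have X1 i : abs (z ^+ i) <= 1 by rewrite (nabsX na) exprn_ile1 ?(nabs_ge0 na).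
exists (b - a)%N; first by rewrite subn_gt0.
(* By additivity of Frobenius, w^(p^a) is congruent to z^(p^b) - z^(p^a), so it has norm below 1,
   and therefore so has w. *)
set q := (p ^ (b - a))%N; set w := z ^+ q - z.
have w1 : abs w <= 1 by apply: (nabsB_le na).
have wlt : abs w < 1.
  have : abs (w ^+ (p ^ a)) < 1.
    have := frobXD na p_prime p1 a w1 z1.
    rewrite subrK -exprM -expnD subnK ?(ltnW ab) // => h.
    have -> : w ^+ (p ^ a) = (z ^+ (p ^ b) - z ^+ (p ^ a)) -
      (z ^+ (p ^ b) - (w ^+ (p ^ a) + z ^+ (p ^ a))) by ring.
    exact: (nabsB_lt na).
  by rewrite (nabsX na) expr_lt1 ?(nabs_ge0 na) // expn_gt0 prime_gt0.
have -> : x ^+ q - x = (x ^+ q - z ^+ q) + (w - (x - z)) by rewrite /w; ring.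
apply: (nabsD_lt na) => //; last exact: (nabsB_lt na).
by apply: le_lt_trans hy; apply: (nabsX_sub_le na).
Qed.

End CpFacts.

(** * Rational functions *)

Lemma fraction_repr (T : idomainType) (f : {fraction T}) :
  f * FracField.tofrac (\d_(repr f)) = FracField.tofrac (\n_(repr f)).
Proof.
rewrite -{1}[f]reprK; unlock FracField.tofrac; rewrite -[LHS]FracField.pi_mul.
apply/eqmodP; rewrite /= FracField.equivfE /FracField.mulf.
by rewrite !numden_Ratio ?mulr1 ?oner_neq0 // 1?mulrC // denom_ratioP.
Qed.

(** * Homogeneous forms on the projective line *)

Section HomEval.
Context (K : fieldType).
Implicit Types (S A B : {poly K}) (x y : K).

Lemma hom_eval1 d S x : (size S <= d.+1)%N -> hom_eval d S x 1 = S.[x].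
Proof. by move=> h; rewrite hom_eval_horner ?oner_neq0 // expr1n mul1r divr1. Qed.

Lemma hom_evalZ d S k x y : hom_eval d S (k * x) (k * y) = k ^+ d * hom_eval d S x y.
Proof.
rewrite /hom_eval mulr_sumr; apply: eq_bigr => i _.
have id : (i <= d)%N by rewrite -ltnS.
have -> : k ^+ d = k ^+ i * k ^+ (d - i) by rewrite -exprD subnKC.
by rewrite !exprMn; ring.
Qed.

Lemma hom_eval0 d x y : hom_eval d (0 : {poly K}) x y = 0.
Proof. by rewrite /hom_eval big1 // => i _; rewrite coef0 !mul0r. Qed.

Lemma hom_evalD d A B x y : hom_eval d (A + B) x y = hom_eval d A x y + hom_eval d B x y.
Proof. by rewrite -big_split; apply: eq_bigr => i _; rewrite coefD !mulrDl. Qed.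

Lemma hom_evalCM d c A x y : hom_eval d (c *: A) x y = c * hom_eval d A x y.
Proof. by rewrite /hom_eval mulr_sumr; apply: eq_bigr => i _; rewrite coefZ !mulrA. Qed.

Lemma coefM_top A B d e : (size A <= d.+1)%N -> (size B <= e.+1)%N ->
  (A * B)`_(d + e) = A`_d * B`_e.
Proof.
move=> sA sB; have dlt : (d < (d + e).+1)%N by rewrite ltnS leq_addr.
rewrite coefM (bigD1 (Ordinal dlt)) //= addKn big1 ?addr0 // => i ine.
have [id|di|eq] := ltngtP i d.
- rewrite [B`_ _]nth_default ?mulr0 //; apply: leq_trans sB _.
  by rewrite ltn_subRL ltn_add2r.
- by rewrite [A`_ _]nth_default ?mul0r // (leq_trans sA).
- by rewrite -val_eqE /= eq eqxx in ine.
Qed.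

Lemma hom_evalM A B d e x y : (size A <= d.+1)%N -> (size B <= e.+1)%N ->
  hom_eval (d + e) (A * B) x y = hom_eval d A x y * hom_eval e B x y.
Proof.
move=> sA sB; have [->|y0] := eqVneq y 0.
  by rewrite !hom_eval_infty coefM_top // exprD; ring.
have sAB : (size (A * B)%R <= (d + e).+1)%N.
  apply: leq_trans (size_polyMleq _ _) _.
  have := leq_add sA sB; rewrite addSn addnS -!subn1; move=> h.
  by rewrite leq_subLR add1n.
by rewrite !hom_eval_horner // hornerM exprD; ring.
Qed.

Lemma size_exp_le A d i : (size A <= d.+1)%N -> (size (A ^+ i)%R <= (i * d).+1)%N.
Proof.
move=> sA; apply: leq_trans (size_poly_exp_leq _ _) _; rewrite ltnS mulnC leq_mul2l.
by apply/orP; right; rewrite -ltnS; case: (size A) sA.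
Qed.

Lemma hom_evalX A d i x y : (size A <= d.+1)%N ->
  hom_eval (i * d) (A ^+ i) x y = hom_eval d A x y ^+ i.
Proof.
move=> sA; elim: i => [|i IH].
  by rewrite mul0n !expr0 /hom_eval big_ord1 coef1 /= !expr0 !mulr1.
by rewrite mulSn !exprS hom_evalM // ?IH // size_exp_le.
Qed.

Lemma size_hom_comp d e S A B : (size A <= e.+1)%N -> (size B <= e.+1)%N ->
  (size (hom_comp d S A B) <= (d * e).+1)%N.
Proof.
move=> sA sB; apply: leq_trans (size_sum _ _ _) _; apply/bigmax_leqP => i _.
apply: leq_trans (size_scale_leq _ _) _; apply: leq_trans (size_polyMleq _ _) _.
have := leq_add (size_exp_le i sA) (size_exp_le (d - i) sB).
have id : (i <= d)%N by rewrite -ltnS.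
by rewrite addSn addnS -mulnDl subnKC //; case: (_ + _)%N.
Qed.

Lemma hom_eval_comp d e S A B x y : (size A <= e.+1)%N -> (size B <= e.+1)%N ->
  hom_eval (d * e) (hom_comp d S A B) x y = hom_eval d S (hom_eval e A x y) (hom_eval e B x y).
Proof.
move=> sA sB; rewrite /hom_comp.
have -> : hom_eval (d * e) (\sum_(i < d.+1) S`_i *: (A ^+ i * B ^+ (d - i))) x y =
    \sum_(i < d.+1) hom_eval (d * e) (S`_i *: (A ^+ i * B ^+ (d - i))) x y.
  elim/big_rec2: _ => [|i u v _ <-]; first exact: hom_eval0.
  exact: hom_evalD.
apply: eq_bigr => i _; rewrite hom_evalCM -mulrA; congr (_ * _).
have {1}-> : (d * e = i * e + (d - i) * e)%N by rewrite -mulnDl subnKC // -ltnS.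
by rewrite hom_evalM ?size_exp_le // !hom_evalX.
Qed.

Lemma hom_eval_zero (K_closed : alg_closed K) d S : (0 < d)%N -> (size S <= d.+1)%N ->
  exists x y, (x != 0) || (y != 0) /\ hom_eval d S x y = 0.
Proof.
move=> d0 sS; have [Sd|Sd] := eqVneq S`_d 0.
  by exists 1, 0; rewrite oner_neq0 hom_eval_infty Sd mul0r.
have dS : (1 < size S)%N.
  rewrite ltnNge; apply/negP => S1; move: Sd; rewrite nth_default ?eqxx //.
  exact: leq_trans d0.
have [x /rootP Sx] := K_closed S dS; exists x, 1.
by rewrite oner_neq0 orbT hom_eval1 // Sx.
Qed.

(** Coprimality of the two forms of degree d, the point at infinity included. Unlike being in lowest
    terms for polynomials, it passes to compositions by mere substitution. *)
Definition no_common_zero (d : nat) (A B : {poly K}) : Prop :=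
  [/\ (size A <= d.+1)%N, (size B <= d.+1)%N & forall x y,
      hom_eval d A x y = 0 -> hom_eval d B x y = 0 -> x = 0 /\ y = 0].

Lemma no_common_zero_neq0 d A B x y : no_common_zero d A B -> (x != 0) || (y != 0) ->
  (hom_eval d A x y != 0) || (hom_eval d B x y != 0).
Proof.
move=> [_ _ h]; apply: contraTT; rewrite !negb_or !negbK => /andP[/eqP hA /eqP hB].
by have [-> ->] := h x y hA hB; rewrite eqxx.
Qed.

Lemma P1_pointZ k x y : k != 0 -> P1_point (k * x) (k * y) = P1_point x y.
Proof.
move=> k0; rewrite /P1_point mulf_eq0 (negPf k0) /=; case: eqP => // /eqP y0.
by rewrite -mulf_div divff // mul1r.
Qed.

Lemma P1_point_eq x y x' y' : (x != 0) || (y != 0) -> (x' != 0) || (y' != 0) ->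
  x * y' = x' * y -> P1_point x y = P1_point x' y'.
Proof.
rewrite /P1_point; have [->|y0] := eqVneq y 0.
  rewrite orbF mulr0 => x0 _ /eqP; rewrite mulf_eq0 (negPf x0) /= => /eqP ->.
  by rewrite eqxx.
have [->|y'0] := eqVneq y' 0.
  by rewrite orbF mulr0 => _ x'0 /esym/eqP; rewrite mulf_eq0 (negPf x'0) (negPf y0).
by move=> _ _ e; congr Some; apply/eqP; rewrite eqr_div // e mulrC.
Qed.

Lemma P1_coord_neq0 (z : P1 K) : ((P1_coord z).1 != 0) || ((P1_coord z).2 != 0).
Proof. by case: z => [x|] /=; rewrite oner_neq0 ?orbT. Qed.

Lemma P1_coordK (z : P1 K) : P1_point (P1_coord z).1 (P1_coord z).2 = z.
Proof. by case: z => [x|]; rewrite /P1_point /= ?oner_eq0 ?divr1 ?eqxx. Qed.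

Lemma P1_coord_point x y : (x != 0) || (y != 0) ->
  exists2 k, k != 0 & x = k * (P1_coord (P1_point x y)).1 /\ y = k * (P1_coord (P1_point x y)).2.
Proof.
rewrite /P1_point; have [->|y0] := eqVneq y 0 => /=.
  by rewrite orbF => x0; exists x; rewrite // mulr1 mulr0.
by exists y; rewrite // mulr1 mulrC divfK.
Qed.

Definition hom_map d A B (z : P1 K) : P1 K :=
  P1_point (hom_eval d A (P1_coord z).1 (P1_coord z).2)
           (hom_eval d B (P1_coord z).1 (P1_coord z).2).

Lemma hom_map_point d A B x y : (x != 0) || (y != 0) ->
  hom_map d A B (P1_point x y) = P1_point (hom_eval d A x y) (hom_eval d B x y).
Proof.
move=> /P1_coord_point [k k0 [hx hy]]; rewrite /hom_map.
move: (P1_coord _) hx hy => c -> ->.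
by rewrite !hom_evalZ P1_pointZ // expf_neq0.
Qed.

End HomEval.

Lemma expr_div_pad (F : fieldType) (a b : F) i m : b != 0 ->
  (a / b) ^+ i = a ^+ i * b ^+ m / b ^+ (m + i).
Proof. by move=> b0; rewrite addnC exprD expr_div_n -mulf_div divff ?mulr1 // expf_neq0. Qed.

Section RatRep.
Context (K : fieldType).
Hypothesis K_closed : alg_closed K.
Implicit Types (f g h : ratfun K) (S A B : {poly K}).
Local Notation "A %:F" := (FracField.tofrac (A : {poly K})).

Lemma rat_den_neq0 f : rat_den f != 0.
Proof.
rewrite /rat_den dvdp_div_eq0 ?dvdp_gcdr //; exact: denom_ratioP.
Qed.

Lemma rat_frac f : f = (rat_num f)%:F / (rat_den f)%:F.
Proof.
have d0 : (rat_den f)%:F != 0 by rewrite tofrac_eq0 rat_den_neq0.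
have hn : \n_(repr f) = rat_num f * rat_gcd f by rewrite divpK // dvdp_gcdl.
have hd : \d_(repr f) = rat_den f * rat_gcd f by rewrite divpK // dvdp_gcdr.
have q0 : (rat_gcd f)%:F != 0.
  rewrite tofrac_eq0; apply/eqP => q0; have := denom_ratioP (repr f).
  by rewrite hd q0 mulr0 eqxx.
have := fraction_repr f; rewrite hn hd !tofracM mulrA => /(mulIf q0) e.
rewrite -e; exact: (esym (mulfK d0 f)).
Qed.

Lemma rat_no_common_zero f : no_common_zero (rat_degree f) (rat_num f) (rat_den f).
Proof.
set d := rat_degree f; have den0 := rat_den_neq0 f.
have dE : maxn (size (rat_num f)) (size (rat_den f)) = d.+1.
  by rewrite /d /rat_degree prednK // leq_max orbC size_poly_gt0 den0.
have sA : (size (rat_num f) <= d.+1)%N by rewrite -dE leq_maxl.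
have sB : (size (rat_den f) <= d.+1)%N by rewrite -dE leq_maxr.
have cop : coprimep (rat_num f) (rat_den f).
  by apply: coprimep_div_gcd; rewrite denom_ratioP orbT.
split=> // x y; have [->|y0] := eqVneq y 0.
  rewrite !hom_eval_infty => hA hB; split=> //; apply/eqP; apply: contraT => x0.
  have xd : x ^+ d != 0 by rewrite expf_neq0.
  have /eqP := hA; have /eqP := hB; rewrite !mulf_eq0 (negPf xd) !orbF => /eqP Bd /eqP Ad.
  have /orP[] : (size (rat_num f) == d.+1) || (size (rat_den f) == d.+1).
    by rewrite -dE; case: leqP; rewrite eqxx ?orbT.
    move=> /eqP s1; have : lead_coef (rat_num f) == 0 by rewrite /lead_coef s1 Ad.
    by rewrite lead_coef_eq0 => /eqP n0; rewrite n0 size_poly0 in s1.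
  move=> /eqP s1; have : lead_coef (rat_den f) == 0 by rewrite /lead_coef s1 Bd.
  by rewrite lead_coef_eq0 (negPf den0).
rewrite !hom_eval_horner // => /eqP; rewrite mulf_eq0 (negPf (expf_neq0 d y0)) /= => hA /eqP.
by rewrite mulf_eq0 (negPf (expf_neq0 d y0)) /= (negPf (coprimep_root cop hA)).
Qed.

Lemma rat_map_hom f : rat_map f = hom_map (rat_degree f) (rat_num f) (rat_den f).
Proof.
have [sA sB _] := rat_no_common_zero f.
apply/funext => -[x|]; rewrite /hom_map /=; first by rewrite !hom_eval1.
by rewrite !hom_eval_infty expr1n !mulr1.
Qed.

(** Compositions come with a numerator and a denominator that need not be the canonical ones. Any
    such pair computes [rat_map], since cross multiplication identifies it with the canonical pair;
    d > 0 excludes constants. *)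
Definition rat_rep h A B d : Prop :=
  [/\ (0 < d)%N, B != 0, no_common_zero d A B & h = A%:F / B%:F].

Lemma frac_eq_cross A B A' B' : B != 0 -> B' != 0 -> A%:F / B%:F = A'%:F / B'%:F ->
  A * B' = A' * B.
Proof.
move=> B0 B'0 /eqP; rewrite eqr_div ?tofrac_eq0 // -!tofracM tofrac_eq.
by move=> /eqP.
Qed.

Lemma rat_map_rep h A B d : rat_rep h A B d -> rat_map h = hom_map d A B.
Proof.
move=> [_ B0 nd hE]; rewrite rat_map_hom; have nd' := rat_no_common_zero h.
have e : rat_num h * B = A * rat_den h.
  by apply: frac_eq_cross; rewrite ?rat_den_neq0 // -rat_frac.
have [sA sB _] := nd; have [sA' sB' _] := nd'.
apply/funext => z; have z0 := P1_coord_neq0 z.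
apply: P1_point_eq; try exact: no_common_zero_neq0.
by rewrite -!hom_evalM // e addnC.
Qed.

(** The form of B vanishes somewhere because d > 0, and that of A does not vanish there. In degree 0
    the cross-multiplied identity would then make the constant denominator of h zero. *)
Lemma rat_degree_rep h A B d : rat_rep h A B d -> (0 < rat_degree h)%N.
Proof.
move=> [d0 B0 nd hE]; rewrite lt0n; apply/eqP => dh.
have nd' := rat_no_common_zero h; rewrite dh in nd'.
have [sA sB _] := nd; have [sA' sB' _] := nd'.
have e : rat_num h * B = A * rat_den h.
  by apply: frac_eq_cross; rewrite ?rat_den_neq0 // -rat_frac.
have [x [y [xy hB]]] := hom_eval_zero K_closed d0 sB.
have eh : hom_eval (0 + d) (rat_num h * B) x y = hom_eval (d + 0) (A * rat_den h) x y.
  by rewrite e addnC.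
move: eh; rewrite !hom_evalM // hB mulr0 => /esym/eqP; rewrite mulf_eq0 => /orP[/eqP hA|].
  by have := no_common_zero_neq0 nd xy; rewrite hA hB eqxx.
have -> : hom_eval 0 (rat_den h) x y = (rat_den h)`_0.
  by rewrite /hom_eval big_ord1 /= !expr0 !mulr1.
move=> /eqP den0; have := rat_den_neq0 h.
by rewrite (size1_polyC sB') den0 polyC0 eqxx.
Qed.

Lemma rat_eval_frac S A B d : B != 0 -> (size S <= d.+1)%N ->
  rat_eval S (A%:F / B%:F) = (hom_comp d S A B)%:F / B%:F ^+ d.
Proof.
move=> B0 sS; have b0 : B%:F != 0 by rewrite tofrac_eq0.
rewrite /rat_eval (@horner_coef_wide _ d.+1); last first.
  by apply: leq_trans (size_poly _ _) _.
rewrite /hom_comp rmorph_sum /= mulr_suml; apply: eq_bigr => i _.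
rewrite coef_map_id0 /=; last by rewrite polyC0 tofrac0.
have id : (i <= d)%N by rewrite -ltnS.
rewrite (expr_div_pad _ i (d - i) b0) subnK //.
by rewrite -mul_polyC !tofracM !tofracXn !mulrA.
Qed.

Lemma rat_rep_comp f g A B e : (0 < rat_degree f)%N -> rat_rep g A B e ->
  let d := rat_degree f in
  rat_rep (rat_comp f g) (hom_comp d (rat_num f) A B) (hom_comp d (rat_den f) A B) (d * e).
Proof.
move=> d0 [e0 B0 nd gE] d; have [sA sB _] := nd; have [sP sQ _] := rat_no_common_zero f.
have de0 : (0 < d * e)%N by rewrite muln_gt0 d0.
have nd' : no_common_zero (d * e) (hom_comp d (rat_num f) A B) (hom_comp d (rat_den f) A B).
  split; try exact: size_hom_comp.
  move=> x y; rewrite !hom_eval_comp // => h1 h2.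
  have [_ _ hf] := rat_no_common_zero f; have [hA hB] := hf _ _ h1 h2.
  by have [_ _] := nd; apply.
have Q0 : hom_comp d (rat_den f) A B != 0.
  apply/eqP => Q0; have [sA' _ _] := nd'.
  have [x [y [xy h]]] := hom_eval_zero K_closed de0 sA'.
  by have := no_common_zero_neq0 nd' xy; rewrite h Q0 hom_eval0 eqxx.
split=> //; rewrite /rat_comp gE !(@rat_eval_frac _ _ _ d) // -mulf_div divff ?mulr1 //.
by rewrite invr_eq0 expf_neq0 // tofrac_eq0.
Qed.

Lemma rat_map_comp f g A B e : (0 < rat_degree f)%N -> rat_rep g A B e ->
  rat_map (rat_comp f g) = rat_map f \o rat_map g.
Proof.
move=> d0 gr; rewrite (rat_map_rep (rat_rep_comp d0 gr)) (rat_map_rep gr) rat_map_hom.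
have [_ _ nd _] := gr; have [sA sB _] := nd.
apply/funext => z; rewrite /comp [X in _ = hom_map _ _ _ X]/hom_map hom_map_point.
  by rewrite /hom_map !hom_eval_comp.
exact: no_common_zero_neq0 nd (P1_coord_neq0 z).
Qed.

Lemma rat_rep_id : rat_rep (rat_id K) 'X 1 1.
Proof.
split; rewrite ?oner_neq0 //; last by rewrite tofrac1 divr1.
split; rewrite ?size_polyX ?size_poly1 // => x y.
rewrite /hom_eval !big_ord_recr !big_ord0 /= !coefX !coef1 /= !expr0 !expr1.
by rewrite !mul0r !mul1r !mulr1 !add0r !addr0.
Qed.

Lemma rat_rep_inv : rat_rep (rat_id K)^-1 1 'X 1.
Proof.
have [_ _ [_ _ nd] _] := rat_rep_id; split; rewrite ?polyX_eq0 //.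
  by split=> [||x y h1 h2]; rewrite ?size_polyX ?size_poly1 //; apply: nd.
by rewrite tofrac1 mul1r.
Qed.

Definition P1_inv (z : P1 K) : P1 K := P1_point (P1_coord z).2 (P1_coord z).1.

Lemma rat_map_inv : rat_map (rat_id K)^-1 = P1_inv.
Proof.
rewrite (rat_map_rep rat_rep_inv); apply/funext => z; rewrite /hom_map /P1_inv.
rewrite /hom_eval !big_ord_recr !big_ord0 /= !coefX !coef1 /= !expr0 !expr1.
by rewrite !mul0r !mul1r !mulr1 !add0r !addr0.
Qed.

Lemma rat_rep_iter f n : (0 < rat_degree f)%N -> exists A B d, rat_rep (rat_iter n f) A B d.
Proof.
move=> d0; elim: n => [|n [A [B [d IH]]]]; first by exists 'X, 1, 1%N; apply: rat_rep_id.
by do 3!eexists; apply: rat_rep_comp IH.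
Qed.

Lemma rat_map_iter f n : (0 < rat_degree f)%N -> rat_map (rat_iter n f) = iter n (rat_map f).
Proof.
move=> d0; elim: n => [|n IH].
  rewrite (rat_map_rep rat_rep_id); apply/funext => z; rewrite /hom_map.
  rewrite /hom_eval !big_ord_recr !big_ord0 /= !coefX !coef1 /= !expr0 !expr1.
  by rewrite !mul0r !mul1r !mulr1 !add0r !addr0 P1_coordK.
have [A [B [d r]]] := rat_rep_iter n d0.
by rewrite /rat_iter iterS (rat_map_comp d0 r) -/(rat_iter n f) IH.
Qed.

Lemma rat_map_conj_inv g A B d : rat_rep g A B d ->
  rat_map (rat_conj_inv g) = P1_inv \o rat_map g \o P1_inv.
Proof.
move=> gr; have dg := rat_degree_rep gr.
rewrite /rat_conj_inv (rat_map_comp (rat_degree_rep rat_rep_inv) (rat_rep_comp dg rat_rep_inv)).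
by rewrite (rat_map_comp dg rat_rep_inv) !rat_map_inv.
Qed.

End RatRep.

(** * Multipliers *)

Section Chordal.
Context (R : realType) (K : fieldType) (abs : K -> R).
Hypothesis na : is_nonarch_abs abs.

Local Notation chordal := (chordal abs).
Local Notation nrm x y := (Num.max (abs x) (abs y)).

Lemma nrm_gt0 x y : (x != 0) || (y != 0) -> 0 < nrm x y.
Proof. by rewrite lt_max !(nabs_gt0 na). Qed.

Lemma nrmZ k x y : nrm (k * x) (k * y) = abs k * nrm x y.
Proof. by rewrite !(nabsM na) maxr_pMr ?(nabs_ge0 na). Qed.

Lemma chordalE z w : chordal z w =
  abs ((P1_coord z).1 * (P1_coord w).2 - (P1_coord w).1 * (P1_coord z).2)
    / (nrm (P1_coord z).1 (P1_coord z).2 * nrm (P1_coord w).1 (P1_coord w).2).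
Proof. by rewrite /Defs.chordal; case: (P1_coord z) => x y; case: (P1_coord w). Qed.

Lemma chordal_point x y x' y' : (x != 0) || (y != 0) -> (x' != 0) || (y' != 0) ->
  chordal (P1_point x y) (P1_point x' y') = abs (x * y' - x' * y) / (nrm x y * nrm x' y').
Proof.
move=> /P1_coord_point [k k0 [hx hy]] /P1_coord_point [k' k'0 [hx' hy']].
rewrite chordalE; move: (P1_coord _) hx hy => u -> ->; move: (P1_coord _) hx' hy' => v -> ->.
rewrite !nrmZ.
have -> : k * u.1 * (k' * v.2) - k' * v.1 * (k * u.2) = k * k' * (u.1 * v.2 - v.1 * u.2) by ring.
rewrite !(nabsM na) mulrACA -mulf_div divff ?mul1r //.
by rewrite mulf_neq0 ?(nabs_eq0 na).
Qed.

Lemma chordal_ge0 z w : 0 <= chordal z w.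
Proof.
rewrite chordalE divr_ge0 ?(nabs_ge0 na) // mulr_ge0 //; apply: ltW; apply: nrm_gt0; exact: P1_coord_neq0.
Qed.

Lemma P1_invK (z : P1 K) : P1_inv (P1_inv z) = z.
Proof.
case: z => [x|]; rewrite /P1_inv /P1_point /=; last by rewrite oner_eq0 /= divr1 eqxx.
have [->|x0] := eqVneq x 0; first by rewrite /= oner_eq0 divr1.
by rewrite /= mulf_eq0 oner_eq0 invr_eq0 (negPf x0) /= !div1r invrK.
Qed.

Lemma chordal_inv z w : chordal (P1_inv z) (P1_inv w) = chordal z w.
Proof.
rewrite /P1_inv chordal_point 1?orbC ?P1_coord_neq0 // chordalE (nabs_sub na).
rewrite ![Num.max (abs _.2) _]maxC; congr (abs _ / _); ring.
Qed.

Lemma chordal_Some x z : abs (z - x) < nrm x 1 ->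
  chordal (Some z) (Some x) = abs (z - x) / nrm x 1 ^+ 2.
Proof.
move=> h; rewrite chordalE /= mulr1 mulr1; congr (_ / _).
suff -> : nrm z 1 = nrm x 1 by rewrite expr2.
have -> : z = (z - x) + x by ring.
have [x1|x1] := leP (abs x) 1.
  have e : nrm x 1 = 1 by rewrite max_r (nabs1 na).
  rewrite e in h *; rewrite max_r (nabs1 na) //; apply: (nabsD_le na) => //; exact: ltW.
have e : nrm x 1 = abs x by rewrite max_l ?(nabs1 na) // ltW.
by rewrite e in h *; rewrite (nabsDr na) // max_l ?(nabs1 na) // ltW.
Qed.

(** A substitute for a multiplier of norm below 1 that survives changes of coordinate up to the
    constant c, so no chain rule is needed. Chordal distance is invariant under 1/z, which brings a
    fixed point at infinity to 0. *)
Definition geometrically_attracted (F : P1 K -> P1 K) (z0 : P1 K) : Prop :=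
  exists c theta e : R, [/\ 0 <= theta < 1, 0 < e & forall y, chordal y z0 < e ->
    forall k, chordal (iter k F y) z0 <= c * theta ^+ k * chordal y z0].

Context (K_closed : alg_closed K) (pi : K).
Hypothesis abs_pi : 0 < abs pi < 1.

(** Close to a fixed point with multiplier lambda of norm at least 1 the map
    multiplies chordal distances by |lambda|, against the geometric decay. *)
Lemma rat_deriv_lt1 (h : ratfun K) x : rat_map h (Some x) = Some x ->
  geometrically_attracted (rat_map h) (Some x) -> abs (rat_deriv_at h x) < 1.
Proof.
set A := rat_num h; set B := rat_den h.
move=> hx [c [th [e [th01 e0 hth]]]].
have /andP[Bx /eqP Ax] : (B.[x] != 0) && (A.[x] == x * B.[x]).
  move: hx; rewrite /rat_map /P1_point -/A -/B; case: (eqVneq B.[x] 0) => // Bx [xE].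
  by apply/eqP; rewrite -{2}xE divfK.
rewrite ltNge; apply/negP => lam1; set lam := rat_deriv_at h x in lam1.
have [E defE] : exists E, A - x%:P * B = E * ('X - x%:P).
  by apply/factor_theorem; rewrite rootE !hornerE Ax subrr.
have Ex : E.[x] = lam * B.[x].
  have := congr1 (fun S => S^`().[x]) defE.
  rewrite derivB !derivM derivC mul0r add0r derivB derivX derivC subr0 mulr1 !hornerE.
  rewrite subrr mulr0 add0r => <-.
  by rewrite /lam /rat_deriv_at -/A -/B Ax; field.
have lam0 : 0 < abs lam by lra.
have Ex0 : 0 < abs E.[x] by rewrite Ex (nabsM na) mulr_gt0 // (nabs_gt0 na).
have near (S : {poly K}) : 0 < abs S.[x] ->
    exists2 d, 0 < d & forall z, abs (z - x) < d -> abs S.[z] = abs S.[x].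
  move=> S0; have [M M0 hM] := poly_lipschitz na S x 1.
  exists (Num.min 1 (abs S.[x] / (M + 1))).
    by rewrite lt_min ltr01 divr_gt0 //; lra.
  move=> z; rewrite lt_min => /andP[z1 z2]; rewrite ltr_pdivlMr in z2; last by lra.
  have -> : S.[z] = S.[x] + (S.[z] - S.[x]) by ring.
  apply: (nabsDl na) => //; apply: le_lt_trans (hM z (ltW z1)) _; apply: le_lt_trans z2.
  by rewrite mulrC ler_wpM2l ?(nabs_ge0 na) //; lra.
have [d1 d10 hd1] := near E Ex0.
have [d2 d20 hd2] : exists2 d, 0 < d & forall z, abs (z - x) < d -> abs B.[z] = abs B.[x].
  by apply: near; rewrite (nabs_gt0 na).
pose m := nrm x 1; have m1 : 1 <= m by rewrite le_max (nabs1 na) // lexx orbT.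
pose d := Num.min (Num.min d1 d2) (Num.min m e).
have d0 : 0 < d by rewrite !lt_min d10 d20 e0; lra.
have step z : abs (z - x) < d ->
    exists2 z', rat_map h (Some z) = Some z' & abs (z' - x) = abs lam * abs (z - x).
  rewrite !lt_min => /andP[/andP[z1 z2] _].
  have Bz : B.[z] != 0 by rewrite -(nabs_gt0 na) hd2 // (nabs_gt0 na).
  exists (A.[z] / B.[z]); first by rewrite /rat_map /P1_point -/A -/B (negPf Bz).
  have -> : A.[z] / B.[z] - x = (A - x%:P * B).[z] / B.[z] by rewrite !hornerE; field.
  rewrite defE hornerM hornerXsubC (nabs_div na) (nabsM na) hd1 // hd2 // Ex (nabsM na).
  by rewrite mulrAC mulfK // (nabs_eq0 na).
(* After k steps the geometric bound is below the initial distance, whereas multiplication by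
   |lam|^k has not decreased that distance. *)
have [k hk] : exists k, th ^+ k < (Num.max c 1)^-1.
  by apply: expr_small; rewrite // invr_gt0 lt_max ltr01 orbT.
have cth : c * th ^+ k < 1.
  have c1 : 0 < Num.max c 1 by rewrite lt_max ltr01 orbT.
  have thk : 0 <= th ^+ k by rewrite exprn_ge0 //; case/andP: th01.
  apply: (@le_lt_trans _ _ (Num.max c 1 * th ^+ k)).
    by rewrite ler_wpM2r // le_max lexx.
  by rewrite mulrC -ltr_pdivlMr // div1r.
have lk0 : 0 < abs lam ^+ k by rewrite exprn_gt0.
(* The starting point x + pi^N is so close to x that its first k iterates stay where [step]
   applies. *)
have [N hN] : exists N, abs pi ^+ N < d / abs lam ^+ k.
  by apply: expr_small; rewrite ?divr_gt0 //; case/andP: abs_pi => /ltW -> ->.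
pose eta := abs (pi ^+ N).
have eta0 : 0 < eta by rewrite /eta (nabsX na) exprn_gt0 //; case/andP: abs_pi.
have etad i : (i <= k)%N -> abs lam ^+ i * eta < d.
  move=> ik; rewrite -(nabsX na) // ltr_pdivlMr // mulrC in hN; apply: le_lt_trans hN.
  by rewrite ler_pM2r // ler_weXn2l.
have orb i : (i <= k)%N -> exists2 z, iter i (rat_map h) (Some (x + pi ^+ N)) = Some z &
    abs (z - x) = abs lam ^+ i * eta.
  elim: i => [|i IH] ik; first by exists (x + pi ^+ N); rewrite // expr0 mul1r addrC addKr.
  have [z hz hzx] := IH (ltnW ik).
  have [|z' h1 h2] := step z; first by rewrite hzx etad // ltnW.
  by exists z'; rewrite ?iterS ?hz // h2 hzx exprS mulrA.
have dm : d <= m by rewrite !ge_min lexx orbT.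
have de : d <= e by rewrite !ge_min lexx !orbT.
have m0 : 0 < m ^+ 2 by rewrite exprn_gt0 // (lt_le_trans ltr01 m1).
have [zk hzk hzkx] := orb k (leqnn k).
have z0x : abs (x + pi ^+ N - x) = eta by rewrite addrC addKr.
have eta_d : eta < d by have := etad 0%N (leq0n _); rewrite expr0 mul1r.
have eta_m : eta / m ^+ 2 <= eta.
  by rewrite ler_pdivrMr // ler_peMr ?(ltW eta0) // exprn_ege1.
have ch0 : chordal (Some (x + pi ^+ N)) (Some x) = eta / m ^+ 2.
  by rewrite chordal_Some // z0x //; apply: lt_le_trans dm.
have := hth (Some (x + pi ^+ N)); rewrite ch0 => /(_ _ k) H.
have : eta / m ^+ 2 < e by apply: le_lt_trans eta_m _; apply: lt_le_trans de.
move=> /H; rewrite hzk chordal_Some //; last first.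
  by rewrite hzkx; apply: lt_le_trans dm; apply: etad.
rewrite hzkx mulrA ler_pM2r ?invr_gt0 // leNgt => /negP; apply.
rewrite ltr_pM2r //; apply: lt_le_trans cth _; exact: exprn_ege1.
Qed.

Lemma geometric_is_attracting (f : ratfun K) z0 n : (0 < rat_degree f)%N ->
  has_primitive_period f z0 n -> geometrically_attracted (iter n (rat_map f)) z0 ->
  is_attracting abs f z0.
Proof.
move=> d0 per b; exists n => //; have [_ fz0 _] := per.
rewrite -(rat_map_iter K_closed n d0) in fz0 b.
case: z0 fz0 b {per} => [x|] fz0 b /=; first exact: rat_deriv_lt1.
have [A [B [d gr]]] := rat_rep_iter K_closed n d0.
have conjE := rat_map_conj_inv K_closed gr.
have inv0 : P1_inv (Some 0) = None :> P1 K by rewrite /P1_inv /P1_point /= eqxx.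
have invoo : P1_inv None = Some 0 :> P1 K by rewrite /P1_inv /P1_point /= oner_eq0 mul0r.
apply: rat_deriv_lt1; first by rewrite conjE /= inv0 fz0 invoo.
have [c [th [e [th01 e0 hth]]]] := b; exists c, th, e; split=> // y.
rewrite -(P1_invK y) -{1 2}invoo !chordal_inv => /hth h k.
have -> : iter k (rat_map (rat_conj_inv (rat_iter n f))) (P1_inv (P1_inv y)) =
    P1_inv (iter k (rat_map (rat_iter n f)) (P1_inv y)).
  by elim: k => //= k ->; rewrite conjE /= P1_invK.
by rewrite -invoo !chordal_inv.
Qed.

End Chordal.

(** * Fixed points and charts *)

Lemma uniq_of_rem (T : eqType) (s : seq T) : (forall w, w \in s -> w \notin rem w s) -> uniq s.
Proof.
elim: s => // x s IH h /=; apply/andP; split; first by have := h x (mem_head _ _); rewrite /= eqxx.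
apply: IH => w ws; have := h w; rewrite inE ws orbT /= => /(_ isT).
have [xw|_] := eqVneq x w; last by rewrite inE negb_or => /andP[].
by apply: contraNN => /mem_rem.
Qed.

Section NonrepellingFixedPoint.
Context (R : realType) (K : fieldType) (abs : K -> R).
Hypothesis (na : is_nonarch_abs abs) (K_closed : alg_closed K).

Lemma nonrepelling_fixed_point (P Q : {poly K}) d :
  (size P <= d.+1)%N -> (size Q <= d.+1)%N -> Q`_d != 0 ->
  exists2 w, P.[w] = w * Q.[w] & abs (P^`().[w] - w * Q^`().[w]) <= abs Q.[w].
Proof.
move=> sP sQ Qd; set N := P - 'X * Q.
have NdE : N`_d.+1 = - Q`_d.
  by rewrite /N coefB coefXM /= nth_default ?sub0r.
have szN : size N = d.+2.
  apply/anti_leq/andP; split.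
    apply: leq_trans (size_polyD _ _) _; rewrite size_polyN geq_max leqW //=.
    have [->|Q0] := eqVneq Q 0; first by rewrite mulr0 size_poly0.
    by rewrite mulrC size_mulX // ltnS.
  rewrite ltnNge; apply/negP => h; move: NdE; rewrite nth_default // => /esym/eqP.
  by rewrite oppr_eq0 (negPf Qd).
have leadN : lead_coef N = - Q`_d by rewrite /lead_coef szN.
have N0 : N != 0 by rewrite -size_poly_gt0 szN.
have lead0 : lead_coef N != 0 by rewrite lead_coef_eq0.
set s := poly_roots N.
have NE : N = lead_coef N *: \prod_(x <- s) ('X - x%:P) by apply: poly_splits.
have szs : size s = d.+1.
  by apply: succn_inj; rewrite -szN NE size_scale // size_prod_XsubC.
pose E w := lead_coef N *: \prod_(x <- rem w s) ('X - x%:P).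
have NEw w : w \in s -> N = E w * ('X - w%:P).
  by move=> ws; rewrite {1}NE (perm_big _ (perm_to_rem ws)) big_cons /= mulrC scalerAl.
have dN w : w \in s -> N^`().[w] = (E w).[w].
  move=> ws; rewrite (NEw w ws) derivM derivB derivX derivC subr0 mulr1 !hornerE.
  by rewrite subrr mulr0 add0r.
have fixw w : w \in s -> P.[w] = w * Q.[w].
  rewrite mem_poly_roots // rootE !hornerE subr_eq0 => /eqP //.
have dNE w : P^`().[w] - w * Q^`().[w] = N^`().[w] + Q.[w].
  by rewrite /N derivB derivM derivX !hornerE; ring.
apply: contrapT => H.
have big w : w \in s -> abs Q.[w] < abs N^`().[w].
  move=> ws; have h : abs Q.[w] < abs (N^`().[w] + Q.[w]).
    by rewrite -dNE ltNge; apply/negP => h; apply: H; exists w; rewrite // fixw.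
  rewrite ltNge; apply/negP => h2; move: h; rewrite ltNge => /negP; apply.
  exact: (nabsD_le na).
have dN0 w : w \in s -> (E w).[w] != 0.
  by move=> ws; rewrite -dN // -(nabs_gt0 na); apply: le_lt_trans (big w ws); apply: (nabs_ge0 na).
have Ew0 w v : v \in rem w s -> (E w).[v] = 0.
  move=> vs; rewrite /E hornerZ horner_prod; apply/eqP; rewrite mulf_eq0; apply/orP; right.
  by rewrite prodf_seq_eq0; apply/hasP; exists v; rewrite //= hornerXsubC subrr.
have us : uniq s.
  apply: uniq_of_rem => w ws; apply/negP => /Ew0 /eqP; exact/negP/dN0.
pose L := \sum_(w <- s) (Q.[w] / N^`().[w]) *: E w.
have szrem w : w \in s -> size (rem w s) = d by move=> ws; rewrite size_rem // szs.
have sE w : w \in s -> (size (E w) <= d.+1)%N.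
  by move=> ws; apply: leq_trans (size_scale_leq _ _) _; rewrite size_prod_XsubC szrem.
have Ed w : w \in s -> (E w)`_d = lead_coef N.
  move=> ws; rewrite /E coefZ; have := monicP (monic_prod_XsubC (rem w s) predT id).
  by rewrite /lead_coef size_prod_XsubC szrem //= => ->; rewrite mulr1.
have sL : (size L <= d.+1)%N.
  rewrite /L big_seq; apply: (@leq_trans (\max_(w <- s | w \in s) size ((Q.[w] / N^`().[w]) *: E w))).
    exact: size_sum.
  apply/bigmax_leqP_seq => w _ ws; apply: leq_trans (size_scale_leq _ _) _; exact: sE.
have Lv v : v \in s -> L.[v] = Q.[v].
  move=> vs; rewrite /L horner_sum (bigD1_seq v) //= big1_seq ?addr0 => [|w /andP[wv ws]].
    by rewrite hornerZ dN // divfK // dN0.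
  by rewrite hornerZ Ew0 ?mulr0 // mem_rem_uniq // inE eq_sym wv.
have LQ : L - Q = 0.
  apply/eqP; apply: contraT => n0.
  have := @max_poly_roots _ (L - Q) s n0; rewrite us szs => /(_ _ isT).
  have -> : all (root (L - Q)) s.
    by apply/allP => v vs; rewrite rootE !hornerE Lv // subrr.
  move=> /(_ isT); rewrite ltnNge => /negP; case.
  by apply: leq_trans (size_polyD _ _) _; rewrite size_polyN geq_max sL.
have LE : Q`_d = lead_coef N * \sum_(w <- s) (Q.[w] / N^`().[w]).
  have -> : Q = L by apply/esym/eqP; rewrite -subr_eq0 LQ.
  rewrite {1}/L coef_sum mulr_sumr !big_seq; apply: eq_bigr => w ws.
  by rewrite coefZ Ed // mulrC; congr (_ * (_ / _)); rewrite Lv.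
have : abs (\sum_(w <- s) (Q.[w] / N^`().[w])) < 1.
  rewrite big_seq; elim/big_ind: _ => [|x y|w ws]; [by rewrite (nabs0 na) // ltr01|exact: (nabsD_lt na)|].
  rewrite (nabs_div na) ltr_pdivrMr ?mul1r ?big //.
  by apply: le_lt_trans (big w ws); apply: (nabs_ge0 na).
have -> : \sum_(w <- s) (Q.[w] / N^`().[w]) = -1.
  by apply: (mulfI lead0); rewrite -LE leadN mulrN1 opprK.
by rewrite (nabsN na) (nabs1 na) // ltxx.
Qed.

End NonrepellingFixedPoint.

Definition rev_poly (K : fieldType) (d : nat) (S : {poly K}) : {poly K} :=
  \poly_(i < d.+1) S`_(d - i).

Lemma hom_eval_rev (K : fieldType) d (S : {poly K}) x y :
  hom_eval d (rev_poly d S) x y = hom_eval d S y x.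
Proof.
rewrite /hom_eval (reindex_inj rev_ord_inj) /=; apply: eq_bigr => i _.
have id : (i <= d)%N by rewrite -ltnS.
rewrite subSS coef_poly ltnS leq_subr subKn // -!mulrA; congr (_ * _); exact: mulrC.
Qed.

Section Charts.
Context (K : fieldType) (f : ratfun K).
Local Notation d := (rat_degree f).

(** Defined for finite u only; the one point missed, for an invertible matrix, is [P1_point a c],
    the image of infinity. *)
Definition moebius (a b c e u : K) : P1 K := P1_point (a * u + b) (c * u + e).

(** R reads z |-> P(z) / Q(z) in the coordinate z |-> (a z + b) / (c z + e). *)
Record chart (P Q : {poly K}) (a b c e : K) : Prop := Chart {
  chart_det : a * e - b * c != 0;
  chart_num_size : (size P <= d.+1)%N;
  chart_den_size : (size Q <= d.+1)%N;
  chart_num : forall x y, hom_eval d (rat_num f) (a * x + b * y) (c * x + e * y) =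
    a * hom_eval d P x y + b * hom_eval d Q x y;
  chart_den : forall x y, hom_eval d (rat_den f) (a * x + b * y) (c * x + e * y) =
    c * hom_eval d P x y + e * hom_eval d Q x y }.

Lemma linear_eq0 (a b c e x y : K) : a * e - b * c != 0 ->
  a * x + b * y = 0 -> c * x + e * y = 0 -> x = 0 /\ y = 0.
Proof.
move=> det h1 h2; split; apply/eqP.
  have : (a * e - b * c) * x == 0.
    have -> : (a * e - b * c) * x = e * (a * x + b * y) - b * (c * x + e * y) by ring.
    by rewrite h1 h2 !mulr0 subrr.
  by rewrite mulf_eq0 (negPf det).
have : (a * e - b * c) * y == 0.
  have -> : (a * e - b * c) * y = a * (c * x + e * y) - c * (a * x + b * y) by ring.
  by rewrite h1 h2 !mulr0 subrr.
by rewrite mulf_eq0 (negPf det).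
Qed.

Lemma linear_neq0 (a b c e x y : K) : a * e - b * c != 0 -> (x != 0) || (y != 0) ->
  (a * x + b * y != 0) || (c * x + e * y != 0).
Proof.
move=> det; apply: contraTT; rewrite !negb_or !negbK => /andP[/eqP h1 /eqP h2].
by have [-> ->] := linear_eq0 det h1 h2; rewrite eqxx.
Qed.

Lemma moebius_neq0 (a b c e u : K) : a * e - b * c != 0 -> (a * u + b != 0) || (c * u + e != 0).
Proof.
by move=> det; have := @linear_neq0 a b c e u 1 det; rewrite !mulr1 oner_neq0 orbT => /(_ isT).
Qed.

Lemma moebius_surj (a b c e : K) z : a * e - b * c != 0 ->
  z = P1_point a c \/ exists u, z = moebius a b c e u.
Proof.
move=> det; rewrite -(P1_coordK z); have := P1_coord_neq0 z; move: (P1_coord z) => -[x y] /= xy.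
have [h|h] := eqVneq (a * y - c * x) 0; [left | right].
  apply: P1_point_eq => //.
    by have := @linear_neq0 a b c e 1 0 det; rewrite !mulr1 !mulr0 !addr0 oner_neq0; apply.
  by rewrite [x * c]mulrC; apply/esym/eqP; rewrite -subr_eq0 h.
exists ((e * x - b * y) / (a * y - c * x)); apply: P1_point_eq => //; first exact: moebius_neq0.
by field.
Qed.

Lemma moebius_inj (a b c e : K) : a * e - b * c != 0 -> injective (moebius a b c e).
Proof.
move=> det u v; rewrite /moebius => huv.
have [k k0 [h1 h2]] := P1_coord_point (moebius_neq0 u det).
have [l l0 [h3 h4]] := P1_coord_point (moebius_neq0 v det).
rewrite huv in h1 h2; move: (P1_coord _) h1 h2 h3 h4 => q h1 h2 h3 h4.
have : (a * e - b * c) * (u - v) == 0.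
  have -> : (a * e - b * c) * (u - v) = (a * u + b) * (c * v + e) - (a * v + b) * (c * u + e) by ring.
  by rewrite h1 h2 h3 h4; apply/eqP; ring.
by rewrite mulf_eq0 (negPf det) subr_eq0 => /eqP.
Qed.

Section OneChart.
Context (P Q : {poly K}) (a b c e : K).
Hypothesis ch : chart P Q a b c e.
Let det := chart_det ch.
Let sP := chart_num_size ch.
Let sQ := chart_den_size ch.

Lemma chart_no_common_zero : no_common_zero d P Q.
Proof.
split=> // x y hP hQ; have [_ _ nd] := rat_no_common_zero f.
have h1 := chart_num ch x y; have h2 := chart_den ch x y.
rewrite hP hQ !mulr0 addr0 in h1 h2.
by have [h3 h4] := nd _ _ h1 h2; apply: linear_eq0 det h3 h4.
Qed.

Lemma chart_coprime u : P.[u] = 0 -> Q.[u] != 0.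
Proof.
move=> Pu; apply/eqP => Qu; have [_ _ nd] := chart_no_common_zero.
have [] := nd u 1; rewrite ?hom_eval1 // => _ /eqP; by rewrite oner_eq0.
Qed.

(** If P = X Q, a zero of Q is a common zero, so Q is constant and P has degree at most 1. In degree
    d >= 2 both forms then vanish at infinity. *)
Lemma chart_fixed_neq0 (K_closed : alg_closed K) : (2 <= d)%N -> P - 'X * Q != 0.
Proof.
move=> d2; apply/eqP => /eqP; rewrite subr_eq0 => /eqP PE.
have Qroot u : Q.[u] != 0.
  apply/eqP => Qu; have : P.[u] = 0 by rewrite PE !hornerE Qu mulr0.
  by move=> /chart_coprime; rewrite Qu eqxx.
have [_ _ nd] := chart_no_common_zero.
have sQ1 : (size Q <= 1)%N.
  rewrite leqNgt; apply/negP => /K_closed [x /rootP Qx].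
  by have := Qroot x; rewrite Qx eqxx.
have sP2 : (size P <= 2)%N.
  have [Q0|Q0] := eqVneq Q 0; first by rewrite PE Q0 mulr0 size_poly0.
  by rewrite PE mulrC size_mulX.
have [] := nd 1 0; rewrite ?hom_eval_infty ?nth_default ?mul0r //.
- exact: leq_trans d2.
- by apply: leq_trans sQ1 _; apply: ltnW.
- by move=> /eqP; rewrite oner_eq0.
Qed.

Lemma chart_map u : Q.[u] != 0 -> rat_map f (moebius a b c e u) = moebius a b c e (frac_map P Q u).
Proof.
move=> Qu; rewrite rat_map_hom /moebius hom_map_point ?moebius_neq0 //.
have := chart_num ch u 1; have := chart_den ch u 1; rewrite !mulr1 => -> ->.
rewrite !hom_eval1 // -[RHS](@P1_pointZ _ Q.[u] _ _ Qu) /frac_map.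
by congr P1_point; field.
Qed.

Lemma chart_map_infty u : Q.[u] = 0 -> rat_map f (moebius a b c e u) = P1_point a c.
Proof.
move=> Qu; rewrite rat_map_hom /moebius hom_map_point ?moebius_neq0 //.
have := chart_num ch u 1; have := chart_den ch u 1; rewrite !mulr1 => -> ->.
rewrite !hom_eval1 // Qu !mulr0 !addr0 ![_ * P.[u]]mulrC P1_pointZ //.
by apply/eqP => /chart_coprime; rewrite Qu eqxx.
Qed.

Lemma chart_iter u k : (forall i, Q.[iter i (frac_map P Q) u] != 0) ->
  iter k (rat_map f) (moebius a b c e u) = moebius a b c e (iter k (frac_map P Q) u).
Proof. by move=> h; elim: k => //= k ->; rewrite chart_map. Qed.

Lemma chart_translate w :
  chart ((P - w *: Q) \Po ('X + w%:P)) (Q \Po ('X + w%:P)) a (a * w + b) c (c * w + e).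
Proof.
have tsize (S : {poly K}) : (size S <= d.+1)%N -> (size (S \Po ('X + w%:P)) <= d.+1)%N.
  by move=> sS; rewrite size_comp_poly2 // size_XaddC.
have heval (S : {poly K}) x y : (size S <= d.+1)%N ->
    hom_eval d (S \Po ('X + w%:P)) x y = hom_eval d S (x + w * y) y.
  move=> sS; have [->|y0] := eqVneq y 0.
    rewrite mulr0 addr0 !hom_eval_infty; congr (_ * _).
    have [|] := ltnP (size S) d.+1.
      by rewrite ltnS => lt; rewrite !nth_default // size_comp_poly2 // size_XaddC.
    move=> ge; have sE : size S = d.+1 by apply/anti_leq; rewrite sS ge.
    have sE' : size (S \Po ('X + w%:P)) = d.+1 by rewrite size_comp_poly2 ?size_XaddC.
    have := lead_coef_comp S (q := 'X + w%:P); rewrite size_XaddC => /(_ isT).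
    by rewrite /lead_coef sE sE' -/(lead_coef ('X + w%:P)) lead_coefXaddC expr1n mulr1.
  rewrite !hom_eval_horner ?tsize // horner_comp !hornerE; congr (_ * _.[_]).
  by field.
have sPw : (size (P - w *: Q)%R <= d.+1)%N.
  apply: leq_trans (size_polyD _ _) _; rewrite size_polyN geq_max sP /=.
  by apply: leq_trans (size_scale_leq _ _) _.
split=> [|||x y|x y]; try exact: tsize.
- by have := det; congr (_ != 0); ring.
- rewrite !heval // hom_evalD -scaleNr hom_evalCM.
  have := chart_num ch (x + w * y) y; set u := hom_eval d P _ _; set v := hom_eval d Q _ _.
  have -> : a * (x + w * y) + b * y = a * x + (a * w + b) * y by ring.
  have -> : c * (x + w * y) + e * y = c * x + (c * w + e) * y by ring.
  by move=> ->; ring.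
- rewrite !heval // hom_evalD -scaleNr hom_evalCM.
  have := chart_den ch (x + w * y) y; set u := hom_eval d P _ _; set v := hom_eval d Q _ _.
  have -> : a * (x + w * y) + b * y = a * x + (a * w + b) * y by ring.
  have -> : c * (x + w * y) + e * y = c * x + (c * w + e) * y by ring.
  by move=> ->; ring.
Qed.

Lemma chart_invert : chart (rev_poly d Q) (rev_poly d P) b a e c.
Proof.
split=> [|||x y|x y]; try exact: size_poly.
- by rewrite -oppr_eq0 opprB [X in X - _]mulrC; have := det; congr (_ != 0); ring.
- rewrite !hom_eval_rev [b * x + _]addrC [e * x + _]addrC [RHS]addrC; exact: (chart_num ch).
- rewrite !hom_eval_rev [b * x + _]addrC [e * x + _]addrC [RHS]addrC; exact: (chart_den ch).
Qed.

Lemma moebius_invert u : u != 0 -> moebius b a e c u = moebius a b c e u^-1.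
Proof.
move=> u0; rewrite /moebius -(@P1_pointZ _ u (a * _ + _)) //.
by congr P1_point; field.
Qed.

End OneChart.

Lemma chart_id : chart (rat_num f) (rat_den f) 1 0 0 1.
Proof.
have [sP sQ _] := rat_no_common_zero f; split=> // [|x y|x y].
- by rewrite mulr1 mulr0 subr0 oner_neq0.
- by rewrite !mul0r !mul1r !addr0 add0r.
- by rewrite !mul0r !mul1r !addr0 !add0r.
Qed.

End Charts.

(** * Moebius maps and the chordal metric *)

Section MoebiusMetric.
Context (R : realType) (K : fieldType) (abs : K -> R).
Hypothesis na : is_nonarch_abs abs.
Context (a b c e : K).
Hypothesis det : a * e - b * c != 0.

Local Notation chordal := (chordal abs).
Local Notation nrm x y := (Num.max (abs x) (abs y)).
Local Notation psi := (moebius a b c e).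

Lemma chordalC z w : chordal z w = chordal w z.
Proof. by rewrite !chordalE (nabs_sub na) [X in _ / X]mulrC. Qed.

Let ac0 : 0 < nrm a c.
Proof.
apply: nrm_gt0 => //; rewrite -negb_and; apply: contra det => /andP[/eqP -> /eqP ->].
by rewrite mul0r mulr0 subrr.
Qed.

Let det0 : 0 < abs (a * e - b * c).
Proof. by rewrite (nabs_gt0 na). Qed.

Lemma nrm_moebius u : abs (a * e - b * c) / nrm a c <= nrm (a * u + b) (c * u + e).
Proof.
rewrite ler_pdivrMr // [X in _ <= X]mulrC.
have -> : a * e - b * c = a * (c * u + e) - c * (a * u + b) by ring.
apply: (nabsB_le na) => //; rewrite (nabsM na) ler_pM ?(nabs_ge0 na) // le_max lexx ?orbT //.
Qed.

Lemma chordal_moebius_le : exists2 C, 0 < C & forall u v, chordal (psi u) (psi v) <= C * abs (u - v).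
Proof.
set D := abs (a * e - b * c); set k := D / nrm a c; have k0 : 0 < k by rewrite /k divr_gt0.
have D0 : 0 < D := det0.
have kk : 0 < k * k by exact: mulr_gt0.
exists (D / (k * k)); first by rewrite divr_gt0.
move=> u v; rewrite chordal_point ?moebius_neq0 //.
have -> : (a * u + b) * (c * v + e) - (a * v + b) * (c * u + e) = (a * e - b * c) * (u - v) by ring.
rewrite (nabsM na) -/D mulrAC ler_wpM2r ?(nabs_ge0 na) // ler_wpM2l ?(nabs_ge0 na) //.
have hu := nrm_moebius u; have hv := nrm_moebius v.
have nu := lt_le_trans k0 hu; have nv := lt_le_trans k0 hv.
have nn : 0 < nrm (a * u + b) (c * u + e) * nrm (a * v + b) (c * v + e) by exact: mulr_gt0.
by rewrite lef_pV2 ?posrE // ler_pM // ltW.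
Qed.

(** The local converse of [chordal_moebius_le]: apply the inverse matrix and control its denominator
    near psi(u0). *)
Lemma moebius_near u0 : exists eps C, [/\ 0 < eps, 0 <= C &
  forall z, chordal z (psi u0) < eps ->
    exists2 u, z = psi u & abs (u - u0) <= C * chordal z (psi u0)].
Proof.
set D := abs (a * e - b * c).
pose x0 := a * u0 + b; pose y0 := c * u0 + e.
have xy0 : (x0 != 0) || (y0 != 0) by apply: moebius_neq0.
have n0 : 0 < nrm x0 y0 by apply: nrm_gt0.
exists (D / (nrm a c * nrm x0 y0)), (nrm x0 y0 ^+ 2 / D); split.
- by rewrite divr_gt0 ?mulr_gt0.
- by rewrite divr_ge0 ?exprn_ge0 ?ltW.
move=> z; rewrite -(P1_coordK z); have := P1_coord_neq0 z; move: (P1_coord z) => -[x y] /= xy.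
rewrite [chordal _ _]chordal_point //; set X := x * _ - _ => h.
have n1 : 0 < nrm x y by apply: nrm_gt0.
have hX : nrm a c * abs X < D * nrm x y.
  move: h; rewrite ltr_pdivrMr ?mulr_gt0 // -/x0 -/y0 => h.
  rewrite -ltr_pdivlMl //; apply: lt_le_trans h _.
  rewrite le_eqVlt; apply/orP; left; apply/eqP; field.
  by rewrite !lt0r_neq0.
set w := a * y - c * x.
have w1 : w * x0 = (a * e - b * c) * x - a * X by rewrite /w /X /x0; ring.
have w2 : w * y0 = (a * e - b * c) * y - c * X by rewrite /w /X /y0; ring.
have aX : abs (a * X) < D * nrm x y.
  by apply: le_lt_trans hX; rewrite (nabsM na) ler_wpM2r ?(nabs_ge0 na) // le_max lexx.
have cX : abs (c * X) < D * nrm x y.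
  by apply: le_lt_trans hX; rewrite (nabsM na) ler_wpM2r ?(nabs_ge0 na) // le_max lexx orbT.
(* The vectors w (x0, y0) and det (x, y) differ by X (a, c), which is smaller than the second one
   because z is close to psi(u0); hence they have the same norm. *)
have wn : abs w * nrm x0 y0 = D * nrm x y.
  rewrite -nrmZ // w1 w2; apply/le_anti/andP; split.
    rewrite ge_max; apply/andP; split; apply: (nabsB_le na) => //; try exact: ltW;
    by rewrite (nabsM na) ler_pM2l // le_max lexx ?orbT.
  have [xy'|xy'] := leP (abs x) (abs y).
    rewrite (max_r xy') in aX cX *; rewrite le_max; apply/orP; right.
    by rewrite /D -(nabsM na) in cX *; rewrite (nabsBl na).
  rewrite (max_l (ltW xy')) in aX cX *; rewrite le_max; apply/orP; left.
  by rewrite /D -(nabsM na) in aX *; rewrite (nabsBl na).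
have w0 : w != 0.
  apply/eqP => w0; move: wn; rewrite w0 (nabs0 na) // mul0r => /esym/eqP.
  by rewrite mulf_eq0 (gt_eqF det0) (gt_eqF n1).
exists ((e * x - b * y) / w).
  apply: P1_point_eq => //; first exact: moebius_neq0.
  by rewrite /w; field; rewrite -/w.
have -> : (e * x - b * y) / w - u0 = X / w.
  by rewrite /X /w; field; rewrite -/w.
rewrite (nabs_div na) -/x0 -/y0.
have -> : abs w = D * nrm x y / nrm x0 y0 by rewrite -wn mulfK // lt0r_neq0.
rewrite le_eqVlt; apply/orP; left; apply/eqP; field.
by rewrite !lt0r_neq0.
Qed.

(** These two comparisons show that a set |l1| < |l2|, for independent linear forms
    l1 and l2, is a ball. *)
Lemma ltr_near_linear y0 w t s : abs y0 < s ->
  (abs (y0 * w + t) < s * abs w) = (abs t < s * abs w).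
Proof.
move=> ys; have [->|w0] := eqVneq w 0; first by rewrite !mulr0 add0r.
have h : abs (y0 * w) < s * abs w by rewrite (nabsM na) ltr_pM2r // (nabs_gt0 na).
have [lt|le] := ltP (abs t) (s * abs w); first by apply: (nabsD_lt na).
by rewrite (nabsDr na) ?(lt_le_trans h) // ltNge le.
Qed.

Lemma ltr_far_linear y0 c' w t s : 0 < s -> s * abs c' <= abs y0 ->
  (abs (y0 * w) < s * abs (t - c' * w)) = (abs (y0 * w) < s * abs t).
Proof.
move=> s0 ys; have [lt|le] := ltP (abs (c' * w)) (abs t); first by rewrite (nabsBl na).
have h : s * abs (c' * w) <= abs (y0 * w) by rewrite !(nabsM na) mulrA ler_wpM2r ?(nabs_ge0 na).
have -> : abs (y0 * w) < s * abs t = false.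
  by apply/negbTE; rewrite -leNgt; apply: le_trans h; rewrite ler_pM2l.
apply/negbTE; rewrite -leNgt; apply: le_trans h; rewrite ler_pM2l //; exact: (nabsB_le na).
Qed.

(** In homogeneous coordinates |u - u0| < r reads |x y0 - x0 y| < r |a y - c x|. If infinity
    satisfies this, the image is the complement of a closed disk centred at a / c, the image of
    infinity; otherwise it is an open disk centred at psi(u0) = x0 / y0. *)
Lemma moebius_open_ball u0 r : value_group abs r ->
  is_open_ball abs [set psi u | u in oball abs u0 r].
Proof.
move=> [c0 c00 hr]; have r0 : 0 < r by rewrite -hr (nabs_gt0 na).
pose x0 := a * u0 + b; pose y0 := c * u0 + e.
have xy0 : (x0 != 0) || (y0 != 0) by apply: moebius_neq0.
have memE x y : (x != 0) || (y != 0) -> [set psi u | u in oball abs u0 r] (P1_point x y) <->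
    abs (x * y0 - x0 * y) < r * abs (a * y - c * x).
  move=> xy; split.
    move=> [u ur]; have [k k0 [hx hy]] := P1_coord_point xy.
    have [l l0 [hx' hy']] := P1_coord_point (moebius_neq0 u det) => E.
    rewrite /moebius in E; rewrite E in hx' hy'.
    have hx2 : x = k / l * (a * u + b) by rewrite {1}hx hx' mulrA divfK.
    have hy2 : y = k / l * (c * u + e) by rewrite {1}hy hy' mulrA divfK.
    have kl : k / l != 0 by rewrite mulf_neq0 ?invr_eq0.
    rewrite hx2 hy2.
    have -> : k / l * (a * u + b) * y0 - x0 * (k / l * (c * u + e)) =
      k / l * (a * e - b * c) * (u - u0) by rewrite /x0 /y0; field.
    have -> : a * (k / l * (c * u + e)) - c * (k / l * (a * u + b)) = k / l * (a * e - b * c) by field.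
    by rewrite (nabsM na) mulrC ltr_pM2r // (nabs_gt0 na) mulf_neq0.
  move=> h; have w0 : a * y - c * x != 0.
    by apply/eqP => w0; move: h; rewrite w0 (nabs0 na) // mulr0 ltNge (nabs_ge0 na).
  exists ((e * x - b * y) / (a * y - c * x)).
    rewrite /oball /=.
    have -> : (e * x - b * y) / (a * y - c * x) - u0 = (x * y0 - x0 * y) / (a * y - c * x).
      by rewrite /x0 /y0; field.
    by rewrite (nabs_div na) ltr_pdivrMr // (nabs_gt0 na).
  apply/esym/P1_point_eq => //; first exact: moebius_neq0.
  by field.
have detE : y0 * a - x0 * c = a * e - b * c by rewrite /x0 /y0; ring.
have memS z : [set psi u | u in oball abs u0 r] (Some z) <-> abs (z * y0 - x0) < r * abs (a - c * z).
  have := memE z 1; rewrite /P1_point oner_eq0 divr1 !mulr1 orbT; exact.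
have memN : [set psi u | u in oball abs u0 r] None <-> abs y0 < r * abs c.
  have := memE 1 0; rewrite /P1_point eqxx !mulr0 oner_neq0 mul1r mulr1 subr0 sub0r (nabsN na) //; exact.
have y0x0 : y0 = 0 -> c = 0 -> False.
  by move=> y00 c00'; move/eqP: det; apply; rewrite -detE y00 c00' mul0r mulr0 subrr.
have [hc|hc] := ltP (abs y0) (r * abs c).
  have cn0 : c != 0.
    by apply/eqP => cn0; move: hc; rewrite cn0 (nabs0 na) // mulr0 ltNge (nabs_ge0 na).
  have ac : 0 < abs c by rewrite (nabs_gt0 na).
  exists (a / c), ((a * e - b * c) / c / (c0 * c)); split.
    by rewrite !mulf_neq0 ?invr_eq0 ?mulf_neq0.
  right; apply/seteqP.
  have E z : (abs (z * y0 - x0) < r * abs (a - c * z)) =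
      (abs ((a * e - b * c) / c / (c0 * c)) < abs (z - a / c)).
    have -> : z * y0 - x0 = y0 * (z - a / c) + (y0 * a - x0 * c) / c by field.
    have -> : a - c * z = - (c * (z - a / c)) by field.
    rewrite detE (nabsN na) (nabsM na) mulrA ltr_near_linear // [in RHS](nabs_div na).
    by rewrite [abs (c0 * c)](nabsM na) hr ltr_pdivrMr ?mulr_gt0 // [X in _ = (_ < X)]mulrC.
  split=> -[z|] //=.
  - by move=> /memS; rewrite E => h [z' + [zz']]; rewrite /= zz' leNgt h.
  - by move=> _ [].
  - move=> h; apply/memS; rewrite E ltNge; apply/negP => h2; apply: h; by exists z.
  - by move=> _; apply/memN.
have yn0 : y0 != 0.
  apply/eqP => y00; apply: (y0x0 y00); apply/eqP; rewrite -(nabs_eq0 na) eq_le (nabs_ge0 na) // andbT.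
  by rewrite y00 (nabs0 na) // pmulr_rle0 in hc.
have ay : 0 < abs y0 by rewrite (nabs_gt0 na).
exists (x0 / y0), (c0 * ((a * e - b * c) / y0) / y0); split.
  by rewrite !mulf_neq0 ?invr_eq0.
left; apply/seteqP.
have E z : (abs (z * y0 - x0) < r * abs (a - c * z)) =
    (abs (z - x0 / y0) < abs (c0 * ((a * e - b * c) / y0) / y0)).
  have -> : z * y0 - x0 = y0 * (z - x0 / y0) by field.
  have -> : a - c * z = (y0 * a - x0 * c) / y0 - c * (z - x0 / y0) by field.
  rewrite detE ltr_far_linear // [in RHS](nabs_div na) [abs (c0 * _)](nabsM na) hr.
  by rewrite ltr_pdivlMr // (nabsM na) mulrC.
split=> -[z|] //=.
- by move=> /memS; rewrite E => h; exists z.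
- by move=> /memN; rewrite ltNge hc.
- by move=> [z' /= h [<-]]; apply/memS; rewrite E.
- by move=> [].
Qed.

End MoebiusMetric.

(** * From a chart back to the projective line *)

Section Transfer.
Context (R : realType) (K : fieldType) (abs : K -> R) (p : nat).
Hypothesis (na : is_nonarch_abs abs) (K_closed : alg_closed K).
Hypothesis (p_prime : prime p) (abs_p : 0 < abs p%:R < 1).
Context (f : ratfun K) (P Q : {poly K}) (a b c e : K).
Hypothesis ch : chart f P Q a b c e.
Hypothesis f_degree : (0 < rat_degree f)%N.
Variable X : set (P1 K).

Local Notation psi := (moebius a b c e).
Local Notation g := (frac_map P Q).
Let det := chart_det ch.

(** The image of the disk is a single open ball, hence an open affinoid. It lies in the basin and
    contains both the periodic point and a point of X, so that point belongs to the immediate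
    basin. *)
Lemma attracting_disk_transfer : attracting_disk abs P Q [set u | X (psi u)] ->
  exists2 z0, is_attracting abs f z0 & X `&` immediate_basin abs f z0 !=set0.
Proof.
move=> [z0 [r [n [vr [n0 fz0 per] [x Xx xr] hQ hth]]]].
have r0 := vg_gt0 na vr.
have [C C0 hC] := chordal_moebius_le na det.
have z0r : oball abs z0 r z0 by rewrite /oball /= subrr (nabs0 na).
have it k u : oball abs z0 r u -> iter k (rat_map f) (psi u) = psi (iter k g u).
  by move=> ur; apply: (chart_iter ch) => i; apply: hQ.
exists (psi z0).
  apply: (geometric_is_attracting na K_closed abs_p f_degree (n := n)).
    split=> //; first by rewrite it // fz0.
    by move=> m mn; rewrite it // => /(moebius_inj det); apply: per.
  (* Applying the rate hypothesis to a point at distance exactly rho from z0 fixes one rate for the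
     whole closed disk of radius rho. *)
  have [rho vrho /andP[rho0 rhor]] := vg_dense na K_closed abs_p (lexx 0) r0.
  have [c0 c00 hc0] := vrho.
  have z1 : abs (z0 + c0 - z0) = rho by rewrite addrC addKr.
  have [|th th01 hth1] := hth (z0 + c0); first by rewrite /oball /= z1.
  have [eps [D [eps0 D0 hD]]] := moebius_near na det z0.
  have D1 : 0 < D + 1 by lra.
  exists (C * D), th, (Num.min eps (rho / (D + 1))); split=> //.
    by rewrite lt_min eps0 divr_gt0.
  move=> y; rewrite lt_min => /andP[/hD [u -> hu]] hrho k.
  rewrite ltr_pdivlMr // in hrho.
  have ur : abs (u - z0) <= rho.
    apply: le_trans hu _; apply: le_trans (ltW hrho).
    by rewrite mulrC ler_wpM2l ?chordal_ge0 //; lra.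
  rewrite -iterM mulnC it; last by apply: le_lt_trans ur _.
  apply: le_trans (hC _ _) _; rewrite -!mulrA ler_pM2l //.
  have := hth1 u; rewrite z1 => /(_ ur k) /le_trans; apply.
  rewrite mulrCA; apply: ler_wpM2l => //; apply: exprn_ge0; by case/andP: th01.
exists (psi x); split=> //.
exists [set psi u | u in oball abs z0 r]; last by exists x.
split; last by exists z0.
  split; first by exists (psi z0), z0.
  exists 0%N, (fun=> [set psi u | u in oball abs z0 r]); split.
    by move=> _; apply: moebius_open_ball.
  by apply/seteqP; split=> [z hz i _|z h]; [exact: hz | exact: (h ord0 I)].
move=> _ [u ur <-]; apply/cvg0P => [k|eps eps0]; first exact: chordal_ge0.
have [rho vrho /andP[urho rhor]] := vg_dense na K_closed abs_p (nabs_ge0 na _) ur.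
have sub : cball abs z0 rho `<=` oball abs z0 r by apply: cball_subset_oball.
have hlip i : exists2 M, 0 <= M & forall y, cball abs z0 rho y ->
    abs (iter i g y - iter i g z0) <= M * abs (y - z0).
  have hr : rational_on (cball abs z0 rho) (iter i g).
    by apply: frac_map_iter_rational => y k /sub; apply: hQ.
  have [M M0 hM] := rational_on_lipschitz na K_closed vrho hr.
  exists M => // y Dy; apply: hM => //.
  by rewrite /cball /= subrr (nabs0 na) // ltW // (vg_gt0 na vrho).
(* Decay is known along multiples of n; the fewer than n remaining iterates share the Lipschitz
   constant M. *)
have [M M0 hM] : exists2 M, 0 <= M & forall i y, (i < n)%N -> cball abs z0 rho y ->
    abs (iter i g y - iter i g z0) <= M * abs (y - z0).
  elim: (n) => [|m [M M0 IH]]; first by exists 0.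
  have [M' M'0 hM'] := hlip m; exists (Num.max M M'); first by rewrite le_max M0.
  move=> i y; rewrite ltnS leq_eqVlt => /orP[/eqP -> Dy|im Dy].
    by apply: le_trans (hM' y Dy) _; rewrite ler_wpM2r ?(nabs_ge0 na) // le_max lexx orbT.
  by apply: le_trans (IH i y im Dy) _; rewrite ler_wpM2r ?(nabs_ge0 na) // le_max lexx.
have [th th01 hth1] := hth u ur; have /andP[th0 th1] := th01.
have CM0 : 0 <= C * (M * abs (u - z0)) by rewrite !mulr_ge0 ?(nabs_ge0 na) // ltW.
have [J hJ] := expr_small th01 (divr_gt0 eps0 (ltr_wpDl CM0 ltr01)).
exists (n * J)%N => k kJ; rewrite !it //; apply: le_lt_trans (hC _ _) _.
have kE : k = (k %% n + n * (k %/ n))%N by rewrite mulnC addnC -divn_eq.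
have Jk : (J <= k %/ n)%N by rewrite leq_divRL // mulnC.
rewrite kE !iterD; have -> : iter (n * (k %/ n)) g z0 = z0.
  by elim: (k %/ n)%N => [|m IH]; rewrite ?muln0 // mulnS iterD IH.
have hj := hth1 u (lexx _) (k %/ n)%N.
have Dj : cball abs z0 rho (iter (n * (k %/ n)) g u).
  apply: le_trans hj _; apply: le_trans (ltW urho).
  by rewrite ler_piMl ?(nabs_ge0 na) // exprn_ile1 // ltW.
apply: (@le_lt_trans _ _ (C * (M * (th ^+ J * abs (u - z0))))).
  rewrite ler_pM2l //; apply: le_trans (hM _ _ _ Dj) _; first by rewrite ltn_mod.
  rewrite ler_wpM2l //; apply: le_trans hj _; rewrite ler_wpM2r ?(nabs_ge0 na) //.
  by apply: ler_wiXn2l => //; exact: ltW.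
have -> : C * (M * (th ^+ J * abs (u - z0))) = th ^+ J * (C * (M * abs (u - z0))) by ring.
rewrite ltr_pdivlMr in hJ; last by apply: ltr_wpDl.
apply: le_lt_trans hJ; rewrite ler_wpM2l ?exprn_ge0 // lerDl ler01 //.
Qed.

(** By [moebius_near] a small chordal ball around psi(x) lies in the image of the recurrent disk, so
    psi(x) is interior to the set of recurrent points. *)
Lemma recurrent_disk_transfer : recurrent_disk abs p P Q [set u | X (psi u)] ->
  X `&` quasi_periodicity_domain abs f !=set0.
Proof.
move=> [x [r [n [r0 n0 Xx hQ hrec]]]]; exists (psi x); split=> //.
have [C C0 hC] := chordal_moebius_le na det.
have [eps [D [eps0 D0 hD]]] := moebius_near na det x.
have D1 : 0 < D + 1 by lra.
exists (Num.min eps (r / (D + 1))); first by rewrite lt_min eps0 divr_gt0.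
move=> z /=; rewrite chordalC // lt_min => /andP[/hD [u -> hu]] hr.
rewrite ltr_pdivlMr // in hr.
have ur : cball abs x r u.
  apply: le_trans hu _; apply: le_trans (ltW hr).
  by rewrite mulrC ler_wpM2l ?chordal_ge0 //; lra.
exists (fun k => (p ^ k * n)%N); split.
  apply/cvgnyPge => N; exists N => // k /= Nk.
  apply: leq_trans Nk _; apply: leq_trans (ltnW (ltn_expl k (prime_gt1 p_prime))) _.
  by rewrite leq_pmulr.
have := hrec u ur => /(cvg0P (fun k => nabs_ge0 na _)) h.
apply/cvg0P => [k|t t0]; first exact: chordal_ge0.
have [N hN] := h (t / C) (divr_gt0 t0 C0); exists N => k /hN.
rewrite ltr_pdivlMr // mulrC => hk.
rewrite (chart_iter ch) => [|i]; last exact: hQ.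
exact: le_lt_trans (hC _ _) hk.
Qed.

End Transfer.

(** * Analytic spaces *)

Section AnalyticSpaces.
Context (R : realType) (K : fieldType) (abs : K -> R).
Hypothesis na : is_nonarch_abs abs.

Lemma closed_disk_point alpha s x y : (x != 0) || (y != 0) ->
  closed_disk abs alpha s (P1_point x y) <-> abs (x - alpha * y) <= s * abs y.
Proof.
rewrite /P1_point; have [->|y0] := eqVneq y 0.
  rewrite orbF => x0; split; first by move=> [].
  by rewrite mulr0 subr0 (nabs0 na) // mulr0 leNgt (nabs_gt0 na) x0.
move=> _; have -> : x - alpha * y = (x / y - alpha) * y by field.
rewrite (nabsM na) ler_pM2r ?(nabs_gt0 na) //; split=> [[z h [<-]]//|h]; by exists (x / y).
Qed.

Lemma open_disk_point alpha s x y : (x != 0) || (y != 0) ->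
  open_disk abs alpha s (P1_point x y) <-> abs (x - alpha * y) < s * abs y.
Proof.
rewrite /P1_point; have [->|y0] := eqVneq y 0.
  rewrite orbF => x0; split; first by move=> [].
  by rewrite mulr0 subr0 (nabs0 na) // mulr0 ltNge (nabs_ge0 na).
move=> _; have -> : x - alpha * y = (x / y - alpha) * y by field.
rewrite (nabsM na) ltr_pM2r ?(nabs_gt0 na) //; split=> [[z h [<-]]//|h]; by exists (x / y).
Qed.

Context (a b c e : K).
Hypothesis det : a * e - b * c != 0.
Local Notation psi := (moebius a b c e).

(** Both kinds of closed balls become one comparison of affine forms in u. The absence of a common
    zero makes the right-hand form nonzero on the ball. *)
Lemma closed_ball_linear B : is_closed_ball abs B -> exists s1 t1 s2 t2,
  (forall u, B (psi u) <-> abs (s1 * u + t1) <= abs (s2 * u + t2)) /\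
  forall u, (s1 * u + t1 != 0) || (s2 * u + t2 != 0).
Proof.
move=> [alpha [gam [gam0 hB]]].
have E1 u : a * u + b - alpha * (c * u + e) = (a - alpha * c) * u + (b - alpha * e) by ring.
have E2 u : gam * (c * u + e) = gam * c * u + gam * e by ring.
have nz u : (a * u + b - alpha * (c * u + e) != 0) || (gam * (c * u + e) != 0).
  rewrite mulf_eq0 (negPf gam0) /=; have := moebius_neq0 u det.
  by have [->|] := eqVneq (c * u + e) 0; rewrite ?orbT // mulr0 subr0.
case: hB => ->.
  exists (a - alpha * c), (b - alpha * e), (gam * c), (gam * e); split=> u; rewrite -E1 -E2 //.
  by rewrite (nabsM na); apply: closed_disk_point; apply: moebius_neq0.
exists (gam * c), (gam * e), (a - alpha * c), (b - alpha * e); split=> u; rewrite -E1 -E2 1?orbC //.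
rewrite (nabsM na) leNgt.
have := open_disk_point alpha (abs gam) (moebius_neq0 u det).
rewrite /setC /mkset => -[h1 h2]; split=> [h|/negP h /h1 //]; by apply/negP => /h2.
Qed.

(** The inequalities at u and v bound the slope s1 through the difference of the two values. So the
    left side is at most max(|s2 u + t2|, |s2| r) on D(u, r), and away from the zero of the
    right-hand form this maximum is at most |s2 z + t2|. *)
Lemma linear_convex s1 t1 s2 t2 u v z r :
  abs (s1 * u + t1) <= abs (s2 * u + t2) -> abs (s1 * v + t1) <= abs (s2 * v + t2) ->
  r <= abs (u - v) -> abs (z - u) <= r -> r <= abs (z - - t2 / s2) ->
  abs (s1 * z + t1) <= abs (s2 * z + t2).
Proof.
move=> hu hv ruv zu zc.
have r0 : 0 <= r by apply: le_trans zu; apply: (nabs_ge0 na).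
have s1uv : abs s1 * abs (u - v) <= Num.max (abs (s2 * u + t2)) (abs s2 * abs (u - v)).
  rewrite -(nabsM na); have -> : s1 * (u - v) = (s1 * u + t1) - (s1 * v + t1) by ring.
  apply: (nabsB_le na) => //; first by rewrite le_max hu.
  apply: le_trans hv _; have -> : s2 * v + t2 = (s2 * u + t2) - s2 * (u - v) by ring.
  by apply: (nabsB_le na) => //; rewrite le_max ?(nabsM na) lexx ?orbT.
have s1r : abs s1 * r <= Num.max (abs (s2 * u + t2)) (abs s2 * r).
  have [uv0|uv0] := eqVneq (abs (u - v)) 0.
    have -> : r = 0 by apply/le_anti; rewrite r0 -uv0 ruv.
    by rewrite mulr0 le_max (nabs_ge0 na).
  have uvp : 0 < abs (u - v) by rewrite lt_def uv0 (nabs_ge0 na).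
  move: s1uv; rewrite le_max => /orP[h|].
    by rewrite le_max; apply/orP; left; apply: le_trans h; rewrite ler_wpM2l ?(nabs_ge0 na).
  by rewrite ler_pM2r // => h; rewrite le_max; apply/orP; right; rewrite ler_wpM2r.
have L1 : abs (s1 * z + t1) <= Num.max (abs (s2 * u + t2)) (abs s2 * r).
  have -> : s1 * z + t1 = (s1 * u + t1) + s1 * (z - u) by ring.
  apply: (nabsD_le na) => //; first by rewrite le_max hu.
  by apply: le_trans s1r; rewrite (nabsM na) ler_wpM2l ?(nabs_ge0 na).
apply: le_trans L1 _; rewrite ge_max.
(* For s2 = 0 the excluded point -t2 / s2 is the junk value 0; the right-hand form is then constant
   and the bound holds without it. *)
have [s20|s20] := eqVneq s2 0.
  by rewrite s20 !mul0r (nabs0 na) // mul0r lexx (nabs_ge0 na).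
have hz : abs (s2 * z + t2) = abs s2 * abs (z - - t2 / s2).
  by rewrite -(nabsM na); congr abs; field.
have h2 : abs s2 * r <= abs (s2 * z + t2) by rewrite hz ler_wpM2l ?(nabs_ge0 na).
rewrite h2 andbT.
have -> : s2 * u + t2 = (s2 * z + t2) - s2 * (z - u) by ring.
apply: (nabsB_le na) => //; apply: le_trans h2; by rewrite (nabsM na) ler_wpM2l ?(nabs_ge0 na).
Qed.

Lemma affinoid_convex A u v r : is_closed_affinoid abs A -> A (psi u) -> A (psi v) ->
  r <= abs (u - v) -> exists L : seq K, forall z, abs (z - u) <= r ->
    (forall x, x \in L -> r <= abs (z - x)) -> A (psi z).
Proof.
move=> [_ [n [B [hB ->]]]] Au Av ruv.
have H (i : 'I_n.+1) : exists x, forall z, abs (z - u) <= r -> r <= abs (z - x) -> B i (psi z).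
  have [s1 [t1 [s2 [t2 [h _]]]]] := closed_ball_linear (hB i).
  exists (- t2 / s2) => z zu zc; apply/h; apply: (linear_convex _ _ ruv zu zc).
    by apply/h; apply: Au.
  by apply/h; apply: Av.
exists [seq projT1 (cid (H i)) | i <- enum 'I_n.+1] => z zu hz i _.
apply: (projT2 (cid (H i))) => //; apply: hz; apply: map_f; exact: mem_enum.
Qed.

Lemma affinoid_open A u : is_closed_affinoid abs A -> A (psi u) ->
  exists2 del, 0 < del & forall z, abs (z - u) < del -> A (psi z).
Proof.
move=> [_ [n [B [hB ->]]]] Au.
have H (i : 'I_n.+1) : exists2 del, 0 < del & forall z, abs (z - u) < del -> B i (psi z).
  have [s1 [t1 [s2 [t2 [h nz]]]]] := closed_ball_linear (hB i).
  have hu : abs (s1 * u + t1) <= abs (s2 * u + t2) by apply/h; apply: Au.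
  have L0 : 0 < abs (s2 * u + t2).
    rewrite lt_def (nabs_ge0 na) // andbT (nabs_eq0 na); apply/eqP => e0.
    move: hu (nz u); rewrite e0 (nabs0 na) // eqxx orbF => hu.
    by rewrite -(nabs_gt0 na) ltNge hu.
  set S := Num.max (abs s1) (abs s2) + 1.
  have S0 : 0 < S by rewrite ltr_wpDl // le_max (nabs_ge0 na).
  exists (abs (s2 * u + t2) / S); first by rewrite divr_gt0.
  move=> z; rewrite ltr_pdivlMr // => hz; apply/h.
  have small s : abs s <= S -> abs (s * (z - u)) < abs (s2 * u + t2).
    by move=> sS; apply: le_lt_trans hz; rewrite (nabsM na) mulrC ler_wpM2l ?(nabs_ge0 na).
  have s1S : abs s1 <= S by rewrite /S; apply: ler_wpDr => //; rewrite le_max lexx.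
  have s2S : abs s2 <= S by rewrite /S; apply: ler_wpDr => //; rewrite le_max lexx orbT.
  have -> : s1 * z + t1 = (s1 * u + t1) + s1 * (z - u) by ring.
  have -> : s2 * z + t2 = (s2 * u + t2) + s2 * (z - u) by ring.
  by rewrite (nabsDl na (small s2 s2S)); apply: (nabsD_le na) => //; apply: ltW; apply: small.
pose D i := s2val (cid2 (H i)).
have [del del0 hdel] : exists2 del : R, 0 < del & forall i, i \in enum 'I_n.+1 -> del <= D i.
  elim: (enum _) => [|i s [del del0 IH]]; first by exists 1.
  exists (Num.min (D i) del); first by rewrite lt_min del0 andbT /D; case: cid2.
  move=> k; rewrite inE => /orP[/eqP ->|/IH ks]; rewrite ge_min ?lexx // ks orbT //.
exists del => // z zu i _; apply: (s2valP' (cid2 (H i))).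
by apply: lt_le_trans zu _; apply: hdel; apply: mem_enum.
Qed.

Context (X : set (P1 K)).
Hypothesis (X_analytic : is_analytic_space abs X) (X_infty : ~ X (P1_point a c)).

(** Points u and v may lie in different affinoids. If they are at distance at least r, the common
    point w is at distance at least r from one of them, and a single affinoid suffices: the one of
    u, or that of v with w, in the same disk as u, as centre. *)
Lemma analytic_space_convex u v r : X (psi u) -> X (psi v) -> r <= abs (u - v) ->
  exists L : seq K, forall z, abs (z - u) <= r ->
    (forall x, x \in L -> r <= abs (z - x)) -> X (psi z).
Proof.
move=> Xu Xv ruv; have [F [x [F0 FA XE]]] := X_analytic.
have inX A : F A -> A `<=` X by move=> FA' z Az; rewrite XE; exists A.
have [w xw] : exists w, x = psi w.
  have [xE|//] := moebius_surj x det; case: X_infty; rewrite -xE.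
  by have [A FA'] := F0; apply: (inX A FA'); have [] := FA A FA'.
move: Xu Xv; rewrite {1 2}XE => -[A FA1 Au] [B FB1 Bv].
have [affA Ax] := FA A FA1; have [affB Bx] := FA B FB1; rewrite xw in Ax Bx.
have [h|h] := leP r (abs (u - w)).
  have [L hL] := affinoid_convex affA Au Ax h.
  by exists L => z zu zL; apply: (inX A FA1); apply: hL.
have wv : r <= abs (w - v).
  rewrite leNgt; apply/negP => h2; have : abs (u - v) < r by apply: (nabs_dist_lt na h).
  by rewrite ltNge ruv.
have [L hL] := affinoid_convex affB Bx Bv wv.
exists L => z zu zL; apply: (inX B FB1); apply: hL => //.
by apply: (nabs_dist_le na zu); exact: ltW.
Qed.

Lemma analytic_space_two_points (pi : K) : 0 < abs pi < 1 ->
  exists u v, [/\ X (psi u), X (psi v) & u != v].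
Proof.
move=> /andP[p0 p1]; have [F [x [[A FA'] FA XE]]] := X_analytic.
have inX : A `<=` X by move=> z Az; rewrite XE; exists A.
have [affA Ax] := FA A FA'.
have [xE|[w xw]] := moebius_surj x det; first by case: X_infty; rewrite -xE; apply: inX.
rewrite xw in Ax; have [del del0 hdel] := affinoid_open affA Ax.
have [n hn] := expr_small (introT andP (conj (ltW p0) p1)) del0.
exists w, (w + pi ^+ n); split; first exact: inX.
  by apply/inX/hdel; rewrite addrC addKr (nabsX na).
rewrite -subr_eq0 opprD addrA subrr add0r oppr_eq0 expf_neq0 //.
by rewrite -(nabs_gt0 na).
Qed.

End AnalyticSpaces.

(** * Choice of the chart and conclusion *)

Section Main.
Context (R : realType) (K : fieldType) (abs : K -> R) (p : nat).
Hypothesis (na : is_nonarch_abs abs) (K_closed : alg_closed K).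
Hypothesis (p_prime : prime p) (abs_p : 0 < abs p%:R < 1).
Hypothesis res_alg : residue_algebraic abs p.
Context (f : ratfun K).
Hypothesis f_degree : (2 <= rat_degree f)%N.
Variable X : set (P1 K).
Hypothesis (X_analytic : is_analytic_space abs X) (X_invariant : rat_map f @` X `<=` X).

Local Notation vg := (value_group abs).

(** The condition on Q says that infinity is not fixed. If it is fixed, some finite z is not, since
    N is nonzero; translate z to 0 and invert. *)
Lemma exists_chart_infty_not_fixed : exists P Q a b c e,
  chart f P Q a b c e /\ Q`_(rat_degree f) != 0.
Proof.
have ch0 := chart_id f.
have [Q0|Q0] := eqVneq (rat_den f)`_(rat_degree f) 0; last first.
  by exists (rat_num f), (rat_den f), 1, 0, 0, 1.
have N0 := chart_fixed_neq0 ch0 K_closed f_degree; set N := _ - _ in N0.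
have v1 : vg 1 by exists 1; rewrite ?oner_neq0 ?(nabs1 na).
have [z [_ _ hz]] := gn_gen na K_closed [:: N] [::] 0 v1.
have Nz : N.[z] != 0.
  by rewrite -(nabs_gt0 na) hz ?inE ?eqxx // gn_gt0.
have ch := chart_invert (chart_translate ch0 z).
do 6!eexists; split; first exact: ch.
rewrite coef_poly ltnSn subnn -horner_coef0 horner_comp !hornerE.
by move: Nz; rewrite /N !hornerE.
Qed.

Lemma bounded_chart_periodic_disk (P Q : {poly K}) a b c e M : chart f P Q a b c e ->
  ~ X (P1_point a c) -> (forall u, X (moebius a b c e u) -> abs u <= M) ->
  periodic_disk abs P Q [set u | X (moebius a b c e u)].
Proof.
move=> ch Xinf hM; have det := chart_det ch.
have [x0 [x1 [Xx0 Xx1 x01]]] := analytic_space_two_points na det X_analytic Xinf abs_p.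
have inv z : X z -> X (rat_map f z) by move=> Xz; apply: X_invariant; exists z.
apply: (bounded_invariant_periodic_disk na K_closed p_prime abs_p res_alg
  (chart_coprime ch) (chart_fixed_neq0 ch K_closed f_degree) _ hM Xx0 Xx1 x01).
  (* A pole u in X would be sent to the infinity of the chart, which is not in X. *)
  move=> u /= Xu; have := inv _ Xu; have [Qu|Qu] := eqVneq Q.[u] 0.
    by rewrite (chart_map_infty ch Qu).
  by rewrite (chart_map ch Qu).
move=> u v r Xu Xv _ ruv; exact: (analytic_space_convex na det X_analytic Xinf Xu Xv ruv).
Qed.

(** R(z) = z E(z) / Q(z) with |E(0)| <= |Q(0)|. On a disk so small that E and Q vary by less than
    |Q(0)|, this gives |R(z)| <= |z|. *)
Lemma nonrepelling_periodic_disk (P Q : {poly K}) (Y : set K) :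
  P.[0] = 0 -> Q.[0] != 0 -> abs P^`().[0] <= abs Q.[0] ->
  (forall del, 0 < del -> exists2 u, Y u & abs u < del) -> periodic_disk abs P Q Y.
Proof.
move=> P0 Q0 dP hY.
have [E defE] : exists E, P = E * ('X - 0%:P) by apply/factor_theorem/rootP.
rewrite polyC0 subr0 in defE.
have E0 : E.[0] = P^`().[0].
  by rewrite defE derivM derivX mulr1 !hornerE.
have Q0' : 0 < abs Q.[0] by rewrite (nabs_gt0 na).
have [M1 M10 hM1] := poly_lipschitz na Q 0 1.
have [M2 M20 hM2] := poly_lipschitz na E 0 1.
have M3 : 0 < M1 + M2 + 1 by lra.
have [r vr /andP[r0 hr]] : exists2 r, vg r & 0 < r < Num.min 1 (abs Q.[0] / (M1 + M2 + 1)).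
  by apply: (vg_dense na K_closed abs_p (lexx 0)); rewrite lt_min ltr01 divr_gt0.
move: hr; rewrite lt_min ltr_pdivlMr // => /andP[r1 hr].
have [x Yx xr] := hY r r0.
apply: (invariant_periodic_disk vr Yx (a := 0)); first by rewrite subr0.
move=> z; rewrite subr0 => zr.
have z1 : abs (z - 0) <= 1 by rewrite subr0; apply: ltW; apply: lt_trans r1.
have small M : 0 <= M -> M <= M1 + M2 + 1 -> M * abs (z - 0) < abs Q.[0].
  move=> M0 hM; rewrite subr0; apply: le_lt_trans hr.
  by rewrite mulrC ler_pM ?(nabs_ge0 na) // ltW.
have Qz : abs Q.[z] = abs Q.[0].
  have -> : Q.[z] = Q.[0] + (Q.[z] - Q.[0]) by ring.
  by apply: (nabsDl na) => //; apply: le_lt_trans (hM1 z z1) _; apply: small => //; lra.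
have Ez : abs E.[z] <= abs Q.[0].
  have -> : E.[z] = E.[0] + (E.[z] - E.[0]) by ring.
  apply: (nabsD_le na) => //; first by rewrite E0.
  by apply: le_trans (hM2 z z1) _; apply: ltW; apply: small => //; lra.
split; first by rewrite -(nabs_gt0 na) Qz.
rewrite subr0 /frac_map defE !hornerE (nabs_div na) (nabsM na) Qz ltr_pdivrMr //.
apply: (@le_lt_trans _ _ (abs Q.[0] * abs z)); first by rewrite ler_wpM2r ?(nabs_ge0 na).
by rewrite mulrC ltr_pM2r.
Qed.

Lemma exists_chart_periodic_disk : exists P Q a b c e,
  chart f P Q a b c e /\ periodic_disk abs P Q [set u | X (moebius a b c e u)].
Proof.
have [P [Q [a [b [c [e [ch Qd]]]]]]] := exists_chart_infty_not_fixed.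
have [w Pw dPw] := nonrepelling_fixed_point na K_closed (chart_num_size ch) (chart_den_size ch) Qd.
have Qw : Q.[w] != 0.
  by apply/eqP => Qw; have := chart_coprime ch (u := w); rewrite Pw Qw mulr0 eqxx => /(_ erefl).
have ch3 := chart_translate ch w.
set P3 := (P - _) \Po _ in ch3; set Q3 := Q \Po _ in ch3.
have [[del del0 hdel]|near0] := pselect (exists2 del, 0 < del &
    forall u, X (moebius a (a * w + b) c (c * w + e) u) -> del <= abs u); last first.
  do 6!eexists; split; first exact: ch3.
  apply: nonrepelling_periodic_disk.
  - by rewrite /P3 horner_comp !hornerE Pw subrr.
  - by rewrite /Q3 horner_comp !hornerE.
  - have dX : ('X + w%:P)^`() = 1 by rewrite derivD derivX derivC addr0.
    by rewrite /P3 /Q3 deriv_comp dX mulr1 !horner_comp derivB derivZ !hornerE.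
  move=> del del0; apply: contrapT => H; apply: near0; exists del => // u Xu.
  by rewrite leNgt; apply/negP => h; apply: H; exists u.
have ch4 := chart_invert ch3.
do 6!eexists; split; first exact: ch4.
(* After inversion X lies in the disk of radius 1 / del, and the infinity of the new chart is the
   old origin, which X avoids. *)
apply: (@bounded_chart_periodic_disk _ _ _ _ _ _ del^-1 ch4).
  move=> X0; have := hdel 0; rewrite /moebius !mulr0 !add0r => /(_ X0).
  by rewrite (nabs0 na) // leNgt del0.
move=> u; have [->|u0] := eqVneq u 0; first by rewrite (nabs0 na) // invr_ge0 ltW.
rewrite (moebius_invert _ _ _ _ u0) => /hdel; rewrite (nabsV na) => h.
by rewrite -[abs u]invrK lef_pV2 ?posrE ?invr_gt0 ?(nabs_gt0 na).
Qed.

Lemma invariant_analytic_space :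
  (exists2 z0 : P1 K, is_attracting abs f z0 & X `&` immediate_basin abs f z0 !=set0) \/
  X `&` quasi_periodicity_domain abs f !=set0.
Proof.
have [P [Q [a [b [c [e [ch hD]]]]]]] := exists_chart_periodic_disk.
have d0 : (0 < rat_degree f)%N by apply: ltnW.
have [h|h] := periodic_disk_alternative na K_closed p_prime abs_p res_alg hD; [left|right].
  exact: (attracting_disk_transfer na K_closed abs_p ch d0 h).
exact: (recurrent_disk_transfer na p_prime ch h).
Qed.

End Main.

Theorem propositionA (R : realType) (p : nat) (C : fieldType) (abs : C -> R)
    (p_prime : prime p) (C_Cp : is_Cp p abs)
    (f : ratfun C) (f_degree : (2 <= rat_degree f)%N)
    (X : set (P1 C)) (X_analytic : is_analytic_space abs X)
    (X_invariant : rat_map f @` X `<=` X) :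
  (exists2 z0 : P1 C, is_attracting abs f z0
     & X `&` immediate_basin abs f z0 !=set0) \/
  X `&` quasi_periodicity_domain abs f !=set0.
Proof.
exact: (invariant_analytic_space (Cp_nonarch C_Cp) (Cp_alg_closed C_Cp) p_prime
  (Cp_abs_p p_prime C_Cp) (Cp_residue_algebraic p_prime C_Cp) f_degree X_analytic X_invariant).
Qed.
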